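(* Let $n\ge2$, let $1\le r\le n-1$ and let $\mathbf{r}=(i_1,\dots,i_r)$ be integers with $1\le i_1<\cdots<i_r\le n-1$. Let $f$ be a bounded integrable function on $\mathbb{R}^n$, and set $$I(f)=\int_{F^n_{\mathbf{r}}}\prod_{j=1}^r\big\|f|_{F_j}\big\|_1^{\,i_{j+1}-i_{j-1}}\,d\xi_{\mathbf{r}} .$$ Then for every $g\in SL_n$, $I(g\cdot f)=I(f)$.
   Context: Put $i_0=0$ and $i_{r+1}=n$. $F^n_{\mathbf{r}}$ is the partial flag manifold of all $\xi_{\mathbf{r}}=(F_1,\dots,F_r)$ where $F_1\subset\cdots\subset F_r$ are linear subspaces of $\mathbb{R}^n$ with $\dim F_j=i_j$; it carries its unique $SO_n$-invariant probability measure $d\xi_{\mathbf{r}}$. $\|f|_{F}\|_1=\int_F|f(x)|\,dx$ is the $L_1$-norm of the restriction of $f$ to the subspace $F$ with respect to Lebesgue measure on $F$. For $g\in SL_n$, $(g\cdot f)(x)=f(g^{-1}x)$. *)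

(* Defs.v *)
From HB Require Import structures.
From mathcomp Require Import all_boot all_order all_algebra.
From mathcomp Require Import all_classical all_reals all_analysis.

Set Implicit Arguments.
Unset Strict Implicit.
Unset Printing Implicit Defensive.

Import Order.TTheory GRing.Theory Num.Theory.
Import numFieldNormedType.Exports.

Local Open Scope classical_set_scope.
Local Open Scope ring_scope.

Section measurable_mx.
Context {R : realType} {m n : nat}.

Definition mx_cylinder : set (set 'M[R]_(m, n)) :=
  [set A | exists i j (B : set (measurableTypeR R)),
     measurable B /\ A = [set M : 'M[R]_(m, n) | B (M i j)]].

Definition mx_measurable : set (set 'M[R]_(m, n)) := <<s mx_cylinder >>.

Let mx_measurable0 : mx_measurable set0.
Proof. exact: sigma_algebra0. Qed.

Let mx_measurableC A : mx_measurable A -> mx_measurable (~` A).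
Proof. exact: sigma_algebraC. Qed.

Let mx_measurable_bigcup (F : (set _)^nat) :
  (forall i, mx_measurable (F i)) -> mx_measurable (\bigcup_i (F i)).
Proof. exact: sigma_algebra_bigcup. Qed.

HB.instance Definition _ := @isMeasurable.Build default_measure_display
  'M[R]_(m, n) mx_measurable mx_measurable0 mx_measurableC mx_measurable_bigcup.

Lemma measurable_fun_entry (i : 'I_m) (j : 'I_n) :
  measurable_fun [set: 'M[R]_(m, n)] (fun M => M i j : measurableTypeR R).
Proof.
move=> _ B mB; rewrite setTI; apply: sub_sigma_algebra.
by exists i, j, B.
Qed.

Lemma measurable_fun_mxP d (T : measurableType d) (f : T -> 'M[R]_(m, n)) :
  (forall i j, measurable_fun [set: T] (fun x => f x i j : measurableTypeR R)) ->
  measurable_fun [set: T] f.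
Proof.
move=> mf; apply: (@measurability _ _ _ _ setT f mx_cylinder) => //.
move=> _ [_ [i [j [B [mB ->]]]] <-].
exact: mf.
Qed.

End measurable_mx.

Lemma sigma_finite_product d1 d2 (T1 : measurableType d1)
    (T2 : measurableType d2) (R : realType)
    (m1 : {sigma_finite_measure set T1 -> \bar R})
    (m2 : {sigma_finite_measure set T2 -> \bar R}) :
  sigma_finite setT (m1 \x m2)%E.
Proof.
have /sigma_finiteP[F [TF ndF Foo]] := sigma_finiteT m1.
have /sigma_finiteP[G [TG ndG Goo]] := sigma_finiteT m2.
exists (fun n => F n `*` G n).
  rewrite -setXTT TF TG predeqE => -[x y]; split.
    move=> [/= [n _ Fnx] [k _ Gky]]; exists (maxn n k) => //; split.
    - by move: x Fnx; exact/subsetPset/ndF/leq_maxl.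
    - by move: y Gky; exact/subsetPset/ndG/leq_maxr.
  by move=> [n _ []/= ? ?]; split; exists n.
move=> k; have [? ?] := Foo k; have [? ?] := Goo k.
split; first exact: measurableX.
by rewrite product_measure1E// lte_mul_pinfty// ge0_fin_numE.
Qed.

Section lebesgue_cV.
Context {R : realType}.

Definition cV_cons k (p : measurableTypeR R * 'cV[R]_k) : 'cV[R]_k.+1 :=
  col_mx (p.1%:M : 'cV[R]_1) p.2.

Definition cV_uncons k (x : 'cV[R]_k.+1) : measurableTypeR R * 'cV[R]_k :=
  (x 0 0, dsubmx (x : 'cV[R]_(1 + k))).

Lemma cV_cons0 k p j : @cV_cons k p ord0 j = p.1.
Proof.
have -> : @ord0 k = @lshift 1 k ord0 by exact: val_inj.
by rewrite (ord1 j) [LHS](@col_mxEu _ 1 k) mxE; exact: mulr1n.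
Qed.

Lemma cV_consS k p a j : @cV_cons k p (lift ord0 a) j = p.2 a j.
Proof.
have -> : lift (@ord0 k) a = rshift 1 a by exact: val_inj.
exact: (@col_mxEd _ 1 k).
Qed.

Lemma cV_consK k : cancel (@cV_cons k) (@cV_uncons k).
Proof.
move=> [a x]; rewrite /cV_uncons cV_cons0; congr pair; exact: col_mxKd.
Qed.

Lemma measurable_cV_cons k : measurable_fun setT (@cV_cons k).
Proof.
apply: measurable_fun_mxP => i j.
have [a ->|->] := unliftP ord0 i.
  under eq_fun do rewrite cV_consS.
  by apply: (measurableT_comp (measurable_fun_entry a j)); exact: measurable_snd.
under eq_fun do rewrite cV_cons0.
exact: measurable_fst.
Qed.

Lemma measurable_cV_uncons k : measurable_fun setT (@cV_uncons k).
Proof.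
apply/measurable_fun_pairP; split; first exact: measurable_fun_entry.
apply: measurable_fun_mxP => i j; rewrite /cV_uncons/=.
under eq_fun do rewrite mxE.
exact: measurable_fun_entry.
Qed.

Section cV_cons_measure.
Local Open Scope ereal_scope.
Context {k : nat} (m : {sigma_finite_measure set 'cV[R]_k -> \bar R}).

Definition cV_cons_measure : set 'cV[R]_k.+1 -> \bar R :=
  pushforward (lebesgue_measure \x m) (@cV_cons k).

Let m0 : cV_cons_measure set0 = 0.
Proof. by rewrite /cV_cons_measure /pushforward preimage_set0 measure0. Qed.

Let m_ge0 A : 0 <= cV_cons_measure A.
Proof. exact: (measure_ge0 (@lebesgue_measure R \x m)). Qed.

Let m_sigma_additive : semi_sigma_additive cV_cons_measure.
Proof.
move=> F mF tF mUF; rewrite /cV_cons_measure /pushforward preimage_bigcup.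
apply: measure_semi_sigma_additive.
- by move=> n; rewrite -[X in measurable X]setTI; exact: measurable_cV_cons.
- apply/trivIsetP => /= i j _ _ ij; rewrite -preimage_setI.
  by move/trivIsetP : tF => /(_ _ _ _ _ ij) ->//; rewrite preimage_set0.
- rewrite -preimage_bigcup -[X in measurable X]setTI.
  exact: measurable_cV_cons.
Qed.

HB.instance Definition _ := isMeasure.Build _ _ _ cV_cons_measure
  m0 m_ge0 m_sigma_additive.

Let m_sigma_finite : sigma_finite setT cV_cons_measure.
Proof.
have [F FT Ffin] := sigma_finite_product (@lebesgue_measure R) m.
exists (fun i => @cV_uncons k @^-1` F i).
  by rewrite -preimage_bigcup -FT preimage_setT.
move=> i; have [mF Foo] := Ffin i; split.
  by rewrite -[X in measurable X]setTI; exact: measurable_cV_uncons.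
rewrite /cV_cons_measure /pushforward -comp_preimage.
by rewrite (_ : _ \o _ = id)//; apply/funext => x; exact: cV_consK.
Qed.

HB.instance Definition _ := Measure_isSigmaFinite.Build _ _ _ cV_cons_measure
  m_sigma_finite.

End cV_cons_measure.

Fixpoint lebesgue_cV k : {sigma_finite_measure set 'cV[R]_k -> \bar R} :=
  match k with
  | 0 => \d_(0 : 'cV[R]_0)
  | k'.+1 => cV_cons_measure (lebesgue_cV k')
  end.

End lebesgue_cV.

Definition mx_image {R : realType} {m n} (g : 'M[R]_(m, n))
    (F : {vspace 'cV[R]_n}) : {vspace 'cV[R]_m} :=
  (linfun (mulmx g : 'cV[R]_n -> 'cV[R]_m) @: F)%VS.

Section orthonormal_basis.
Context {R : realType} {n : nat}.
Implicit Types F : {vspace 'cV[R]_n}.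

Definition orthonormal_basis F k (B : 'M[R]_(n, k)) : Prop :=
  B^T *m B = 1%:M /\ mx_image B fullv = F.

Lemma dot_cV_gt0 (v : 'cV[R]_n) : v != 0 -> 0 < (v^T *m v) 0 0.
Proof.
move=> v0; rewrite lt_neqAle mxE sumr_ge0 ?andbT => [|i _]; last first.
  by rewrite mxE -expr2 sqr_ge0.
apply: contra v0; rewrite eq_sym psumr_eq0 => [/allP v0|i _]; last first.
  by rewrite mxE -expr2 sqr_ge0.
apply/eqP/matrixP => i j; rewrite (ord1 j) mxE; apply/eqP.
by have := v0 i (mem_index_enum _); rewrite mxE -expr2 sqrf_eq0.
Qed.

Lemma orthonormal_familyP k F : \dim F = k ->
  exists2 B : 'M[R]_(n, k), B^T *m B = 1%:M & forall y, B *m y \in F.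
Proof.
elim: k F => [|k IHk] F dimF.
  exists 0; first by rewrite mulmx0; apply/matrixP => -[].
  by move=> y; rewrite mul0mx mem0v.
have F0 : vpick F != 0 by rewrite vpick0 -dimv_eq0 dimF.
pose v := vpick F; pose c := Num.sqrt ((v^T *m v) 0 0).
have c0 : 0 < c by rewrite sqrtr_gt0 dot_cV_gt0.
pose u := c^-1 *: v.
have uF : u \in F by rewrite memvZ ?memv_pick.
have uu : u^T *m u = 1%:M.
  apply/matrixP => i j; rewrite !ord1 (_ : u^T = c^-1 *: v^T); last exact: linearZ.
  rewrite -scalemxAr -scalemxAl.
  rewrite !mxE eqxx mulr1n.
  have -> : \sum_j0 v^T 0 j0 * v j0 0 = c ^+ 2.
    by rewrite sqr_sqrtr ?ltW ?dot_cV_gt0// mxE.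
  by rewrite mulrA -expr2 -exprMn mulVf ?expr1n ?gt_eqF.
pose h := linfun (mulmx u^T : 'cV[R]_n -> 'cV[R]_1).
have hu : h u = 1%:M by rewrite lfunE.
have dimhF : \dim (h @: F)%VS = 1%N.
  apply/eqP; rewrite eqn_leq; apply/andP; split.
    by apply: leq_trans (dimvS (subvf _)) _; rewrite dimvf dim_matrix.
  rewrite lt0n dimv_eq0; apply/eqP => hF0.
  have := memv_img h uF; rewrite hF0 memv0 hu => /eqP /matrixP /(_ 0 0).
  by rewrite !mxE eqxx => /eqP; rewrite oner_eq0.
have /IHk[B BB BF] : \dim (F :&: lker h)%VS = k.
  by have := limg_ker_dim h F; rewrite dimhF dimF addn1 => -[].
have uB : u^T *m B = 0.
  apply/matrixP => i j.
  have := BF (delta_mx j 0); rewrite memv_cap => /andP[_].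
  rewrite memv_ker lfunE /= mulmxA -colE => /eqP /matrixP /(_ i 0).
  by rewrite !mxE.
have Bu : B^T *m u = 0 by rewrite -[RHS]trmx0 -uB trmx_mul trmxK.
have uBuB : (row_mx u B)^T *m row_mx u B = 1%:M.
  by rewrite tr_row_mx mul_col_row uu uB Bu BB -scalar_mx_block.
have uBF (y : 'cV[R]_(1 + k)) : row_mx u B *m y \in F.
  rewrite -[y]vsubmxK mul_row_col memvD//; last first.
    by have := BF (dsubmx y); rewrite memv_cap => /andP[].
  have -> : usubmx y = (usubmx y 0 0)%:M.
    by apply/matrixP => i j; rewrite !ord1 [RHS]mxE eqxx mulr1n.
  by rewrite mul_mx_scalar memvZ.
by exists (row_mx u B : 'M[R]_(n, 1 + k)); [exact: uBuB|exact: uBF].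
Qed.

Lemma orthonormal_basis_exists F :
  exists B : 'M[R]_(n, \dim F), orthonormal_basis F B.
Proof.
have [B BB BF] := orthonormal_familyP (erefl (\dim F)).
exists B; split=> //; apply/eqP; rewrite eqEdim; apply/andP; split.
  by apply/subvP => _ /memv_imgP[y _ ->]; rewrite lfunE; exact: BF.
rewrite /mx_image limg_dim_eq ?dimvf ?dim_matrix ?mulr1//.
apply/eqP; rewrite capfv; apply/lker0P => x y; rewrite !lfunE/= => Bxy.
by rewrite -[x]mul1mx -[y]mul1mx -BB -!mulmxA Bxy.
Qed.

(* The choice of the basis is irrelevant below: two orthonormal bases differ by
   an orthogonal matrix, which preserves Lebesgue measure. *)
Definition onb F : 'M[R]_(n, \dim F) := xget 0 [set B | orthonormal_basis F B].

Lemma onbP F : orthonormal_basis F (onb F).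
Proof. by apply: (@xgetPex _ 0); exact: orthonormal_basis_exists. Qed.

Definition orthoproj F : 'M[R]_n := onb F *m (onb F)^T.

End orthonormal_basis.

Section integration.
Context {R : realType} {n : nat}.
Implicit Types (F : {vspace 'cV[R]_n}) (f : 'cV[R]_n -> R).

(* Lebesgue measure of the Euclidean space F, seen as a measure on R^n *)
Definition lebesgue_on F : set 'cV[R]_n -> \bar R :=
  pushforward (lebesgue_cV (\dim F)) (mulmx (onb F)).

Definition L1norm_on F f : \bar R :=
  (\int[lebesgue_on F]_(x in [set` F]) `|f x|%:E)%E.

(* Lebesgue (and not only Borel) measurable functions are allowed: f has a Borel
   integrable version. The integral of the library is total and, on nonnegative
   functions, it is a lower integral; for almost every subspace F, f and f0
   agree almost everywhere on F. *)
Definition lebesgue_integrable f : Prop :=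
  exists2 f0 : 'cV[R]_n -> R,
    (lebesgue_cV n).-integrable setT (EFin \o f0) &
    {ae lebesgue_cV n, forall x, f x = f0 x}.

End integration.

Definition flag_dims n r (i : r.-tuple nat) : bool :=
  sorted ltn i && all (fun k => (1 <= k <= n.-1)%N) i.

Section flag.
Context {R : realType} {n r : nat} {i : r.-tuple nat}.

Definition is_flag (F : {ffun 'I_r -> {vspace 'cV[R]_n}}) : bool :=
  [forall j, \dim (F j) == tnth i j] &&
  [forall j : 'I_r, forall k : 'I_r, (j <= k)%N ==> (F j <= F k)%VS].

(* hi guarantees that there is a flag: measurable types are inhabited. *)
Record flag (hi : flag_dims n i) := Flag {
  flag_val :> {ffun 'I_r -> {vspace 'cV[R]_n}} ;
  flagP : is_flag flag_val }.

Context {hi : flag_dims n i}.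

HB.instance Definition _ := [isSub for @flag_val hi].
HB.instance Definition _ := [Choice of flag hi by <:].

Lemma flag_nonempty : exists F, is_flag F.
Proof.
pose X : seq 'cV[R]_n := vbasis fullv.
have freeX : free X by exact: basis_free (vbasisP _).
have sizeX : size X = n by rewrite size_tuple dimvf dim_matrix mulr1.
have /andP[si /all_tnthP ni] := hi.
exists [ffun j => <<take (tnth i j) X>>%VS]; apply/andP; split.
  apply/forallP => j; rewrite ffunE; apply/eqP.
  have /eqP -> : free (take (tnth i j) X).
    by apply: (@catl_free _ _ (drop (tnth i j) X)); rewrite cat_take_drop.
  rewrite size_takel// sizeX.
  by have /andP[_ /leq_trans ->//] := ni j; exact: leq_pred.
apply/forallP => j; apply/forallP => k; apply/implyP => jk; rewrite !ffunE.
apply: sub_span => x.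
have le_ijk : (tnth i j <= tnth i k)%N.
  rewrite !(tnth_nth 0%N); apply: (sorted_leq_nth leq_trans leqnn) => //.
  - by apply: sub_sorted si => ? ?; exact: ltnW.
  - by rewrite inE size_tuple.
  - by rewrite inE size_tuple.
by rewrite -(subnKC le_ijk) takeD mem_cat => ->.
Qed.

HB.instance Definition _ :=
  isPointed.Build (flag hi) (Flag hi (xchooseP flag_nonempty)).

(* Borel sigma-algebra of the flag manifold: a flag is determined by its
   orthogonal projections, and this embeds the (compact) manifold
   topologically in a product of matrix spaces. *)
Definition flag_cylinder : set (set (flag hi)) :=
  [set A | exists j (B : set 'M[R]_n),
     measurable B /\ A = [set xi : flag hi | B (orthoproj (xi j))]].

Definition flag_measurable := <<s flag_cylinder >>.

Let flag_measurable0 : flag_measurable set0.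
Proof. exact: sigma_algebra0. Qed.

Let flag_measurableC A : flag_measurable A -> flag_measurable (~` A).
Proof. exact: sigma_algebraC. Qed.

Let flag_measurable_bigcup (F : (set _)^nat) :
  (forall k, flag_measurable (F k)) -> flag_measurable (\bigcup_k (F k)).
Proof. exact: sigma_algebra_bigcup. Qed.

HB.instance Definition _ := @isMeasurable.Build default_measure_display
  (flag hi) flag_measurable
  flag_measurable0 flag_measurableC flag_measurable_bigcup.

Lemma is_flag_act (g : 'M[R]_n) (F : {ffun 'I_r -> {vspace 'cV[R]_n}}) :
  g \in unitmx -> is_flag F -> is_flag [ffun j => mx_image g (F j)].
Proof.
move=> gU /andP[/forallP dimF /forallP subF]; apply/andP; split.
  apply/forallP => j; rewrite ffunE limg_dim_eq//.
  apply/eqP; rewrite -subv0; apply: subv_trans (capvSr _ _) _.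
  rewrite subv0; apply/lker0P => x y; rewrite !lfunE/=.
  exact: (can_inj (mulKmx gU)).
apply/forallP => j; apply/forallP => k; apply/implyP => jk; rewrite !ffunE.
by apply: limgS; move/forallP/(_ k)/implyP: (subF j); exact.
Qed.

Definition flag_act (g : 'M[R]_n) (gU : g \in unitmx) (xi : flag hi) :
    flag hi :=
  Flag hi (is_flag_act gU (flagP xi)).

End flag.
Arguments flag R {n r i} hi.

Definition is_SO {R : realType} {n} (O : 'M[R]_n) : Prop :=
  O^T *m O = 1%:M /\ \det O = 1.

Section flag_integral.
Context {R : realType} {n r : nat} {i : r.-tuple nat} {hi : flag_dims n i}.
Local Open Scope ereal_scope.

Definition SO_invariant (mu : set (flag R hi) -> \bar R) : Prop :=
  forall (O : 'M[R]_n) (OU : O \in unitmx), is_SO O ->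
  forall A, measurable A -> mu (flag_act OU @^-1` A) = mu A.

(* i_k with the conventions i_0 = 0 and i_(r + 1) = n *)
Definition flag_index (k : nat) : nat := nth n (0%N :: i) k.

(* The subspaces are numbered from 0 here: xi j is F_(j + 1). *)
Definition flag_integral (mu : set (flag R hi) -> \bar R)
    (f : 'cV[R]_n -> R) : \bar R :=
  \int[mu]_xi \prod_(j < r)
    L1norm_on (xi j) f ^+ (flag_index j.+2 - flag_index j).

End flag_integral.

Definition mx_act {R : realType} {n} (g : 'M[R]_n) (f : 'cV[R]_n -> R) :
    'cV[R]_n -> R :=
  fun x => f (invmx g *m x).

(* Main.v *)
Require Import Defs.
From HB Require Import structures.
From mathcomp Require Import all_boot all_order all_algebra.
From mathcomp Require Import all_classical all_reals all_analysis.
From mathcomp Require Import measurable_realfun ring lra.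

Set Implicit Arguments.
Unset Strict Implicit.
Unset Printing Implicit Defensive.

Import Order.TTheory GRing.Theory Num.Theory.
Import numFieldNormedType.Exports.

Local Open Scope classical_set_scope.
Local Open Scope ring_scope.

(** The integral is rewritten in a form in which only the linear structure of
    R^n occurs. Cut the n columns of a square matrix X into consecutive blocks
    of sizes i_(j+1) - i_j, the last block ending at n. Up to a factor that does
    not depend on f, the integral over the flags equals the integral over the
    invertible X of a product with two factors for every column x_a of X:
      - |f (x_a)|, or h (x_a) if a lies in the last block, where h is any fixed
        probability density on R^n;
      - the integral over t in R^l of |f| at the combination of the first l
        columns of X with coefficients t, where l is the index at which the block
        of a starts (no factor if l = 0).
    This is [flag_integral_linear]. A substitution of determinant one, X := g X,
    replaces f by its image under g and h by another density of integral one
    ([linear_integral_act]), so the right-hand side, hence the left-hand side,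
    is invariant.

    The identity combines three facts.

    First, an SO_n-invariant probability on the flags can be computed with a
    random matrix: its integrals are proportional to those against the law of the
    flag spanned by the columns of X, when the density of X is invariant under
    rotations on the left ([invariant_flag_integral]). This is uniqueness of the
    invariant measure. Tonelli's theorem averages over the rotation part of the
    QR decomposition of X, and the average sees only the orbit of the flag, that
    is nothing, because rotations act transitively on flags.

    Second, the L1-norm of f on the span of the first k columns of X is the
    k-dimensional volume of these columns times the integral over t in R^k of |f|
    at the combination of the columns with coefficients t ([L1norm_on_frame]).
    As i_(j+1) - i_(j-1) is the sum of the lengths of the blocks after and before
    i_j, the product of norms to be integrated has two factors for every column:
    the norm for the end of its block and the norm for the start of its block.

    Third, the product of the integrals attached to the ends of the blocks is an
    integral over block triangular matrices T of the values of |f| and h at the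
    columns of X T. Exchanging the integrals and substituting X T^-1 for X moves T
    into the rotation invariant density. What is left of T is an integral over the
    block triangular group, a function of X that is invariant under rotations
    and multiplied by a character under upper triangular matrices, so that the QR
    decomposition computes it; it cancels exactly the volumes that came from the
    norms ([section_norm_weight_identity]).

    These arguments apply to a Borel function. A Lebesgue integrable f agrees with
    a Borel function off a null set of R^n, and a null set of R^n meets the
    subspaces of almost every flag in null sets ([flag_integral_ae]). *)

(** * Image measures and Lebesgue measure on the line *)

Section image_measure.
Local Open Scope ereal_scope.
Context d1 d2 (T1 : measurableType d1) (T2 : measurableType d2) (R : realType).
Variables (m : {measure set T1 -> \bar R}) (f : T1 -> T2).
Hypothesis mf : measurable_fun [set: T1] f.

Definition image_measure (_ : measurable_fun [set: T1] f) : set T2 -> \bar R :=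
  pushforward m f.

Let im0 : image_measure mf set0 = 0.
Proof. by rewrite /image_measure /pushforward preimage_set0 measure0. Qed.

Let im_ge0 A : 0 <= image_measure mf A.
Proof. exact: (measure_ge0 m). Qed.

Let im_sigma_additive : semi_sigma_additive (image_measure mf).
Proof.
move=> F mF tF mUF; rewrite /image_measure /pushforward preimage_bigcup.
apply: measure_semi_sigma_additive.
- by move=> n; rewrite -[X in measurable X]setTI; exact: mf.
- apply/trivIsetP => /= i j _ _ ij; rewrite -preimage_setI.
  by move/trivIsetP : tF => /(_ _ _ _ _ ij) ->//; rewrite preimage_set0.
- by rewrite -preimage_bigcup -[X in measurable X]setTI; exact: mf.
Qed.

HB.instance Definition _ := isMeasure.Build _ _ _
  (image_measure mf) im0 im_ge0 im_sigma_additive.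

Lemma ge0_integral_image_measure (h : T2 -> \bar R) :
  measurable_fun setT h -> (forall x, 0 <= h x) ->
  \int[image_measure mf]_y h y = \int[m]_x h (f x).
Proof. by move=> mh h0; rewrite ge0_integral_pushforward. Qed.

End image_measure.

(** The left inverse is what transports sigma-finiteness: the preimages under [g]
    of sets of finite measure have finite measure for the image by [f]. *)
Section embedded_measure.
Local Open Scope ereal_scope.
Context d1 d2 (T1 : measurableType d1) (T2 : measurableType d2) (R : realType).
Variables (m : {measure set T1 -> \bar R}) (f : T1 -> T2) (g : T2 -> T1).

Definition embedded_measure (_ : sigma_finite setT m)
    (mf : measurable_fun [set: T1] f) (_ : measurable_fun [set: T2] g)
    (_ : cancel f g) : set T2 -> \bar R :=
  image_measure m mf.

Hypotheses (sm : sigma_finite setT m) (mf : measurable_fun [set: T1] f).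
Hypotheses (mg : measurable_fun [set: T2] g) (fK : cancel f g).

HB.instance Definition _ := Measure.on (embedded_measure sm mf mg fK).

Let sigma_finite_em : sigma_finite setT (embedded_measure sm mf mg fK).
Proof.
have [F FT Ffin] := sm.
exists (fun i => g @^-1` F i); first by rewrite -preimage_bigcup -FT preimage_setT.
move=> i; have [mF Foo] := Ffin i; split.
  by rewrite -[X in measurable X]setTI; exact: mg.
rewrite /embedded_measure /image_measure /pushforward -comp_preimage.
by rewrite (_ : _ \o _ = id)//; apply/funext => x; exact: fK.
Qed.

HB.instance Definition _ := Measure_isSigmaFinite.Build _ _ _
  (embedded_measure sm mf mg fK) sigma_finite_em.

Lemma ge0_integral_embedded_measure (h : T2 -> \bar R) :
  measurable_fun setT h -> (forall x, 0 <= h x) ->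
  \int[embedded_measure sm mf mg fK]_y h y = \int[m]_x h (f x).
Proof. exact: ge0_integral_image_measure. Qed.

End embedded_measure.

Section lebesgue_line.
Context {R : realType}.
Local Notation mu := (@lebesgue_measure R).
Local Notation RT := (measurableTypeR R).

Lemma measurable_shift (a : R) : measurable_fun [set: RT] (fun x : RT => x + a : RT).
Proof. exact: (@measurable_funD _ RT). Qed.

Lemma measurable_scale (c : R) : measurable_fun [set: RT] (fun x : RT => c * x : RT).
Proof. exact: (@measurable_funM _ RT). Qed.

Lemma ge0_integral_shift (a : R) (f : RT -> \bar R) :
  measurable_fun setT f -> (forall x, 0 <= f x)%E ->
  (\int[mu]_x f (x + a)%R = \int[mu]_x f x)%E.
Proof.
move=> mf f0; rewrite -(ge0_integral_image_measure mu (measurable_shift a))//.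
apply: eq_measure_integral => A mA _.
apply/esym; apply: lebesgue_measure_unique => //.
move=> _ [[b c]] _ <-; rewrite -[RHS]/(mu ((fun x : RT => x + a) @^-1` _)).
rewrite (_ : _ @^-1` _ = `]b - a, c - a]%classic); last first.
  by apply/seteqP; split => x /=; rewrite !in_itv/= ltrBlDr lerBrDr.
rewrite !lebesgue_measure_itv/= !lte_fin ltrD2r.
by case: ifP => // _; rewrite -!EFinB; congr EFin; ring.
Qed.

Lemma ge0_integral_scale (c : R) (f : RT -> \bar R) : c != 0 ->
  measurable_fun setT f -> (forall x, 0 <= f x)%E ->
  (`|c|%:E * \int[mu]_x f (c * x)%R = \int[mu]_x f x)%E.
Proof.
move=> c0 mf f0; rewrite -(ge0_integral_image_measure mu (measurable_scale c))//.
have nc : 0 <= `|c| by [].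
rewrite -[LHS](ge0_integral_mscale _ measurableT (NngNum nc))//.
apply: eq_measure_integral => A mA _.
apply/esym; apply: lebesgue_measure_unique => //.
move=> _ [[a b]] _ <-; rewrite -[RHS]/(`|c|%:E * mu ((fun x : RT => (c * x)%R) @^-1` _))%E.
have [cp|cn|c0'] := ltgtP c 0; last by rewrite c0' eqxx in c0.
- rewrite (_ : _ @^-1` _ = `[b / c, a / c[%classic); last first.
    apply/seteqP; split => x /=; rewrite !in_itv/= ltr_ndivlMr// ler_ndivrMr//.
      by rewrite ![c * x]mulrC => /andP[-> ->].
    by rewrite ![c * x]mulrC => /andP[-> ->].
  rewrite !lebesgue_measure_itv/= !lte_fin ltr_nM2r ?invr_lt0//.
  case: ifP => // _; rewrite ?mule0// -!EFinB -EFinM ltr0_norm//; congr EFin.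
  by field.
- rewrite (_ : _ @^-1` _ = `]a / c, b / c]%classic); last first.
    apply/seteqP; split => x /=; rewrite !in_itv/= ltr_pdivrMr// ler_pdivlMr//.
      by rewrite ![c * x]mulrC => /andP[-> ->].
    by rewrite ![c * x]mulrC => /andP[-> ->].
  rewrite !lebesgue_measure_itv/= !lte_fin ltr_pM2r ?invr_gt0//.
  case: ifP => // _; rewrite ?mule0// -!EFinB -EFinM gtr0_norm//; congr EFin.
  by field.
Qed.

End lebesgue_line.

(** * Measurability of matrix operations *)
Section measurable_matrix_operations.
Context d (T : measurableType d) {R : realType}.

Lemma measurable_entry m n (f : T -> 'M[R]_(m, n)) i j :
  measurable_fun setT f -> measurable_fun setT (fun x => f x i j : R).
Proof. by move=> mf; exact: (measurableT_comp (measurable_fun_entry i j)). Qed.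

Lemma measurable_mx m n (f : T -> 'M[R]_(m, n)) :
  (forall i j, measurable_fun setT (fun x => f x i j : R)) ->
  measurable_fun setT f.
Proof. by move=> mf; apply: measurable_fun_mxP => i j; exact: mf. Qed.

Lemma measurable_mulmx m n p (f : T -> 'M[R]_(m, n)) (g : T -> 'M[R]_(n, p)) :
  measurable_fun setT f -> measurable_fun setT g ->
  measurable_fun setT (fun x => f x *m g x).
Proof.
move=> mf mg; apply: measurable_mx => i j; under eq_fun do rewrite mxE.
by apply: measurable_sum => k; apply: measurable_funM; exact: measurable_entry.
Qed.

Lemma measurable_addmx m n (f g : T -> 'M[R]_(m, n)) :
  measurable_fun setT f -> measurable_fun setT g ->
  measurable_fun setT (fun x => f x + g x).
Proof.
move=> mf mg; apply: measurable_mx => i j; under eq_fun do rewrite mxE.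
by apply: measurable_funD; exact: measurable_entry.
Qed.

Lemma measurable_scalemx m n (c : T -> R) (f : T -> 'M[R]_(m, n)) :
  measurable_fun setT c -> measurable_fun setT f ->
  measurable_fun setT (fun x => c x *: f x).
Proof.
move=> mc mf; apply: measurable_mx => i j; under eq_fun do rewrite mxE.
by apply: measurable_funM => //; exact: measurable_entry.
Qed.

Lemma measurable_submx m n (f g : T -> 'M[R]_(m, n)) :
  measurable_fun setT f -> measurable_fun setT g ->
  measurable_fun setT (fun x => f x - g x).
Proof.
move=> mf mg; apply: measurable_mx => i j; under eq_fun do rewrite !mxE.
by apply: measurable_funB; exact: measurable_entry.
Qed.

Lemma measurable_trmx m n (f : T -> 'M[R]_(m, n)) :
  measurable_fun setT f -> measurable_fun setT (fun x => (f x)^T).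
Proof.
move=> mf; apply: measurable_mx => i j; under eq_fun do rewrite mxE.
exact: measurable_entry.
Qed.

Lemma measurable_row_mx m n p (f : T -> 'M[R]_(m, n)) (g : T -> 'M[R]_(m, p)) :
  measurable_fun setT f -> measurable_fun setT g ->
  measurable_fun setT (fun x => row_mx (f x) (g x)).
Proof.
move=> mf mg; apply: measurable_mx => i j; under eq_fun do rewrite mxE.
by case: split_ordP => k _; exact: measurable_entry.
Qed.

Lemma measurable_col m n (f : T -> 'M[R]_(m, n)) j :
  measurable_fun setT f -> measurable_fun setT (fun x => col j (f x)).
Proof.
move=> mf; apply: measurable_mx => i k; under eq_fun do rewrite mxE.
exact: measurable_entry.
Qed.

Lemma measurable_det n (f : T -> 'M[R]_n) :
  measurable_fun setT f -> measurable_fun setT (fun x => \det (f x)).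
Proof.
move=> mf; rewrite /determinant; apply: measurable_sum => s.
by apply: measurable_funM => //; apply: measurable_prod => i _; exact: measurable_entry.
Qed.

Lemma measurable_adj n (f : T -> 'M[R]_n) :
  measurable_fun setT f -> measurable_fun setT (fun x => \adj (f x)).
Proof.
move=> mf; apply: measurable_mx => i j; under eq_fun do rewrite mxE.
apply: measurable_funM => //; apply: measurable_det.
by apply: measurable_mx => k l; under eq_fun do rewrite !mxE; exact: measurable_entry.
Qed.

(** The inverse of a real y is y times the power -1 of y ^ 2, with the convention
    that the inverse of 0 is 0. *)
Lemma measurable_invr (f : T -> R) :
  measurable_fun setT f -> measurable_fun setT (fun x => (f x)^-1).
Proof.
move=> mf; rewrite (_ : (fun _ => _) = fun x => f x * (f x ^+ 2) `^ (-1)).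
  apply: measurable_funM => //.
  by apply: (measurableT_comp (measurable_powR _)); exact: measurable_funX.
apply/funext => x; rewrite powR_inv1 ?sqr_ge0// expr2 invfM mulrA.
by have [->|fx0] := eqVneq (f x) 0; [rewrite invr0 mulr0|rewrite mulfV// mul1r].
Qed.

Lemma measurable_sqrtr (f : T -> R) :
  measurable_fun setT f -> measurable_fun setT (fun x => Num.sqrt (f x)).
Proof.
move=> mf; rewrite (_ : (fun _ => _) = fun x => (Num.max (f x) 0) `^ (2^-1)).
  by apply: (measurableT_comp (measurable_powR _)); exact: measurable_maxr.
apply/funext => x; rewrite powR12_sqrt ?le_max ?lexx ?orbT//.
by case: (ltP (f x) 0) => // fx0; rewrite sqrtr0 ler0_sqrtr// ltW.
Qed.

End measurable_matrix_operations.

(** * Lebesgue measure on column vectors *)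
Section tonelli.
Local Open Scope ereal_scope.
Context d1 d2 (T1 : measurableType d1) (T2 : measurableType d2) (R : realType).
Variables (m1 : {sigma_finite_measure set T1 -> \bar R}).
Variables (m2 : {sigma_finite_measure set T2 -> \bar R}).
Variable f : T1 -> T2 -> \bar R.
Hypothesis mf : measurable_fun setT (fun z => f z.1 z.2).
Hypothesis f0 : forall x y, 0 <= f x y.

Lemma measurable_parametric_integral : measurable_fun setT (fun x => \int[m2]_y f x y).
Proof. by apply: (measurable_fun_fubini_tonelli_F (fun z => f z.1 z.2)). Qed.

Lemma tonelli_swap :
  \int[m1]_x \int[m2]_y f x y = \int[m2]_y \int[m1]_x f x y.
Proof. by rewrite (fubini_tonelli (fun z => f z.1 z.2)). Qed.

End tonelli.

Section lebesgue_cV_invariance.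
Local Open Scope ereal_scope.
Context {R : realType}.

Lemma ge0_integral_cVS k (f : 'cV[R]_k.+1 -> \bar R) :
  measurable_fun setT f -> (forall x, 0 <= f x) ->
  \int[lebesgue_cV k.+1]_x f x =
  \int[lebesgue_measure]_a \int[lebesgue_cV k]_x f (cV_cons (a, x)).
Proof.
move=> mf f0; rewrite [LHS](ge0_integral_pushforward (@measurable_cV_cons R k))//.
rewrite preimage_setT fubini_tonelli1//; last by move=> z; exact: f0.
by apply: measurableT_comp => //; exact: measurable_cV_cons.
Qed.

Lemma measurable_translate m n (v : 'M[R]_(m, n)) :
  measurable_fun setT (fun x : 'M[R]_(m, n) => (x + v)%R).
Proof. exact: measurable_addmx. Qed.

Lemma measurable_homothety m n (c : R) :
  measurable_fun setT (fun x : 'M[R]_(m, n) => (c *: x)%R).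
Proof. exact: measurable_scalemx. Qed.

Lemma measurable_cV_consr k a : measurable_fun setT (fun x : 'cV[R]_k => cV_cons (a, x)).
Proof. by apply: (measurableT_comp (@measurable_cV_cons R k)); exact: pair1_measurable. Qed.

Lemma ge0_integral_cV_translate k (v : 'cV[R]_k) (f : 'cV[R]_k -> \bar R) :
  measurable_fun setT f -> (forall x, 0 <= f x) ->
  \int[lebesgue_cV k]_x f (x + v)%R = \int[lebesgue_cV k]_x f x.
Proof.
elim: k v f => [|k IHk] v f mf f0.
  by apply: eq_integral => x _; congr f; apply/matrixP => -[].
have mfv : measurable_fun setT (fun x : 'cV[R]_k.+1 => f (x + v)%R).
  by apply: measurableT_comp => //; exact: measurable_translate.
rewrite (ge0_integral_cVS mfv (fun x => f0 _)) (ge0_integral_cVS mf f0).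
pose F (a : measurableTypeR R) := \int[lebesgue_cV k]_x f (cV_cons (a, x)).
have mF : measurable_fun setT F.
  apply: (measurable_parametric_integral _ (f := fun a x => f (cV_cons (a, x)))) => //.
  rewrite (_ : (fun _ => _) = f \o @cV_cons R k); last by apply/funext => -[].
  by apply: measurableT_comp => //; exact: measurable_cV_cons.
have F0 a : 0 <= F a by exact: integral_ge0.
rewrite -[RHS](ge0_integral_shift (v ord0 ord0) mF F0).
apply: eq_integral => a _; rewrite /F.
have mfa : measurable_fun setT (fun x : 'cV[R]_k => f (cV_cons (a + v ord0 ord0, x)%R)).
  by apply: measurableT_comp => //; exact: measurable_cV_consr.
rewrite -[RHS](IHk (dsubmx (v : 'cV_(1 + k))) _ mfa)//.
apply: eq_integral => x _; congr f; apply/matrixP => i j; rewrite (ord1 j) mxE.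
have [b ->|->] := unliftP ord0 i; rewrite ?cV_consS ?cV_cons0//= mxE; congr (_ + _)%R.
by rewrite mxE; congr (v _ _); apply: val_inj.
Qed.

Lemma ge0_integral_cV_scale k (c : R) (f : 'cV[R]_k -> \bar R) : c != 0%R ->
  measurable_fun setT f -> (forall x, 0 <= f x) ->
  (`|c| ^+ k)%:E * \int[lebesgue_cV k]_x f (c *: x)%R = \int[lebesgue_cV k]_x f x.
Proof.
move=> c0; elim: k f => [|k IHk] f mf f0.
  rewrite expr0 mul1e.
  by apply: eq_integral => x _; congr f; apply/matrixP => -[].
have mfv : measurable_fun setT (fun x : 'cV[R]_k.+1 => f (c *: x)%R).
  by apply: measurableT_comp => //; exact: measurable_homothety.
rewrite (ge0_integral_cVS mfv (fun x => f0 _)) (ge0_integral_cVS mf f0).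
pose F (a : measurableTypeR R) := \int[lebesgue_cV k]_x f (cV_cons (a, x)).
have mF : measurable_fun setT F.
  apply: (measurable_parametric_integral _ (f := fun a x => f (cV_cons (a, x)))) => //.
  rewrite (_ : (fun _ => _) = f \o @cV_cons R k); last by apply/funext => -[].
  by apply: measurableT_comp => //; exact: measurable_cV_cons.
have F0 a : 0 <= F a by exact: integral_ge0.
rewrite -[RHS](ge0_integral_scale c0 mF F0).
rewrite exprS EFinM -muleA; congr (_ * _).
rewrite -ge0_integralZl; first last.
- by rewrite lee_fin exprn_ge0.
- by move=> a _; apply: integral_ge0.
- apply: (measurable_parametric_integral _ (f := fun (a : measurableTypeR R) x => f (c *: cV_cons (a, x))%R)) => //.
  rewrite (_ : (fun _ => _) = (fun y : 'cV[R]_k.+1 => f (c *: y)%R) \o @cV_cons R k); last by apply/funext => -[].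
  by apply: measurableT_comp => //; exact: measurable_cV_cons.
- by [].
apply: eq_integral => a _; rewrite /F.
have mfa : measurable_fun setT (fun x : 'cV[R]_k => f (cV_cons (c * a, x)%R)).
  by apply: measurableT_comp => //; exact: measurable_cV_consr.
rewrite -[RHS](IHk _ mfa)//.
congr (_ * _).
apply: eq_integral => x _; congr f; apply/matrixP => i j; rewrite (ord1 j) mxE.
by have [b ->|->] := unliftP ord0 i; rewrite ?cV_consS ?cV_cons0//= mxE.
Qed.

End lebesgue_cV_invariance.

(** * Products of measures on the columns of a matrix *)
Lemma emeasurable_prod d (T : measurableType d) (R : realType) (I : Type)
    (s : seq I) (P : pred I) (f : I -> T -> \bar R) :
  (forall i, measurable_fun setT (f i)) ->
  measurable_fun setT (fun x => \prod_(i <- s | P i) f i x)%E.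
Proof.
move=> mf; elim: s => [|i s IHs].
  by under eq_fun do rewrite big_nil; exact: measurable_cst.
under eq_fun do rewrite big_cons; case: (P i) => //.
exact: emeasurable_funM.
Qed.

Section column_product.
Local Open Scope ereal_scope.
Context {R : realType} {n : nat}.

Definition mx_cons k (p : 'cV[R]_n * 'M[R]_(n, k)) : 'M[R]_(n, k.+1) :=
  row_mx p.1 p.2 : 'M[R]_(n, 1 + k).

Definition mx_uncons k (X : 'M[R]_(n, k.+1)) : 'cV[R]_n * 'M[R]_(n, k) :=
  (lsubmx (X : 'M[R]_(n, 1 + k)), rsubmx (X : 'M[R]_(n, 1 + k))).

Lemma mx_consK k : cancel (@mx_cons k) (@mx_uncons k).
Proof. by move=> [x Y]; congr pair; [exact: row_mxKl|exact: row_mxKr]. Qed.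

Lemma mx_unconsK k : cancel (@mx_uncons k) (@mx_cons k).
Proof. by move=> X; exact: (@hsubmxK _ n 1 k). Qed.

Lemma mx_cons_col0 k p : col ord0 (@mx_cons k p) = p.1.
Proof.
apply/matrixP => a b; rewrite (ord1 b) mxE.
have -> : @ord0 k = @lshift 1 k ord0 by exact: val_inj.
exact: (@row_mxEl _ n 1 k).
Qed.

Lemma mx_cons_colS k p j : col (lift ord0 j) (@mx_cons k p) = col j p.2.
Proof.
apply/matrixP => a b; rewrite mxE [RHS]mxE.
have -> : lift (@ord0 k) j = rshift 1 j by exact: val_inj.
exact: (@row_mxEr _ n 1 k).
Qed.

Lemma measurable_mx_cons k : measurable_fun setT (@mx_cons k).
Proof. by apply: (@measurable_row_mx _ _ _ n 1 k). Qed.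

Lemma measurable_mx_uncons k : measurable_fun setT (@mx_uncons k).
Proof.
apply/measurable_fun_pairP; split; apply: measurable_mx => i j;
  by under eq_fun do rewrite mxE; exact: (@measurable_entry _ _ _ _ (1 + k)).
Qed.

Definition mx_cons_measure k (m1 : {sigma_finite_measure set 'cV[R]_n -> \bar R})
    (m2 : {sigma_finite_measure set 'M[R]_(n, k) -> \bar R}) :
    {sigma_finite_measure set 'M[R]_(n, k.+1) -> \bar R} :=
  @embedded_measure _ _ _ _ R (m1 \x m2)
    _ _ (sigma_finite_product m1 m2) (@measurable_mx_cons k) (@measurable_mx_uncons k) (@mx_consK k).

(** The law of a matrix whose a-th column follows [nu a], independently of the
    others. The measures are indexed by natural numbers so that the recursion
    only shifts the index. *)
Fixpoint column_product (nu : nat -> {sigma_finite_measure set 'cV[R]_n -> \bar R})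
    m : {sigma_finite_measure set 'M[R]_(n, m) -> \bar R} :=
  match m with
  | 0 => \d_(0%R : 'M[R]_(n, 0))
  | m'.+1 => mx_cons_measure (nu 0%N) (column_product (nu \o S) m')
  end.

Implicit Type nu : nat -> {sigma_finite_measure set 'cV[R]_n -> \bar R}.

Lemma measurable_mx_cons_pair k d (T : measurableType d) (f : 'M[R]_(n, k.+1) -> \bar R)
   (u : T -> 'cV[R]_n) (v : T -> 'M[R]_(n, k)) :
  measurable_fun setT f -> measurable_fun setT u -> measurable_fun setT v ->
  measurable_fun setT (fun t => f (mx_cons (u t, v t))).
Proof.
move=> mf mu mv; apply: (measurableT_comp mf).
apply: (measurableT_comp (@measurable_mx_cons k)).
by apply/measurable_fun_pairP; split.
Qed.

Lemma ge0_integral_column_product0 nu (f : 'M[R]_(n, 0) -> \bar R) :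
  measurable_fun setT f -> (forall x, 0 <= f x) ->
  \int[column_product nu 0]_X f X = f 0%R.
Proof. by move=> mf f0; rewrite integral_dirac// diracT mul1e. Qed.

Lemma ge0_integral_column_productS nu m (f : 'M[R]_(n, m.+1) -> \bar R) :
  measurable_fun setT f -> (forall x, 0 <= f x) ->
  \int[column_product nu m.+1]_X f X =
  \int[nu 0%N]_x \int[column_product (nu \o S) m]_Y f (mx_cons (x, Y)).
Proof.
move=> mf f0; rewrite [LHS]ge0_integral_embedded_measure//.
rewrite fubini_tonelli1//.
by apply: measurableT_comp => //; exact: measurable_mx_cons.
Qed.

Definition translation_invariant (m : set 'cV[R]_n -> \bar R) (v : 'cV[R]_n) :=
  forall f : 'cV[R]_n -> \bar R, measurable_fun setT f -> (forall x, 0 <= f x) ->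
  \int[m]_x f (x + v)%R = \int[m]_x f x.

(** The first column is translated in the outer integral, the others in the inner
    one. *)
Lemma ge0_integral_column_translate nu m (V : 'M[R]_(n, m)) (f : 'M[R]_(n, m) -> \bar R) :
  (forall a : 'I_m, translation_invariant (nu a) (col a V)) ->
  measurable_fun setT f -> (forall x, 0 <= f x) ->
  \int[column_product nu m]_X f (X + V)%R = \int[column_product nu m]_X f X.
Proof.
elim: m nu V f => [|m IHm] nu V f nuV mf f0.
  by apply: eq_integral => X _; congr f; apply/matrixP => i -[].
have mfV : measurable_fun setT (fun X : 'M[R]_(n, m.+1) => f (X + V)%R).
  by apply: measurableT_comp => //; exact: measurable_addmx.
rewrite (ge0_integral_column_productS nu mfV (fun=> f0 _)).
rewrite (ge0_integral_column_productS nu mf f0).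
pose F x := \int[column_product (nu \o S) m]_Y f (mx_cons (x, Y)).
have mF : measurable_fun setT F.
  apply: (measurable_parametric_integral _ (f := fun x Y => f (mx_cons (x, Y)))) => //.
  exact: measurable_mx_cons_pair.
have F0 x : 0 <= F x by exact: integral_ge0.
rewrite -[RHS](nuV ord0 F mF F0).
apply: eq_integral => x _; rewrite /F.
have mfx : measurable_fun setT (fun Y => f (mx_cons (x + col ord0 V, Y)%R)).
  exact: measurable_mx_cons_pair.
rewrite -[RHS](IHm _ (rsubmx (V : 'M[R]_(n, 1 + m))) _ _ mfx (fun=> f0 _)).
  apply: eq_integral => Y _; congr f.
  rewrite -[V in LHS]mx_unconsK /mx_cons/= (@add_row_mx _ n 1 m).
  rewrite (_ : lsubmx _ = col ord0 V)//; apply/matrixP => i j; rewrite !mxE.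
  by congr (V _ _); apply: val_inj; rewrite /= (ord1 j).
move=> a; have := nuV (lift ord0 a).
rewrite (_ : col _ _ = col a (rsubmx (V : 'M[R]_(n, 1 + m))))//.
by apply/matrixP => i j; rewrite !mxE; congr (V _ _); apply: val_inj.
Qed.

Lemma ge0_integral_column_prod nu m (u : nat -> 'cV[R]_n -> \bar R) :
  (forall a, measurable_fun setT (u a)) -> (forall a x, 0 <= u a x) ->
  \int[column_product nu m]_X (\prod_(a < m) u a (col a X)) =
  \prod_(a < m) \int[nu a]_x u a x.
Proof.
elim: m nu u => [|m IHm] nu u mu u0.
  under eq_integral do rewrite big_ord0.
  by rewrite ge0_integral_column_product0 ?big_ord0//; exact: measurable_cst.
have mp k (v : nat -> 'cV[R]_n -> \bar R) : (forall a, measurable_fun setT (v a)) ->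
    measurable_fun setT (fun X : 'M[R]_(n, k) => \prod_(a < k) v a (col a X)).
  move=> mv; apply: emeasurable_prod => a.
  by apply: (measurableT_comp (mv _)); exact: measurable_col.
have p0 k (v : nat -> 'cV[R]_n -> \bar R) (X : 'M[R]_(n, k)) : (forall a x, 0 <= v a x) ->
   0 <= \prod_(a < k) v a (col a X).
  by move=> v0; apply: prode_ge0.
rewrite (ge0_integral_column_productS _ (mp _ u mu) (fun X => p0 _ u X u0)).
pose u' a := u a.+1.
have mu' a : measurable_fun setT (u' a) by exact: mu.
have u'0 a x : 0 <= u' a x by exact: u0.
rewrite big_ord_recl -(IHm (nu \o S) u' mu' u'0).
rewrite -ge0_integralZr//; last by apply: integral_ge0 => Y _; exact: p0.
apply: eq_integral => x _.
rewrite -ge0_integralZl//; [|exact: mp|by move=> Y _; exact: p0].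
apply: eq_integral => Y _; rewrite big_ord_recl mx_cons_col0; congr (_ * _).
by apply: eq_bigr => a _; rewrite mx_cons_colS.
Qed.

End column_product.

(** * Lebesgue measure on coordinate subspaces and block triangular matrices *)
Section coordinate_measure.
Local Open Scope ereal_scope.
Context {R : realType} {n : nat}.

Lemma measurable_coord_embedding k :
  measurable_fun setT (fun t : 'cV[R]_k => (pid_mx k : 'M[R]_(n, k)) *m t).
Proof. exact: measurable_mulmx. Qed.

Lemma measurable_coord_projection k :
  measurable_fun setT (fun x : 'cV[R]_n => (pid_mx k : 'M[R]_(k, n)) *m x).
Proof. exact: measurable_mulmx. Qed.

Lemma pid_mxK k : (k <= n)%N ->
  (pid_mx k : 'M[R]_(k, n)) *m (pid_mx k : 'M[R]_(n, k)) = 1%:M.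
Proof. by move=> kn; rewrite pid_mx_id// pid_mx_1. Qed.

Lemma coord_embeddingK k : (k <= n)%N ->
  cancel (fun t : 'cV[R]_k => (pid_mx k : 'M[R]_(n, k)) *m t)
         (fun x => (pid_mx k : 'M[R]_(k, n)) *m x).
Proof. by move=> kn t; rewrite mulmxA pid_mxK// mul1mx. Qed.

(** Lebesgue measure of the span of the first [k] basis vectors, as a measure on
    R^n. *)
Definition coord_measure k (kn : (k <= n)%N) :
    {sigma_finite_measure set 'cV[R]_n -> \bar R} :=
  @embedded_measure _ _ _ _ R (lebesgue_cV k) _ _ (sigma_finiteT (lebesgue_cV k))
    (@measurable_coord_embedding k) (@measurable_coord_projection k) (coord_embeddingK kn).

Lemma ge0_integral_coord_measure k (kn : (k <= n)%N) (f : 'cV[R]_n -> \bar R) :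
  measurable_fun setT f -> (forall x, 0 <= f x) ->
  \int[coord_measure kn]_x f x = \int[lebesgue_cV k]_t f (pid_mx k *m t).
Proof. by move=> mf f0; rewrite ge0_integral_embedded_measure. Qed.

Lemma measurable_coord_fun k (f : 'cV[R]_n -> \bar R) : measurable_fun setT f ->
  measurable_fun setT (fun t : 'cV[R]_k => f (pid_mx k *m t)).
Proof. by move=> mf; apply: (measurableT_comp mf); exact: measurable_coord_embedding. Qed.

Lemma coord_measure_translation k (kn : (k <= n)%N) (t : 'cV[R]_k) :
  translation_invariant (coord_measure kn) (pid_mx k *m t).
Proof.
move=> f mf f0.
have mft : measurable_fun setT (fun x : 'cV[R]_n => f (x + pid_mx k *m t)%R).
  by apply: measurableT_comp => //; exact: measurable_translate.
rewrite (ge0_integral_coord_measure kn mft (fun=> f0 _)).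
rewrite (ge0_integral_coord_measure kn mf f0).
rewrite -[RHS](ge0_integral_cV_translate t (measurable_coord_fun mf) (fun=> f0 _)).
by apply: eq_integral => x _; rewrite mulmxDr.
Qed.

Lemma coord_measure_scale k (kn : (k <= n)%N) (c : R) (f : 'cV[R]_n -> \bar R) :
  c != 0%R -> measurable_fun setT f -> (forall x, 0 <= f x) ->
  (`|c| ^+ k)%:E * \int[coord_measure kn]_x f (c *: x)%R = \int[coord_measure kn]_x f x.
Proof.
move=> c0 mf f0.
have mft : measurable_fun setT (fun x : 'cV[R]_n => f (c *: x)%R).
  by apply: measurableT_comp => //; exact: measurable_homothety.
rewrite (ge0_integral_coord_measure kn mft (fun=> f0 _)).
rewrite (ge0_integral_coord_measure kn mf f0).
rewrite -[RHS](ge0_integral_cV_scale c0 (measurable_coord_fun mf) (fun=> f0 _)).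
by congr (_ * _); apply: eq_integral => x _; rewrite scalemxAr.
Qed.

End coordinate_measure.

Section triangular_substitution.
Local Open Scope ereal_scope.
Context {R : realType} {n : nat}.

(** When [k a] is the end of the block of the column a, this is Lebesgue measure on
    the block upper triangular matrices. *)
Definition parabolic_measure (k : nat -> nat) (kn : forall a, (k a <= n)%N) m :
    {sigma_finite_measure set 'M[R]_(n, m) -> \bar R} :=
  column_product (fun a => coord_measure (kn a)) m.

Lemma pid_mx_nested k l : (k <= l)%N ->
  (pid_mx k : 'M[R]_(n, k)) = (pid_mx l : 'M[R]_(n, l)) *m (pid_mx k : 'M[R]_(l, k)).
Proof.
move=> kl; rewrite mul_pid_mx; congr (pid_mx _).
by rewrite (minn_idPr kl) (minn_idPr kl).
Qed.

Lemma mx_cons_mul_block m (t : 'cV[R]_n) (T : 'M[R]_(n, m)) (S : 'M[R]_(1 + m)) :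
  mx_cons (t, T) *m (S : 'M[R]_m.+1) =
  mx_cons (t *m ulsubmx S + T *m dlsubmx S, t *m ursubmx S + T *m drsubmx S)%R.
Proof. by rewrite -[S in LHS]submxK /mx_cons/= (@mul_row_block _ n 1 m 1 m). Qed.

(** The a-th column of T S is S_aa times the a-th column of T plus a combination
    of earlier columns, which lie in the span of the first [k a] basis vectors as
    [k] is monotone. For fixed earlier columns this is a homothety, of Jacobian
    |S_aa| ^ (k a), followed by a translation of that space. *)
Lemma parabolic_measure_triangular k kn m (S : 'M[R]_m) (f : 'M[R]_(n, m) -> \bar R) :
  {homo k : a b / (a <= b)%N} ->
  (forall i j : 'I_m, (j < i)%N -> S i j = 0%R) -> (forall i, S i i != 0%R) ->
  measurable_fun setT f -> (forall x, 0 <= f x) ->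
  (\prod_(a < m) `|S a a| ^+ k a)%:E * \int[@parabolic_measure k kn m]_T f (T *m S) =
  \int[@parabolic_measure k kn m]_T f T.
Proof.
rewrite /parabolic_measure.
elim: m k kn S f => [|m IHm] k kn S f kmono Supper Sdiag mf f0.
  rewrite big_ord0 mul1e; apply: eq_integral => T _; congr f.
  by apply/matrixP => i [].
have mfS : measurable_fun setT (fun T : 'M[R]_(n, m.+1) => f (T *m S)).
  by apply: measurableT_comp => //; exact: measurable_mulmx.
rewrite (ge0_integral_column_productS _ mfS (fun=> f0 _)).
rewrite (ge0_integral_column_productS _ mf f0).
set s := S ord0 ord0; pose b := ursubmx (S : 'M[R]_(1 + m)).
pose S' := drsubmx (S : 'M[R]_(1 + m)).
set rho := column_product _ m.
pose F x := \int[rho]_Y f (mx_cons (x, Y)).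
have mF : measurable_fun setT F.
  apply: (measurable_parametric_integral _ (f := fun x Y => f (mx_cons (x, Y)))) => //.
  exact: measurable_mx_cons_pair.
have F0 x : 0 <= F x by exact: integral_ge0.
rewrite -[RHS](coord_measure_scale (kn 0%N) (Sdiag ord0) mF F0).
rewrite big_ord_recl EFinM -muleA; congr (_ * _).
pose G x := \int[rho]_Y f (mx_cons (x, Y) *m S).
have mG : measurable_fun setT G.
  apply: (measurable_parametric_integral _ (f := fun x Y => f (mx_cons (x, Y) *m S))) => //.
  exact: (measurable_mx_cons_pair mfS).
have mFs : measurable_fun setT (fun x : 'cV[R]_n => F (s *: x)%R).
  by apply: measurableT_comp => //; exact: measurable_homothety.
rewrite (ge0_integral_coord_measure _ mG) => [|x]; last exact: integral_ge0.
rewrite (ge0_integral_coord_measure _ mFs) => [|x]; last exact: integral_ge0.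
rewrite -ge0_integralZl//; last 3 first.
- exact: measurable_coord_fun.
- by move=> t _; exact: integral_ge0.
- by rewrite lee_fin prodr_ge0.
apply: eq_integral => t _; rewrite /G /F; set x := pid_mx (k 0%N) *m t.
have mfx : measurable_fun setT (fun Y : 'M[R]_(n, m) => f (mx_cons (s *: x, Y + x *m b)%R)).
  by apply: measurable_mx_cons_pair => //; exact: measurable_addmx.
(* The first column contributes [x *m b] to the later ones: a translation by a
   vector of the smaller coordinate space. *)
have -> : \int[rho]_Y f (mx_cons (s *: x, Y)) =
    \int[rho]_Y f (mx_cons (s *: x, Y + x *m b)%R).
  have mfx0 : measurable_fun setT (fun Y : 'M[R]_(n, m) => f (mx_cons (s *: x, Y)%R)).
    exact: measurable_mx_cons_pair.
  rewrite -(@ge0_integral_column_translate _ _ _ _ (x *m b) _ _ mfx0)//.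
  move=> a f' mf' f'0 /=.
  have -> : col a (x *m b) =
      pid_mx (k a.+1) *m (b ord0 a *: (pid_mx (k 0%N) : 'M[R]_(k a.+1, k 0%N)) *m t).
    have -> (y : 'cV[R]_n) : col a (y *m b) = b ord0 a *: y.
      by apply/matrixP => i j; rewrite !mxE big_ord1 !mxE mulrC; congr (_ * y _ _)%R; rewrite (ord1 j).
    by rewrite /x (pid_mx_nested (kmono _ _ (leq0n a.+1))) -scalemxAl -scalemxAr !mulmxA.
  exact: coord_measure_translation.
have kmono' : {homo (fun a => k a.+1) : a b / (a <= b)%N}.
  by move=> c d cd; apply: kmono.
have Supper' (i j : 'I_m) : (j < i)%N -> S' i j = 0%R.
  by move=> ji; rewrite !mxE; apply: Supper; rewrite /= !add1n ltnS.
have Sdiag' i : S' i i != 0%R by rewrite !mxE Sdiag.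
rewrite -[RHS](IHm (fun a => k a.+1) (fun a => kn a.+1) S' _ kmono' Supper' Sdiag' mfx (fun=> f0 _)).
congr (_%:E * _).
  apply: eq_bigr => a _; rewrite /S' !mxE.
  by congr (`|S _ _| ^+ _)%R; apply: val_inj.
apply: eq_integral => Y _; congr f; rewrite mx_cons_mul_block.
have -> : dlsubmx (S : 'M[R]_(1 + m)) = 0%R.
  by apply/matrixP => i j; rewrite !mxE; apply: Supper; rewrite /= (ord1 j).
rewrite mulmx0 addr0 addrC; congr (mx_cons (_, _)).
have -> (y : 'cV[R]_n) : y *m ulsubmx (S : 'M[R]_(1 + m)) = s *: y; last by [].
apply/matrixP => i j; rewrite !mxE big_ord1 !mxE mulrC (ord1 j).
by congr (S _ _ * _)%R; apply: val_inj.
Qed.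

End triangular_substitution.

(** * Linear substitutions *)
Section linear_substitution.
Local Open Scope ereal_scope.
Context {R : realType}.

Definition matrix_lebesgue n m : {sigma_finite_measure set 'M[R]_(n, m) -> \bar R} :=
  column_product (fun=> lebesgue_cV n) m.

Lemma ge0_integral_matrix_lebesgueS n m (f : 'M[R]_(n, m.+1) -> \bar R) :
  measurable_fun setT f -> (forall x, 0 <= f x) ->
  \int[matrix_lebesgue n m.+1]_X f X =
  \int[lebesgue_cV n]_x \int[matrix_lebesgue n m]_Y f (mx_cons (x, Y)).
Proof. exact: ge0_integral_column_productS. Qed.

Lemma matrix_lebesgue_translation n m (V : 'M[R]_(n, m)) (f : 'M[R]_(n, m) -> \bar R) :
  measurable_fun setT f -> (forall x, 0 <= f x) ->
  \int[matrix_lebesgue n m]_X f (X + V)%R = \int[matrix_lebesgue n m]_X f X.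
Proof.
by apply: ge0_integral_column_translate => a g; exact: ge0_integral_cV_translate.
Qed.

(** A predicate on the matrix alone, so that the substitution rule can be proved
    for elementary factors and then composed. *)
Definition right_jacobian n m (T : 'M[R]_m) :=
  forall f : 'M[R]_(n, m) -> \bar R,
  measurable_fun setT f -> (forall X, 0 <= f X) ->
  (`|\det T| ^+ n)%:E * \int[matrix_lebesgue n m]_X f (X *m T) =
  \int[matrix_lebesgue n m]_X f X.

Lemma measurable_comp_mulmxr n m p (T : 'M[R]_(m, p)) (f : 'M[R]_(n, p) -> \bar R) :
  measurable_fun setT f -> measurable_fun setT (fun X : 'M[R]_(n, m) => f (X *m T)).
Proof. by move=> mf; apply: (measurableT_comp mf); exact: measurable_mulmx. Qed.

Lemma right_jacobianM n m (A B : 'M[R]_m) :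
  right_jacobian n A -> right_jacobian n B -> right_jacobian n (A *m B).
Proof.
move=> JA JB f mf f0.
rewrite det_mulmx normrM exprMn EFinM (muleC (_ ^+ n)%:E) -muleA.
rewrite -[RHS](JB f mf f0); congr (_ * _).
rewrite -[RHS](JA _ (measurable_comp_mulmxr B mf) (fun=> f0 _)); congr (_ * _).
by apply: eq_integral => X _; rewrite mulmxA.
Qed.

Lemma right_jacobian1 n m : right_jacobian n (1%:M : 'M[R]_m).
Proof.
move=> f mf f0; rewrite det1 normr1 expr1n mul1e.
by apply: eq_integral => X _; rewrite mulmx1.
Qed.

(** Multiples of the later columns are added to the first one; for fixed later
    columns this is a translation, so the first column is integrated first. *)
Lemma right_jacobian_lower n m (c : 'M[R]_(m, 1)) :
  right_jacobian n (block_mx 1%:M 0 c 1%:M : 'M[R]_(1 + m)).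
Proof.
move=> f mf f0; rewrite (@det_lblock _ 1 m) !det1 mulr1 normr1 expr1n mul1e.
rewrite (ge0_integral_matrix_lebesgueS (measurable_comp_mulmxr _ mf) (fun=> f0 _)).
rewrite (ge0_integral_matrix_lebesgueS mf f0).
have m1 : measurable_fun setT (fun z : 'cV[R]_n * 'M[R]_(n, m) => f (mx_cons (z.1, z.2))).
  exact: measurable_mx_cons_pair.
have m2 : measurable_fun setT (fun z : 'cV[R]_n * 'M[R]_(n, m) =>
    f (mx_cons (z.1 + z.2 *m c, z.2)%R)).
  apply: measurable_mx_cons_pair => //; apply: measurable_addmx => //.
  by apply: measurable_mulmx.
rewrite [RHS](tonelli_swap _ _ m1 (fun _ _ => f0 _)).
transitivity (\int[lebesgue_cV n]_x \int[matrix_lebesgue n m]_Y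
  f (mx_cons (x + Y *m c, Y)%R)).
  apply: eq_integral => x _; apply: eq_integral => Y _; congr f.
  rewrite mx_cons_mul_block block_mxKul block_mxKur block_mxKdl block_mxKdr.
  by rewrite !mulmx1 mulmx0 add0r.
rewrite (tonelli_swap _ _ m2 (fun _ _ => f0 _)).
apply: eq_integral => Y _.
rewrite -[RHS](ge0_integral_cV_translate (Y *m c) _ (fun=> f0 _))//.
exact: measurable_mx_cons_pair.
Qed.

(** The first column is scaled by [a]; for a fixed first column the others undergo
    the substitution by [D] followed by a translation. *)
Lemma right_jacobian_upper n m (a : R) (b : 'M[R]_(1, m)) (D : 'M[R]_m) :
  a != 0%R -> right_jacobian n D ->
  right_jacobian n (block_mx a%:M b 0 D : 'M[R]_(1 + m)).
Proof.
move=> a0 JD f mf f0; rewrite (@det_ublock _ 1 m) det_scalar1 normrM exprMn EFinM -muleA.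
rewrite (ge0_integral_matrix_lebesgueS (measurable_comp_mulmxr _ mf) (fun=> f0 _)).
rewrite (ge0_integral_matrix_lebesgueS mf f0).
pose F x := \int[matrix_lebesgue n m]_Y f (mx_cons (x, Y)).
have mF : measurable_fun setT F.
  apply: (measurable_parametric_integral _ (f := fun x Y => f (mx_cons (x, Y)))) => //.
  exact: measurable_mx_cons_pair.
have F0 x : 0 <= F x by exact: integral_ge0.
rewrite -[RHS](ge0_integral_cV_scale a0 mF F0); congr (_ * _).
have m2 : measurable_fun setT (fun z : 'cV[R]_n * 'M[R]_(n, m) =>
    f (mx_cons (a *: z.1, z.2 *m D + z.1 *m b)%R)).
  apply: measurable_mx_cons_pair => //; first exact: measurable_scalemx.
  by apply: measurable_addmx; apply: measurable_mulmx.
transitivity ((`|\det D| ^+ n)%:E * \int[lebesgue_cV n]_x \int[matrix_lebesgue n m]_Y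
  f (mx_cons (a *: x, Y *m D + x *m b)%R)).
  congr (_ * _); apply: eq_integral => x _; apply: eq_integral => Y _; congr f.
  rewrite mx_cons_mul_block block_mxKul block_mxKur block_mxKdl block_mxKdr.
  by rewrite mulmx0 addr0 mul_mx_scalar addrC.
rewrite -ge0_integralZl//; last 2 first.
- by apply: (measurable_parametric_integral _
    (f := fun (x : 'cV[R]_n) Y => f (mx_cons (a *: x, Y *m D + x *m b)%R))).
- by move=> x _; exact: integral_ge0.
apply: eq_integral => x _; rewrite /F.
have mfx : measurable_fun setT (fun Y : 'M[R]_(n, m) => f (mx_cons (a *: x, Y)%R)).
  exact: measurable_mx_cons_pair.
rewrite -[RHS](matrix_lebesgue_translation (x *m b) mfx)//.
rewrite -[RHS]JD//.
by apply: (measurable_mx_cons_pair mf) => //; exact: measurable_addmx.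
Qed.

(** Gaussian elimination. If the corner entry is nonzero, the matrix is a lower
    factor times an upper one whose block is the Schur complement of the corner.
    Otherwise adding to the first row another row with a nonzero first entry makes
    the corner nonzero. *)
Lemma right_jacobian_unitmx n m (T : 'M[R]_m) : T \in unitmx -> right_jacobian n T.
Proof.
elim: m T => [|m IHm] T; first by rewrite (_ : T = 1%:M) => [_|]; [exact: right_jacobian1|apply/matrixP => -[]].
have pivot (P : 'M[R]_(1 + m)) : P ord0 ord0 != 0%R -> P \in unitmx -> right_jacobian n P.
  set a := P _ _ => a0 Pu.
  pose b := ursubmx P; pose c := dlsubmx P; pose D := (drsubmx P - a^-1 *: (c *m b))%R.
  have aE : ulsubmx P = a%:M.
    apply/matrixP => i j; rewrite !ord1 !mxE eqxx mulr1n /a.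
    by congr (P _ _); apply: val_inj.
  have PE : P = block_mx 1%:M 0 (a^-1 *: c) 1%:M *m block_mx a%:M b 0 D.
    rewrite mulmx_block !mul1mx !mul0mx !addr0 mul_mx_scalar scalerA mulfV// scale1r.
    rewrite -scalemxAl /D [(_ + (_ - _))%R]addrC subrK -aE.
    by rewrite -[LHS]submxK.
  rewrite PE; apply: right_jacobianM; first exact: right_jacobian_lower.
  apply: right_jacobian_upper => //; apply: IHm.
  move: Pu; rewrite PE unitmx_mul => /andP[_].
  by rewrite !unitmxE (@det_ublock _ 1 m) unitrM => /andP[].
move=> Tu; have [T0|] := boolP [forall i, T i ord0 == 0%R].
  move: Tu; rewrite unitmxE (expand_det_col _ ord0) big1 ?unitr0// => i _.
  by rewrite (eqP (forallP T0 i)) mul0r.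
rewrite negb_forall => /existsP[i Ti0].
have [Too|] := eqVneq (T ord0 ord0) 0%R; last by move/pivot; exact.
have [j ij|i0] := unliftP ord0 i; last by rewrite i0 Too eqxx in Ti0.
pose E (s : R) : 'M[R]_(1 + m) := block_mx 1%:M (s *: delta_mx ord0 j) 0 1%:M.
have EE : E (-1)%R *m E 1%R = 1%:M.
  rewrite mulmx_block !mul1mx !mulmx1 !mulmx0 !mul0mx !addr0 add0r scale1r scaleN1r subrr.
  by rewrite -scalar_mx_block.
have -> : T = E (-1)%R *m (E 1%R *m (T : 'M[R]_(1 + m))) by rewrite mulmxA EE mul1mx.
apply: right_jacobianM.
  by apply: right_jacobian_upper; [exact: oner_neq0|exact: right_jacobian1].
apply: pivot; last first.
  rewrite unitmx_mul Tu andbT unitmxE (@det_ublock _ 1 m) !det1 mulr1; exact: unitr1.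
have E0 k : E 1%R ord0 (lift ord0 k) = (k == j)%:R.
  transitivity (E 1%R (lshift m ord0) (rshift 1 k)).
    by congr (E _ _ _); apply: val_inj.
  by rewrite block_mxEur scale1r mxE eqxx.
rewrite mxE big_ord_recl Too mulr0 add0r (bigD1 j)//= E0 eqxx mul1r big1 ?addr0.
  by rewrite -ij.
by move=> k kj; rewrite E0 (negbTE kj) mul0r.
Qed.

Lemma ge0_integral_cV1 (f : 'cV[R]_1 -> \bar R) :
  measurable_fun setT f -> (forall x, 0 <= f x) ->
  \int[lebesgue_cV 1]_x f x = \int[lebesgue_measure]_a f a%:M.
Proof.
move=> mf f0; rewrite ge0_integral_cVS//; apply: eq_integral => a _.
rewrite [LHS]integral_dirac//; last by apply: (measurableT_comp mf); exact: measurable_cV_consr.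
rewrite diracT mul1e; congr f; apply/matrixP => i j; rewrite !ord1 cV_cons0.
by rewrite !mxE eqxx.
Qed.

(** R^k is the space of rows with k columns of height one; this reduces the
    substitutions in R^k to the right multiplications treated above. *)
Lemma ge0_integral_cV_trmx k (f : 'cV[R]_k -> \bar R) :
  measurable_fun setT f -> (forall x, 0 <= f x) ->
  \int[lebesgue_cV k]_x f x = \int[matrix_lebesgue 1 k]_X f X^T.
Proof.
elim: k f => [|k IHk] f mf f0.
  rewrite [LHS]integral_dirac// [RHS]integral_dirac//; last first.
    by apply: (measurableT_comp mf); exact: measurable_trmx.
  by rewrite !diracT !mul1e trmx0.
have mft : measurable_fun setT (fun X : 'M[R]_(1, k.+1) => f X^T).
  by apply: (measurableT_comp mf); exact: measurable_trmx.
rewrite ge0_integral_cVS// ge0_integral_matrix_lebesgueS//.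
rewrite [RHS]ge0_integral_cV1//; last first.
- by move=> x; exact: integral_ge0.
- apply: (measurable_parametric_integral _ (f := fun x Y => f (mx_cons (x, Y))^T)) => //.
  exact: (measurable_mx_cons_pair mft).
apply: eq_integral => a _; rewrite IHk//; last by apply: (measurableT_comp mf); exact: measurable_cV_consr.
apply: eq_integral => Y _; congr f; apply/matrixP => i j; rewrite (ord1 j) [RHS]mxE.
have [b ->|->] := unliftP ord0 i.
  rewrite cV_consS/= mxE; have /matrixP/(_ ord0 ord0) := mx_cons_colS (a%:M, Y) b.
  by rewrite !mxE => ->.
rewrite cV_cons0; have /matrixP/(_ ord0 ord0) := mx_cons_col0 (a%:M, Y).
by rewrite !mxE eqxx mulr1n => ->.
Qed.

Lemma ge0_integral_cV_mulmx k (A : 'M[R]_k) (f : 'cV[R]_k -> \bar R) : A \in unitmx ->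
  measurable_fun setT f -> (forall x, 0 <= f x) ->
  `|\det A|%:E * \int[lebesgue_cV k]_x f (A *m x) = \int[lebesgue_cV k]_x f x.
Proof.
move=> Au mf f0.
have mfA : measurable_fun setT (fun x : 'cV[R]_k => f (A *m x)).
  by apply: (measurableT_comp mf); exact: measurable_mulmx.
have mft : measurable_fun setT (fun X : 'M[R]_(1, k) => f X^T).
  by apply: (measurableT_comp mf); exact: measurable_trmx.
rewrite (ge0_integral_cV_trmx mfA)// (ge0_integral_cV_trmx mf)//.
rewrite -[RHS](@right_jacobian_unitmx 1 k A^T _ _ mft) ?unitmx_tr//.
rewrite det_tr expr1; congr (_ * _).
by apply: eq_integral => X _; rewrite trmx_mul trmxK.
Qed.

Lemma ge0_integral_mulmxl n m (A : 'M[R]_n) (f : 'M[R]_(n, m) -> \bar R) : \det A = 1%R ->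
  measurable_fun setT f -> (forall X, 0 <= f X) ->
  \int[matrix_lebesgue n m]_X f (A *m X) = \int[matrix_lebesgue n m]_X f X.
Proof.
move=> A1; have Au : A \in unitmx by rewrite unitmxE A1 unitr1.
elim: m f => [|m IHm] f mf f0.
  by apply: eq_integral => X _; congr f; apply/matrixP => i [].
have mfA : measurable_fun setT (fun X : 'M[R]_(n, m.+1) => f (A *m X)).
  by apply: (measurableT_comp mf); exact: measurable_mulmx.
rewrite (ge0_integral_matrix_lebesgueS mfA (fun=> f0 _)).
rewrite (ge0_integral_matrix_lebesgueS mf f0).
pose F x := \int[matrix_lebesgue n m]_Y f (mx_cons (x, Y)).
have mF : measurable_fun setT F.
  apply: (measurable_parametric_integral _ (f := fun x Y => f (mx_cons (x, Y)))) => //.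
  exact: measurable_mx_cons_pair.
have F0 x : 0 <= F x by exact: integral_ge0.
rewrite -[RHS](ge0_integral_cV_mulmx Au mF F0) A1 normr1 mul1e.
apply: eq_integral => x _; rewrite /F -[RHS]IHm//; last exact: measurable_mx_cons_pair.
by apply: eq_integral => Y _; rewrite /mx_cons/= (@mul_mx_row _ n n 1 m).
Qed.

End linear_substitution.

(** * Gram-Schmidt orthonormalization *)
Section gram_schmidt.
Context {R : realType}.

Definition euclidean_norm n (x : 'cV[R]_n) : R := Num.sqrt ((x^T *m x) 0 0).

Definition unit_vector n (x : 'cV[R]_n) : 'cV[R]_n := (euclidean_norm x)^-1 *: x.

(** A zero column is sent to zero, so that the function is defined, measurable and
    equivariant on all matrices, without a condition on the rank. *)
Fixpoint gram_schmidt n k : 'M[R]_(n, k) -> 'M[R]_(n, k) :=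
  match k with
  | 0 => id
  | k'.+1 => fun X =>
      let q := unit_vector (mx_uncons X).1 in
      let Y := (mx_uncons X).2 in
      mx_cons (q, gram_schmidt (Y - q *m (q^T *m Y)))
  end.

Definition upper_triangular k (S : 'M[R]_k) :=
  forall i j : 'I_k, (j < i)%N -> S i j = 0.

Lemma mulmx_mx_cons n m k (A : 'M[R]_(m, n)) (p : 'cV[R]_n * 'M[R]_(n, k)) :
  A *m mx_cons p = mx_cons (A *m p.1, A *m p.2).
Proof. exact: (@mul_mx_row _ m n 1 k). Qed.

Lemma gram_schmidt_cons n k (x : 'cV[R]_n) (Y : 'M[R]_(n, k)) :
  gram_schmidt (mx_cons (x, Y)) = mx_cons (unit_vector x,
    gram_schmidt (Y - unit_vector x *m ((unit_vector x)^T *m Y))).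
Proof.
transitivity (let p := mx_uncons (mx_cons (x, Y)) in mx_cons (unit_vector p.1,
    gram_schmidt (p.2 - unit_vector p.1 *m ((unit_vector p.1)^T *m p.2)))).
  by [].
by rewrite mx_consK.
Qed.

Lemma gram_schmidt_mul n k (O : 'M[R]_n) (X : 'M[R]_(n, k)) : O^T *m O = 1%:M ->
  gram_schmidt (O *m X) = O *m gram_schmidt X.
Proof.
move=> OO; elim: k X => [|k IHk] X; first by [].
rewrite -[X]mx_unconsK; case: (mx_uncons X) => x Y.
rewrite mulmx_mx_cons !gram_schmidt_cons mulmx_mx_cons.
have -> : unit_vector (O *m x) = O *m unit_vector x.
  by rewrite /unit_vector /euclidean_norm trmx_mul mulmxA -(mulmxA x^T) OO mulmx1 scalemxAr.
congr mx_cons; congr pair; rewrite -IHk; congr gram_schmidt.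
by rewrite mulmxBr trmx_mul !mulmxA -(mulmxA _ O^T O) OO mulmx1.
Qed.

Lemma measurable_euclidean_norm n : measurable_fun setT (@euclidean_norm n).
Proof.
apply: measurable_sqrtr; apply: measurable_entry; apply: measurable_mulmx => //.
exact: measurable_trmx.
Qed.

Lemma measurable_gram_schmidt n k : measurable_fun setT (@gram_schmidt n k).
Proof.
elim: k => [|k IHk]; first exact: measurable_id.
rewrite /=; set q := fun X : 'M[R]_(n, k.+1) => unit_vector (mx_uncons X).1.
have m1 : measurable_fun setT (fun X : 'M[R]_(n, k.+1) => (mx_uncons X).1).
  by apply: (measurableT_comp measurable_fst); exact: measurable_mx_uncons.
have m2 : measurable_fun setT (fun X : 'M[R]_(n, k.+1) => (mx_uncons X).2).
  by apply: (measurableT_comp measurable_snd); exact: measurable_mx_uncons.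
have mq : measurable_fun setT q.
  apply: measurable_scalemx => //; apply: measurable_invr.
  by apply: (measurableT_comp (@measurable_euclidean_norm n)).
apply: (measurableT_comp (@measurable_mx_cons _ _ k)).
apply/measurable_fun_pairP; split => //=.
apply: (measurableT_comp IHk); apply: measurable_submx => //.
apply: measurable_mulmx => //; apply: measurable_mulmx => //.
exact: measurable_trmx.
Qed.

Lemma euclidean_norm_gt0 n (x : 'cV[R]_n) : x != 0 -> 0 < euclidean_norm x.
Proof. by move=> x0; rewrite sqrtr_gt0 dot_cV_gt0. Qed.

Lemma unit_vectorP n (x : 'cV[R]_n) : x != 0 -> (unit_vector x)^T *m unit_vector x = 1%:M.
Proof.
move=> x0; rewrite /unit_vector (_ : (_ *: x)^T = (euclidean_norm x)^-1 *: x^T); last exact: linearZ.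
rewrite -scalemxAr -scalemxAl scalerA.
apply/matrixP => i j; rewrite !ord1 mxE [RHS]mxE eqxx mulr1n -expr2 exprVn.
by rewrite sqr_sqrtr ?mulVf// ?gt_eqF ?dot_cV_gt0// ltW// dot_cV_gt0.
Qed.

(** The left inverse [Z] expresses that the columns are independent in a form that
    passes to the recursive call: its last rows are a left inverse of the
    projected columns. *)
Lemma gram_schmidtP n k (X : 'M[R]_(n, k)) (Z : 'M[R]_(k, n)) : Z *m X = 1%:M ->
  (gram_schmidt X)^T *m gram_schmidt X = 1%:M /\
  exists S : 'M[R]_k,
    [/\ upper_triangular S, forall i, 0 < S i i & X = gram_schmidt X *m S].
Proof.
elim: k X Z => [|k IHk] X Z ZX.
  split; first by apply/matrixP => -[].
  by exists 1%:M; split; [move=> []|move=> []|rewrite mulmx1].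
move: ZX; rewrite -[X]mx_unconsK; case: (mx_uncons X) => {X} x Y ZX.
rewrite gram_schmidt_cons; set q := unit_vector x.
pose Z1 := usubmx (Z : 'M[R]_(1 + k, n)); pose Z2 := dsubmx (Z : 'M[R]_(1 + k, n)).
have [Z1x Z2x Z2Y] : [/\ Z1 *m x = 1%:M, Z2 *m x = 0 & Z2 *m Y = 1%:M].
  have ZE : Z = col_mx Z1 Z2 :> 'M[R]_(1 + k, n) by rewrite vsubmxK.
  move: ZX; rewrite ZE /mx_cons/= (@mul_col_row _ 1 k n 1 k).
  by rewrite (@scalar_mx_block _ 1 k) => /(@eq_block_mx _ 1 k 1 k)[].
have x0 : x != 0.
  apply/eqP => x0; move: Z1x; rewrite x0 mulmx0 => /matrixP/(_ 0 0).
  by rewrite !mxE eqxx => /eqP; rewrite eq_sym oner_eq0.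
have N0 := euclidean_norm_gt0 x0.
have qq : q^T *m q = 1%:M by exact: unit_vectorP.
have xE : x = euclidean_norm x *: q by rewrite scalerA mulfV ?scale1r// gt_eqF.
set Y' := Y - q *m (q^T *m Y).
have qY' : q^T *m Y' = 0 by rewrite mulmxBr (mulmxA q^T q) qq mul1mx subrr.
have [|QQ [S [Su Sd Y'E]]] := IHk Y' Z2.
  by rewrite mulmxBr (mulmxA Z2 q) /q /unit_vector -scalemxAr Z2x scaler0 mul0mx subr0.
have [S' SS'] : exists S', S *m S' = 1%:M.
  exists (invmx S); rewrite mulmxV// unitmxE unitfE -det_tr.
  rewrite (@det_trig _ _ S^T); last first.
    by apply/is_trig_mxP => i j ij; rewrite mxE Su.
  by rewrite gt_eqF// prodr_gt0// => i _; rewrite mxE.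
have qQ : q^T *m gram_schmidt Y' = 0.
  by rewrite -[LHS]mulmx1 -SS' !mulmxA -(mulmxA q^T) -Y'E qY' mul0mx.
have Qq : (gram_schmidt Y')^T *m q = 0 by rewrite -[RHS]trmx0 -qQ trmx_mul trmxK.
split.
  rewrite /mx_cons/= (@tr_row_mx _ n 1 k) (@mul_col_row _ 1 k n 1 k).
  by rewrite qq qQ Qq QQ -(@scalar_mx_block _ 1 k).
exists (block_mx (euclidean_norm x)%:M (q^T *m Y) 0 S : 'M[R]_(1 + k)); split.
- move=> i j; rewrite /block_mx mxE; case: split_ordP => i' -> /=; rewrite mxE.
    by rewrite ord1.
  by case: split_ordP => j' -> /=; rewrite ?mxE// !add1n ltnS; exact: Su.
- move=> i; case: (@split_ordP 1 k i) => i' ->; rewrite ?(@block_mxEul _ 1 k 1 k) ?(@block_mxEdr _ 1 k 1 k)//.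
  by rewrite mxE eqxx mulr1n.
rewrite /mx_cons/= (@mul_row_block _ n 1 k 1 k) mulmx0 addr0 mul_mx_scalar -xE.
by rewrite -Y'E /Y' addrC subrK.
Qed.

End gram_schmidt.

(** * Volumes of frames and norms on subspaces *)
Section frames.
Context {R : realType}.

Definition frame_volume n k (Y : 'M[R]_(n, k)) : R := Num.sqrt (\det (Y^T *m Y)).

Lemma frame_volume_ge0 n k (Y : 'M[R]_(n, k)) : 0 <= frame_volume Y.
Proof. exact: sqrtr_ge0. Qed.

Lemma frame_volumeM n k (Y : 'M[R]_(n, k)) (A : 'M[R]_k) :
  frame_volume (Y *m A) = frame_volume Y * `|\det A|.
Proof.
rewrite /frame_volume trmx_mul mulmxA -(mulmxA A^T) !det_mulmx det_tr.
rewrite mulrC mulrA -expr2 sqrtrM ?sqr_ge0// sqrtr_sqr mulrC; congr (_ * _).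
Qed.

Lemma frame_volume_isometry m n k (O : 'M[R]_(m, n)) (Y : 'M[R]_(n, k)) :
  O^T *m O = 1%:M -> frame_volume (O *m Y) = frame_volume Y.
Proof. by move=> OO; rewrite /frame_volume trmx_mul mulmxA -(mulmxA Y^T) OO mulmx1. Qed.

Lemma frame_volume_orthonormal n k (B : 'M[R]_(n, k)) :
  B^T *m B = 1%:M -> frame_volume B = 1.
Proof. by move=> BB; rewrite /frame_volume BB det1 sqrtr1. Qed.

Lemma frame_left_inverse n k (Y : 'M[R]_(n, k)) :
  frame_volume Y != 0 -> exists Z : 'M[R]_(k, n), Z *m Y = 1%:M.
Proof.
move=> Y0; exists (invmx (Y^T *m Y) *m Y^T); rewrite -mulmxA mulVmx// unitmxE unitfE.
by apply: contra Y0 => /eqP dY; rewrite /frame_volume dY sqrtr0.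
Qed.

Lemma measurable_frame_volume n k : measurable_fun setT (@frame_volume n k).
Proof.
apply: measurable_sqrtr; apply: measurable_det; apply: measurable_mulmx => //.
exact: measurable_trmx.
Qed.

Lemma mem_mx_imageP n k (B : 'M[R]_(n, k)) x :
  reflect (exists y, x = B *m y) (x \in mx_image B fullv).
Proof.
apply: (iffP memv_imgP) => [[y _ ->]|[y ->]]; exists y => //; rewrite ?memvf ?lfunE//.
Qed.

Lemma mx_imageM m n k (A : 'M[R]_(m, n)) (B : 'M[R]_(n, k)) :
  mx_image (A *m B) fullv = mx_image A (mx_image B fullv).
Proof.
apply/vspaceP => x; apply/mem_mx_imageP/memv_imgP => [[y ->]|[_ /mem_mx_imageP[y ->] ->]].
  by exists (B *m y); [apply/mem_mx_imageP; exists y|rewrite lfunE /= mulmxA].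
by exists y; rewrite lfunE /= mulmxA.
Qed.

Lemma dim_mx_image n k (B : 'M[R]_(n, k)) (Z : 'M[R]_(k, n)) :
  Z *m B = 1%:M -> \dim (mx_image B fullv) = k.
Proof.
move=> ZB; rewrite limg_dim_eq ?dimvf ?dim_matrix ?mulr1//.
apply/eqP; rewrite capfv; apply/lker0P => x y; rewrite !lfunE/= => Bxy.
by rewrite -[x]mul1mx -[y]mul1mx -ZB -!mulmxA Bxy.
Qed.

Lemma orthonormal_basis_fix n k (F : {vspace 'cV[R]_n}) (B : 'M[R]_(n, k)) x :
  orthonormal_basis F B -> x \in F -> B *m (B^T *m x) = x.
Proof.
by move=> [BB <-] /mem_mx_imageP[y ->]; rewrite (mulmxA B^T) BB mul1mx.
Qed.

Lemma orthonormal_basis_mem n k (F : {vspace 'cV[R]_n}) (B : 'M[R]_(n, k)) y :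
  orthonormal_basis F B -> B *m y \in F.
Proof. by move=> [_ <-]; apply/mem_mx_imageP; exists y. Qed.

Lemma orthoproj_fix n (F : {vspace 'cV[R]_n}) x : (x \in F) = (orthoproj F *m x == x).
Proof.
apply/idP/eqP => [xF|<-]; rewrite -mulmxA; first exact: orthonormal_basis_fix (onbP F) xF.
exact: orthonormal_basis_mem (onbP F).
Qed.

(** For two orthonormal bases B and C of one space, B B^T fixes C and C C^T fixes
    B; transposing the first relation gives C C^T = C C^T B B^T = B B^T. *)
Lemma orthoproj_unique n k (F : {vspace 'cV[R]_n}) (B : 'M[R]_(n, k)) :
  orthonormal_basis F B -> orthoproj F = B *m B^T.
Proof.
move=> oB; have oC := onbP F; set C := onb F in oC *.
have fixmx p q (D : 'M[R]_(n, p)) (E : 'M[R]_(n, q)) :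
    orthonormal_basis F D -> orthonormal_basis F E -> D *m D^T *m E = E.
  move=> oD oE; apply/matrixP => i j.
  have : E *m delta_mx j 0 \in F by exact: orthonormal_basis_mem oE.
  by move/(orthonormal_basis_fix oD); rewrite !mulmxA -!colE => /matrixP/(_ i 0); rewrite !mxE.
have := fixmx _ _ _ _ oB oC; have := fixmx _ _ _ _ oC oB.
rewrite /orthoproj -/C => CB BC.
have : (B *m B^T *m C *m C^T)^T = C *m C^T *m B *m B^T.
  by rewrite !trmx_mul !trmxK !mulmxA.
by rewrite BC CB trmx_mul trmxK.
Qed.

Lemma measurable_subspace n (F : {vspace 'cV[R]_n}) : measurable [set` F].
Proof.
pose h (x : 'cV[R]_n) := (((x - orthoproj F *m x)^T *m (x - orthoproj F *m x)) ord0 ord0 : R).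
have mh : measurable_fun setT h.
  have ms : measurable_fun setT (fun x : 'cV[R]_n => x - orthoproj F *m x).
    by apply: measurable_submx => //; exact: measurable_mulmx.
  by apply: measurable_entry; apply: measurable_mulmx => //; exact: measurable_trmx.
rewrite (_ : [set` F] = h @^-1` [set 0]).
  by rewrite -[X in measurable X]setTI; exact: mh.
apply/seteqP; split => x /=; rewrite orthoproj_fix.
  by move=> /eqP Fx; rewrite /h Fx subrr mulmx0 mxE.
move=> hx; rewrite eq_sym -subr_eq0; apply: contraT => /dot_cV_gt0.
by rewrite -[X in 0 < X]/(h x) hx ltxx.
Qed.

Local Open Scope ereal_scope.

Lemma L1norm_on_orthonormal n k (F : {vspace 'cV[R]_n}) : \dim F = k ->
  exists2 B : 'M[R]_(n, k), orthonormal_basis F B &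
  forall f : 'cV[R]_n -> R, measurable_fun setT f ->
  L1norm_on F f = \int[lebesgue_cV k]_t `|f (B *m t)|%:E.
Proof.
move=> dF; case: k / dF; exists (onb F); first exact: onbP.
move=> f mf; rewrite /L1norm_on /lebesgue_on.
have mB : measurable_fun setT (mulmx (onb F) : 'cV[R]_(\dim F) -> _).
  by rewrite (_ : mulmx _ = fun t => onb F *m t)//; exact: measurable_mulmx.
rewrite (ge0_integral_pushforward mB)//.
- rewrite (_ : _ @^-1` _ = setT)//; apply/seteqP; split => // y _ /=.
  exact: orthonormal_basis_mem (onbP F).
- exact: measurable_subspace.
- apply/measurable_EFinP; apply: measurable_funTS.
  exact: (measurableT_comp _ mf).
Qed.

(** If B is an orthonormal basis, then Y = B A with A = B^T Y, and the change of
    variables by A has the Jacobian |det A|, which is the volume of Y. *)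
Lemma L1norm_on_frame n k (Y : 'M[R]_(n, k)) (f : 'cV[R]_n -> R) :
  frame_volume Y != 0%R -> measurable_fun setT f ->
  L1norm_on (mx_image Y fullv) f =
  (frame_volume Y)%:E * \int[lebesgue_cV k]_t `|f (Y *m t)|%:E.
Proof.
move=> Y0 mf; have [Z ZY] := frame_left_inverse Y0.
have [B oB ->//] := L1norm_on_orthonormal (dim_mx_image ZY).
have YE : Y = B *m (B^T *m Y).
  apply/matrixP => i j.
  have : Y *m delta_mx j ord0 \in mx_image Y fullv by apply/mem_mx_imageP; eexists.
  move/(orthonormal_basis_fix oB); rewrite !mulmxA -!colE => /matrixP/(_ i ord0).
  by rewrite !mxE => <-.
have volY : frame_volume Y = `|\det (B^T *m Y)|%R.
  by rewrite YE frame_volumeM (frame_volume_orthonormal oB.1) mul1r -YE.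
rewrite volY -[LHS](@ge0_integral_cV_mulmx _ _ (B^T *m Y)).
- by congr (_ * _); apply: eq_integral => t _; rewrite [in RHS]YE !mulmxA.
- by rewrite unitmxE unitfE -normr_eq0 -volY.
- apply/measurable_EFinP; apply: measurableT_comp => //.
  by apply: (measurableT_comp mf); exact: measurable_mulmx.
- by move=> t; rewrite lee_fin.
Qed.

End frames.

(** * Leading columns and leading blocks *)
Section leading_blocks.
Context {R : realType} {n : nat}.
Implicit Types X T S : 'M[R]_n.

Definition leading_volume k X : R := frame_volume (X *m (pid_mx k : 'M[R]_(n, k))).

Definition leading_block k T : 'M[R]_k :=
  (pid_mx k : 'M[R]_(k, n)) *m T *m (pid_mx k : 'M[R]_(n, k)).

(** [T] maps the span of the first [k] basis vectors to itself, and acts on it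
    through its leading block. *)
Definition stabilizes k T : Prop :=
  T *m (pid_mx k : 'M[R]_(n, k)) = (pid_mx k : 'M[R]_(n, k)) *m leading_block k T.

Lemma stabilizesP k T : (k <= n)%N ->
  (forall i j : 'I_n, (j < k)%N -> (k <= i)%N -> T i j = 0) -> stabilizes k T.
Proof.
move=> kn T0; rewrite /stabilizes /leading_block !mulmxA mul_pid_mx !minnn.
apply/matrixP => i j; have jn : (j < n)%N by exact: leq_trans (ltn_ord j) kn.
have E (M : 'M[R]_n) l : (M *m (pid_mx k : 'M[R]_(n, k))) l j = M l (Ordinal jn).
  rewrite mxE (bigD1 (Ordinal jn))//= big1 ?addr0.
    by rewrite mxE/= eqxx ltn_ord mulr1.
  move=> p pj; rewrite mxE; case: eqP => [pj'|]; last by rewrite mulr0.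
  by case/eqP: pj; exact: val_inj.
rewrite !E mxE; have [ik|ki] := ltnP i k.
  rewrite (bigD1 i)//= mxE eqxx ik mul1r big1 ?addr0// => p pi.
  rewrite mxE; case: eqP => [ip|]; last by rewrite mul0r.
  by case/eqP: pi; apply: val_inj.
rewrite T0//= big1// => p _; rewrite mxE.
by rewrite ltnNge ki andbF mul0r.
Qed.

Lemma leading_volumeM k X T : stabilizes k T ->
  leading_volume k (X *m T) = leading_volume k X * `|\det (leading_block k T)|.
Proof. by move=> kT; rewrite /leading_volume -mulmxA kT mulmxA frame_volumeM. Qed.

Lemma leading_volume1 k : (k <= n)%N -> leading_volume k 1%:M = 1.
Proof.
move=> kn; rewrite /leading_volume mul1mx; apply: frame_volume_orthonormal.
by rewrite tr_pid_mx pid_mxK.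
Qed.

Lemma leading_volume_stable k T : (k <= n)%N -> stabilizes k T ->
  leading_volume k T = `|\det (leading_block k T)|.
Proof. by move=> kn kT; rewrite -[T in LHS]mul1mx leading_volumeM// leading_volume1// mul1r. Qed.

Lemma leading_block_unit k T : (k <= n)%N -> stabilizes k T -> T \in unitmx ->
  leading_block k T \in unitmx.
Proof.
move=> kn kT Tu.
have : (pid_mx k : 'M[R]_(k, n)) *m invmx T *m (pid_mx k : 'M[R]_(n, k))
    *m leading_block k T = 1%:M.
  by rewrite -mulmxA -kT !mulmxA -(mulmxA _ (invmx T)) mulVmx// mulmx1 pid_mxK.
by move/mulmx1_unit => [].
Qed.

Lemma upper_triangular_stabilizes k S : (k <= n)%N -> upper_triangular S -> stabilizes k S.
Proof. by move=> kn Su; apply: stabilizesP => // i j jk ki; apply: Su; exact: leq_trans ki. Qed.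

Lemma det_upper_triangular m (S : 'M[R]_m) : upper_triangular S -> \det S = \prod_i S i i.
Proof.
move=> Su; rewrite -det_tr det_trig; first by apply: eq_bigr => i _; rewrite mxE.
by apply/is_trig_mxP => i j ij; rewrite mxE Su.
Qed.

Lemma leading_volume_upper k S : (k <= n)%N -> upper_triangular S ->
  leading_volume k S = \prod_(a < n | (a < k)%N) `|S a a|.
Proof.
move=> kn Su; rewrite leading_volume_stable//; last exact: upper_triangular_stabilizes.
have E i j : leading_block k S i j = S (widen_ord kn i) (widen_ord kn j).
  rewrite mxE (bigD1 (widen_ord kn j))//= big1 ?addr0; last first.
    move=> p pj; rewrite [X in _ * X]mxE; case: eqP => [pj'|]; last by rewrite mulr0.
    by case/eqP: pj; exact: val_inj.
  rewrite [X in _ * X]mxE /= eqxx ltn_ord mulr1 mxE (bigD1 (widen_ord kn i))//= big1 ?addr0.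
    by rewrite mxE/= eqxx ltn_ord mul1r.
  move=> p pi; rewrite mxE; case: eqP => [ip|]; last by rewrite mul0r.
  by case/eqP: pi; exact: val_inj.
rewrite det_upper_triangular; last first.
  by move=> i j ji; rewrite E; exact: Su.
rewrite normr_prod (big_ord_narrow kn).
by apply: eq_bigr => i _; rewrite E.
Qed.

Lemma leading_volume_unit_gt0 k X : (k <= n)%N -> X \in unitmx -> 0 < leading_volume k X.
Proof.
move=> kn Xu; have [QQ [S [Su Sd XE]]] := gram_schmidtP (mulVmx Xu).
rewrite XE leading_volumeM; last exact: upper_triangular_stabilizes.
rewrite -leading_volume_stable; [|by []|exact: upper_triangular_stabilizes].
rewrite (leading_volume_upper kn Su).
rewrite /leading_volume frame_volume_isometry// frame_volume_orthonormal; last first.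
  by rewrite tr_pid_mx pid_mxK.
by rewrite mul1r prodr_gt0// => i _; rewrite normr_gt0 gt_eqF.
Qed.

Lemma is_SO_unitmx (O : 'M[R]_n) : is_SO O -> O \in unitmx.
Proof. by move=> [_ O1]; rewrite unitmxE O1 unitr1. Qed.

Lemma is_SO_tr (O : 'M[R]_n) : is_SO O -> is_SO O^T.
Proof. by move=> [OO O1]; split; [rewrite trmxK; exact: mulmx1C|rewrite det_tr]. Qed.

Lemma is_SO1 : is_SO (1%:M : 'M[R]_n).
Proof. by split; rewrite ?trmx1 ?mulmx1 ?det1. Qed.

Lemma det_orthogonal (O : 'M[R]_n) : O^T *m O = 1%:M -> \det O = 1 \/ \det O = -1.
Proof.
move/(congr1 determinant); rewrite det_mulmx det_tr det1 -expr2 => /eqP.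
by rewrite sqrf_eq1 => /orP[/eqP|/eqP]; [left|right].
Qed.

(** The identity on matrices of nonpositive determinant makes all values rotations. *)
Definition rotation_part X : 'M[R]_n := if 0 < \det X then gram_schmidt X else 1%:M.

Lemma rotation_partP X : 0 < \det X -> exists S,
  [/\ upper_triangular S, forall i, 0 < S i i & X = rotation_part X *m S].
Proof.
move=> dX; rewrite /rotation_part dX.
have Xu : X \in unitmx by rewrite unitmxE unitfE gt_eqF.
by have [_] := gram_schmidtP (mulVmx Xu).
Qed.

Lemma rotation_part_SO X : is_SO (rotation_part X).
Proof.
rewrite /rotation_part; case: ifPn => [dX|_]; last exact: is_SO1.
have Xu : X \in unitmx by rewrite unitmxE unitfE gt_eqF.
have [QQ [S [Su Sd XE]]] := gram_schmidtP (mulVmx Xu); split=> //.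
have [//|dQ] := det_orthogonal QQ.
move: dX; rewrite XE det_mulmx dQ (det_upper_triangular Su) mulN1r oppr_gt0 ltNge.
by rewrite prodr_ge0// => i _; exact: ltW.
Qed.

Lemma rotation_part_mul (O : 'M[R]_n) X : is_SO O -> 0 < \det X ->
  rotation_part (O *m X) = O *m rotation_part X.
Proof.
move=> [OO O1] dX; rewrite /rotation_part det_mulmx O1 mul1r dX.
exact: gram_schmidt_mul.
Qed.

Lemma measurable_rotation_part : measurable_fun setT rotation_part.
Proof.
apply: measurable_fun_ifT => //; last exact: measurable_gram_schmidt.
by apply: measurable_fun_ltr => //; exact: measurable_det.
Qed.

(** If the orthogonal factor has determinant -1, a sign moves from one of its
    columns to the corresponding row of the triangular factor, whose diagonal is
    then no longer positive. *)
Lemma unitmx_rotation_upper X : X \in unitmx -> exists Q S,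
  [/\ is_SO Q, upper_triangular S, forall i, S i i != 0 & X = Q *m S].
Proof.
move=> Xu; have [QQ [S [Su Sd XE]]] := gram_schmidtP (mulVmx Xu).
set Q := gram_schmidt X in QQ XE; have [dQ|dQ] := det_orthogonal QQ.
  by exists Q, S; split => // i; rewrite gt_eqF.
have [i0 _|n0] := pickP (fun _ : 'I_n => true); last first.
  exists 1%:M, X; split; first exact: is_SO1.
  - by move=> i; have := n0 i.
  - by move=> i; have := n0 i.
  - by rewrite mul1mx.
pose d : 'rV[R]_n := \row_j (if j == i0 then -1 else 1).
pose J := diag_mx d.
have JJ : J *m J = 1%:M.
  rewrite mulmx_diag -diag_const_mx; congr diag_mx; apply/rowP => j.
  by rewrite !mxE; case: ifP => _; rewrite ?mulrNN mulr1.
have dJ : \det J = -1.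
  rewrite det_diag (bigD1 i0)//= mxE eqxx big1 ?mulr1// => j ji.
  by rewrite mxE (negbTE ji).
exists (Q *m J), (J *m S); split.
- split; last by rewrite det_mulmx dQ dJ mulrNN mulr1.
  by rewrite trmx_mul mulmxA -(mulmxA J^T) QQ mulmx1 tr_diag_mx.
- by move=> i j ji; rewrite mul_diag_mx mxE Su// mulr0.
- move=> i; rewrite mul_diag_mx mxE; apply: mulf_neq0; last by rewrite gt_eqF.
  by rewrite mxE; case: ifP => _; rewrite ?oppr_eq0 oner_eq0.
- by rewrite mulmxA -(mulmxA Q) JJ mulmx1.
Qed.

End leading_blocks.

(** * The action of rotations on flags *)
Section adapted_bases.
Context {K : fieldType} {vT : vectType K}.

(** A basis of each term is extended by a basis of a complement in the next. *)
Lemma chain_basis (F : nat -> {vspace vT}) s :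
  (forall j k, (j <= k)%N -> (F j <= F k)%VS) ->
  exists2 X : seq vT, basis_of (F s) X &
    forall j, (j <= s)%N -> <<take (\dim (F j)) X>>%VS = F j.
Proof.
move=> Fmono; elim: s => [|s [X bX XF]].
  exists (vbasis (F 0%N)); first exact: vbasisP.
  by move=> j; rewrite leqn0 => /eqP ->; rewrite take_oversize ?size_tuple// (span_basis (vbasisP _)).
have dX : size X = \dim (F s) by rewrite -(span_basis bX) (eqP (basis_free bX)).
pose D := (F s.+1 :\: F s)%VS.
have FE : F s.+1 = (F s + D)%VS.
  by rewrite addvC addv_diff; apply/esym/addv_idPl/Fmono.
have bXD : basis_of (F s.+1) (X ++ vbasis D).
  rewrite FE; apply: cat_basis bX (vbasisP D).
  by apply/directv_addP; rewrite capvC capv_diff.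
exists (X ++ vbasis D) => // j; rewrite leq_eqVlt => /predU1P[->|js].
  rewrite take_oversize ?(span_basis bXD)//.
  by rewrite -(span_basis bXD) (eqP (basis_free bXD)).
by rewrite takel_cat ?XF// dX; exact/dimvS/Fmono.
Qed.

End adapted_bases.

Section flag_action.
Context {R : realType} {n r : nat} {i : r.-tuple nat} {hi : flag_dims n i}.
Implicit Types (xi : flag R hi) (j : 'I_r).

Lemma flag_dim_le j : (tnth i j <= n)%N.
Proof.
have /andP[_ /all_tnthP/(_ j)/andP[_ /leq_trans]] := hi; apply; exact: leq_pred.
Qed.

Lemma flag_eqP xi xi' : (forall j, xi j = xi' j) -> xi = xi'.
Proof. by move=> e; apply: val_inj; apply/ffunP. Qed.

Lemma flag_dimE xi j : \dim (xi j) = tnth i j.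
Proof. by have /andP[/forallP/(_ j)/eqP] := flagP xi. Qed.

Lemma flag_subv xi (j k : 'I_r) : (j <= k)%N -> (xi j <= xi k)%VS.
Proof. by have /andP[_ /forallP/(_ j)/forallP/(_ k)/implyP] := flagP xi. Qed.

Lemma tnth_flag_dims_mono (j k : 'I_r) : (j <= k)%N -> (tnth i j <= tnth i k)%N.
Proof. by move=> jk; have := dimvS (flag_subv point jk); rewrite !flag_dimE. Qed.

Definition std_flag_fun : {ffun 'I_r -> {vspace 'cV[R]_n}} :=
  [ffun j => mx_image (pid_mx (tnth i j) : 'M[R]_(n, tnth i j)) fullv].

Lemma is_flag_std : is_flag (i := i) std_flag_fun.
Proof.
apply/andP; split.
  apply/forallP => j; rewrite ffunE; apply/eqP.
  exact: (dim_mx_image (pid_mxK (flag_dim_le j))).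
apply/forallP => j; apply/forallP => k; apply/implyP => jk; rewrite !ffunE.
apply/subvP => x /mem_mx_imageP[y ->]; apply/mem_mx_imageP.
by rewrite (pid_mx_nested (tnth_flag_dims_mono jk)) -mulmxA; eexists.
Qed.

Definition std_flag : flag R hi := Flag hi is_flag_std.

Lemma std_flagE j : std_flag j = mx_image (pid_mx (tnth i j) : 'M[R]_(n, tnth i j)) fullv.
Proof. by rewrite [LHS]ffunE. Qed.

(** The action of the invertible matrices extended to all matrices by the identity,
    which avoids carrying proofs of invertibility inside integrands. *)
Definition act (g : 'M[R]_n) xi : flag R hi :=
  match @idP (g \in unitmx) with
  | ReflectT gU => flag_act gU xi
  | ReflectF _ => xi
  end.

Lemma actE g xi j : g \in unitmx -> act g xi j = mx_image g (xi j).
Proof. by move=> gU; rewrite /act; case: {-}_ / idP => // gU'; rewrite [LHS]ffunE. Qed.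

Lemma act_flag_act g (gU : g \in unitmx) : act g = flag_act gU.
Proof. by apply/funext => xi; apply: flag_eqP => j; rewrite actE// [RHS]ffunE. Qed.

Lemma mx_image_comp m p q (A : 'M[R]_(m, p)) (B : 'M[R]_(p, q)) (F : {vspace 'cV[R]_q}) :
  mx_image (A *m B) F = mx_image A (mx_image B F).
Proof.
rewrite /mx_image -limg_comp; congr (_ @: _)%VS.
by apply/lfunP => x; rewrite comp_lfunE !lfunE /= mulmxA.
Qed.

Lemma actM g h xi : g \in unitmx -> h \in unitmx -> act (g *m h) xi = act g (act h xi).
Proof.
move=> gU hU; apply: flag_eqP => j; rewrite !actE ?unitmx_mul ?gU//.
exact: mx_image_comp.
Qed.

Lemma orthoproj_rotate (O : 'M[R]_n) (F : {vspace 'cV[R]_n}) : O^T *m O = 1%:M ->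
  orthoproj (mx_image O F) = O *m orthoproj F *m O^T.
Proof.
move=> OO; have [BB BF] := onbP F.
rewrite (@orthoproj_unique _ _ _ _ (O *m onb F)); first by rewrite trmx_mul !mulmxA.
split; last by rewrite mx_imageM BF.
by rewrite trmx_mul mulmxA -(mulmxA _ O^T) OO mulmx1.
Qed.

Lemma measurable_orthoproj j : measurable_fun setT (fun xi => orthoproj (xi j)).
Proof.
by move=> _ B mB; rewrite setTI; apply: sub_sigma_algebra; exists j, B.
Qed.

(** The sigma-algebra of the flags is generated by the orthogonal projections, and
    a rotation O acts on these by conjugation, P |-> O P O^T. *)
Lemma measurable_act d (Z : measurableType d) (O : Z -> 'M[R]_n) (zeta : Z -> flag R hi) :
  (forall z, is_SO (O z)) -> measurable_fun setT O -> measurable_fun setT zeta ->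
  measurable_fun setT (fun z => act (O z) (zeta z)).
Proof.
move=> OSO mO mz; apply: (@measurability _ _ _ _ setT _ (@flag_cylinder R n r i hi)) => //.
move=> _ [_ [j [B [mB ->]]] <-].
have mp : measurable_fun setT (fun z => O z *m orthoproj (zeta z j) *m (O z)^T).
  apply: measurable_mulmx; last exact: measurable_trmx.
  by apply: measurable_mulmx => //; exact: (measurableT_comp (measurable_orthoproj j)).
rewrite (_ : _ @^-1` _ =
  (fun z => O z *m orthoproj (zeta z j) *m (O z)^T) @^-1` B); first exact: mp.
by apply/seteqP; split => z /=; rewrite actE ?is_SO_unitmx// orthoproj_rotate//; case: (OSO z).
Qed.

Lemma mx_image_unit m k (Y : 'M[R]_(m, k)) (A : 'M[R]_k) : A \in unitmx ->
  mx_image (Y *m A) fullv = mx_image Y fullv.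
Proof.
move=> Au; apply/vspaceP => x; apply/mem_mx_imageP/mem_mx_imageP => -[y ->].
  by exists (A *m y); rewrite mulmxA.
by exists (invmx A *m y); rewrite !mulmxA mulmxK.
Qed.

(** The flag spanned by the columns of g T does not depend on T when T preserves
    the coordinate subspaces. *)
Lemma act_std_flag_stable g T j : g \in unitmx -> T \in unitmx -> stabilizes (tnth i j) T ->
  mx_image (g *m T *m (pid_mx (tnth i j) : 'M[R]_(n, tnth i j))) fullv = act g std_flag j.
Proof.
move=> gU TU sT; rewrite actE// std_flagE -mx_imageM -mulmxA sT mulmxA mx_image_unit//.
exact: leading_block_unit (flag_dim_le j) sT TU.
Qed.

(** The QR decomposition of a basis adapted to the flag: the triangular factor
    preserves the coordinate subspaces, so the rotation alone carries the standard
    flag to the given one. *)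
Lemma flag_transitive xi : exists2 O, is_SO O & xi = act O std_flag.
Proof.
pose F k : {vspace 'cV[R]_n} := oapp xi fullv (insub k : option 'I_r).
have Fmono a b : (a <= b)%N -> (F a <= F b)%VS.
  move=> ab; rewrite /F; case: (insubP _ b) => [b' br bE|_]; last exact: subvf.
  case: insubP => [a' ar aE|]; first by apply: flag_subv; rewrite aE bE.
  by rewrite (leq_ltn_trans ab br).
have [X bX XF] := chain_basis r Fmono.
have Fr : F r = fullv by rewrite /F insubF ?ltnn.
have sX : size X == n.
  rewrite -(eqP (basis_free bX)) (span_basis bX) Fr dimvf dim_matrix mulr1//.
pose Xt := Tuple sX.
pose Z : 'M[R]_n := \matrix_(a, b) (tnth Xt b) a ord0.
have Zmul k (y : 'cV[R]_k) : (k <= n)%N ->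
    Z *m (pid_mx k *m y) = \sum_(b < n) (pid_mx k *m y) b ord0 *: tnth Xt b.
  move=> kn; apply/matrixP => a b; rewrite (ord1 b) mxE summxE.
  by apply: eq_bigr => c _; rewrite !mxE mulrC.
have ZU : Z \in unitmx.
  rewrite -unitmx_tr -row_free_unit; apply: inj_row_free => v /(congr1 trmx).
  rewrite trmx_mul trmxK trmx0 => Zv.
  have /freeP freeX : free Xt by exact: basis_free bX.
  have Xv : \sum_(b < n) v ord0 b *: Xt`_b = 0.
    rewrite -[RHS]Zv; apply/matrixP => a b; rewrite (ord1 b) summxE [RHS]mxE.
    by apply: eq_bigr => c _; rewrite !mxE mulrC (tnth_nth 0).
  by apply/rowP => a; rewrite (freeX _ Xv a) mxE.
have [Q [S [QSO Su Sd ZE]]] := unitmx_rotation_upper ZU.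
exists Q => //; apply: flag_eqP => j.
have SU : S \in unitmx by move: ZU; rewrite ZE unitmx_mul => /andP[].
have jn := flag_dim_le j.
rewrite -(act_std_flag_stable (is_SO_unitmx QSO) SU (upper_triangular_stabilizes jn Su)) -ZE.
apply/eqP; rewrite eq_sym eqEdim flag_dimE.
rewrite (dim_mx_image (Z := (pid_mx (tnth i j) : 'M[R]_(tnth i j, n)) *m invmx Z)); last first.
  by rewrite mulmxA -(mulmxA _ (invmx Z)) mulVmx// mulmx1 pid_mxK.
rewrite leqnn andbT; apply/subvP => x /mem_mx_imageP[y ->].
have Fj : F j = xi j by rewrite /F valK.
have -> : xi j = <<take (tnth i j) X>>%VS.
  by rewrite -Fj -(XF j) ?Fj ?flag_dimE// ltnW.
rewrite -mulmxA Zmul// memv_suml// => b _.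
rewrite mxE; have [bj|jb] := ltnP b (tnth i j).
  apply: memvZ; apply: memv_span; rewrite (tnth_nth 0) /= -(nth_take _ bj).
  by apply: mem_nth; rewrite size_takel// (eqP sX).
rewrite big1 ?scale0r ?mem0v// => c _.
by rewrite mxE ltnNge jb andbF mul0r.
Qed.

End flag_action.

(** * Singular matrices are negligible *)
Section singular_matrices.
Context {R : realType}.

Lemma finite_roots (p : {poly R}) : p != 0 -> exists s : seq R, forall x, root p x -> x \in s.
Proof.
elim: (size p) {-2}p (leqnn (size p)) => [|k IHk] {}p; first by rewrite leqn0 size_poly_eq0 => ->.
move=> pk p0; have [[a /factor_theorem[q pE]]|nroot] := pselect (exists a, root p a); last first.
  by exists [::] => x px; case: nroot; exists x.
have q0 : q != 0 by apply: contra p0 => /eqP q0; rewrite pE q0 mul0r.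
have [|s sq] := IHk q _ q0.
  by move: pk; rewrite pE size_Mmonic ?monicXsubC// size_XsubC addnC.
exists (a :: s) => x; rewrite pE rootM root_XsubC inE => /orP[/sq ->|->//].
exact: orbT.
Qed.

Lemma singular_shift_root n (X : 'M[R]_n) (s : R) :
  \det (X + s%:M) = 0 -> root (char_poly (- X)) s.
Proof.
move=> /eqP/det0P[v v0 vX]; rewrite -eigenvalue_root_char; apply/eigenvalueP; exists v => //.
by rewrite mulmxN; move/eqP: vX; rewrite mulmxDr mul_mx_scalar addr_eq0 => /eqP ->; rewrite opprK.
Qed.

Local Open Scope ereal_scope.

Lemma measurable_bool_indicator d (T : measurableType d) (b : T -> bool) :
  measurable_fun setT b -> measurable_fun setT (fun x => (b x)%:R : R).
Proof.
move=> mb; rewrite (_ : (fun _ => _) = fun x => if b x then 1%R else 0%R); last first.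
  by apply/funext => x; case: (b x).
exact: measurable_fun_ifT.
Qed.

Lemma measurable_EFin_bool d (T : measurableType d) (b : T -> bool) :
  measurable_fun setT b -> measurable_fun setT (fun x => ((b x)%:R : R)%:E).
Proof. by move=> mb; apply/measurable_EFinP; exact: measurable_bool_indicator. Qed.

(** For every X, det (X + s I) vanishes only for finitely many s, so its zeros are
    negligible in s. By invariance under the translations by s I, the measure of
    the singular matrices is the average over s in [0, 1] of the measure of the
    translated sets, which is zero by Tonelli. *)
Lemma singular_null n (nu : nat -> {sigma_finite_measure set 'cV[R]_n -> \bar R}) :
  (forall (a : 'I_n) (s : R), translation_invariant (nu a) (s *: delta_mx a ord0)) ->
  \int[column_product nu n]_X ((\det X == 0%R)%:R : R)%:E = 0.
Proof.
move=> nuinv; set rho := column_product nu n.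
pose z (X : 'M[R]_n) : \bar R := ((\det X == 0%R)%:R : R)%:E.
have mz : measurable_fun setT z.
  by apply: measurable_EFin_bool; apply: measurable_fun_eqr => //; exact: measurable_det.
have z0 X : 0 <= z X by rewrite lee_fin.
pose w (s : measurableTypeR R) : \bar R := (\1_(`[0%R, 1%R]%classic) s)%:E.
have mw : measurable_fun setT w by apply/measurable_EFinP.
have w0 s : 0 <= w s by rewrite lee_fin.
have iw : \int[lebesgue_measure]_s w s = 1.
  by rewrite integral_indic// setIT [LHS]lebesgue_measure_itv/= lte_fin ltr01 oppr0 adde0.
have mzs : measurable_fun setT (fun y : measurableTypeR R * 'M[R]_n => z (y.2 + y.1%:M)%R).
  apply: (measurableT_comp mz); apply: measurable_addmx => //.
  rewrite (_ : (fun _ => _) = fun y : measurableTypeR R * 'M[R]_n => y.1 *: 1%:M)%R.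
    by apply: measurable_scalemx => //; exact: measurable_fst.
  by apply/funext => y; rewrite scalemx1.
transitivity (\int[lebesgue_measure]_s (w s * \int[rho]_X z X)).
  by rewrite ge0_integralZr// ?iw ?mul1e//; exact: integral_ge0.
transitivity (\int[lebesgue_measure]_s \int[rho]_X (w s * z (X + s%:M)%R)).
  apply: eq_integral => s _; rewrite ge0_integralZl//; last first.
    by apply: (measurableT_comp mz); exact: measurable_addmx.
  congr (_ * _); rewrite ge0_integral_column_translate// => a.
  have -> : col a (s%:M : 'M[R]_n) = (s *: delta_mx a ord0)%R.
    by apply/matrixP => b c; rewrite (ord1 c) !mxE eqxx andbT mulr_natr.
  exact: nuinv.
rewrite tonelli_swap; first last.
- by move=> s X; rewrite mule_ge0.
- apply: emeasurable_funM => //; exact: (measurableT_comp mw measurable_fst).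
apply: integral0_eq => X _.
have [s0 rs0] := finite_roots (monic_neq0 (char_poly_monic (- X)%R)).
pose A := [set s : measurableTypeR R | (0 <= s <= 1)%R && (\det (X + s%:M)%R == 0%R)].
have -> : (fun s => w s * z (X + s%:M)%R) = (fun s => (\1_A s : R)%:E).
  apply/funext => s; rewrite /w /z !indicE -EFinM -natrM mulnb; congr ((nat_of_bool _)%:R%:E).
  apply/idP/idP => [/andP[/set_mem/= s01 d0]|/set_mem/= /andP[s01 d0]].
    by apply/mem_set; rewrite /A/= d0 andbT; rewrite in_itv/= in s01.
  by apply/andP; split => //; apply/mem_set; rewrite /= in_itv.
have finA : finite_set A.
  apply: (@sub_finite_set _ _ [set` s0]); last exact: finite_seq.
  by move=> s /= /andP[_ /eqP/singular_shift_root/rs0].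
have cA : countable A by exact: finite_set_countable.
have mA : measurable A by apply: countable_measurable => // x; exact: measurable_set1.
by rewrite integral_indic// setIT; exact: countable_lebesgue_measure0.
Qed.

End singular_matrices.

(** * A rotation invariant weight on matrices *)
Section rotation_weight.
Local Open Scope ereal_scope.
Context {R : realType} {n : nat}.

Lemma ge0_integral_cV_prod k (v : R -> \bar R) :
  measurable_fun setT v -> (forall x, 0 <= v x) ->
  \int[lebesgue_cV k]_x (\prod_(b < k) v (x b ord0)) =
  \prod_(b < k) \int[lebesgue_measure]_x v x.
Proof.
move=> mv v0.
have mvk : measurable_fun setT (fun x : 'cV[R]_k => \prod_(b < k) v (x b ord0)).
  apply: emeasurable_prod => b; apply: (measurableT_comp mv).
  exact: measurable_entry.
rewrite ge0_integral_cV_trmx//; last by move=> x; exact: prode_ge0.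
pose u (b : nat) (x : 'cV[R]_1) := v (x ord0 ord0).
have mu b : measurable_fun setT (u b).
  by apply: (measurableT_comp mv); exact: measurable_entry.
transitivity (\int[matrix_lebesgue 1 k]_X \prod_(b < k) u b (col b X)).
  by apply: eq_integral => X _; apply: eq_bigr => b _; rewrite /u !mxE.
have u0 b x : 0 <= u b x by exact: v0.
rewrite ge0_integral_column_prod//; apply: eq_bigr => b _.
rewrite ge0_integral_cV1//; apply: eq_integral => x _.
by rewrite /u mxE eqxx.
Qed.

Definition cube (c : R) (x : R) : \bar R := ((`|x| <= c)%R%:R : R)%:E.

Lemma measurable_cube c : measurable_fun setT (cube c).
Proof. by apply: measurable_EFin_bool; apply: measurable_fun_ler => //; exact: normr_measurable. Qed.

Lemma cube_ge0 c x : 0 <= cube c x.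
Proof. by rewrite lee_fin. Qed.

Lemma integral_cube c : (0 <= c)%R -> \int[lebesgue_measure]_x cube c x = (c *+ 2)%:E.
Proof.
move=> c0; transitivity (\int[lebesgue_measure]_x ((\1_(`[(- c)%R, c]%classic) x : R)%:E)).
  apply: eq_integral => x _; rewrite /cube indicE; congr ((nat_of_bool _)%:R%:E).
  rewrite ler_norml; apply/idP/idP => [xc|/set_mem/=]; last by rewrite in_itv.
  by apply/mem_set; rewrite /= in_itv.
rewrite integral_indic// setIT [LHS]lebesgue_measure_itv/= lte_fin.
case: ltP => [_|cc]; first by rewrite -EFinB opprK mulr2n.
have -> : c = 0%R by apply/eqP; rewrite eq_le c0 andbT; lra.
by rewrite mul0rn.
Qed.

Definition matrix_cube c (X : 'M[R]_n) : \bar R :=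
  \prod_(a < n) \prod_(b < n) cube c (X b a).

Lemma measurable_matrix_cube c : measurable_fun setT (matrix_cube c).
Proof.
apply: emeasurable_prod => a; apply: emeasurable_prod => b.
by apply: (measurableT_comp (measurable_cube c)); exact: measurable_entry.
Qed.

Lemma matrix_cube_ge0 c X : 0 <= matrix_cube c X.
Proof. by do 2! apply: prode_ge0 => ? _; exact: cube_ge0. Qed.

Lemma integral_matrix_cube c : (0 <= c)%R ->
  \int[matrix_lebesgue n n]_X matrix_cube c X = (((c *+ 2) ^+ n) ^+ n)%:E.
Proof.
move=> c0; pose u (a : nat) (x : 'cV[R]_n) := \prod_(b < n) cube c (x b ord0).
have mu a : measurable_fun setT (u a).
  apply: emeasurable_prod => b; apply: (measurableT_comp (measurable_cube c)).
  exact: measurable_entry.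
transitivity (\int[matrix_lebesgue n n]_X \prod_(a < n) u a (col a X)).
  by apply: eq_integral => X _; apply: eq_bigr => a _; apply: eq_bigr => b _; rewrite mxE.
have u0 a x : 0 <= u a x by apply: prode_ge0 => b _; exact: cube_ge0.
rewrite ge0_integral_column_prod//.
transitivity (\prod_(a < n) ((c *+ 2) ^+ n)%:E); last first.
  by rewrite prodEFin prodr_const card_ord.
apply: eq_bigr => a _; rewrite ge0_integral_cV_prod; last exact: cube_ge0.
- by rewrite integral_cube// prodEFin prodr_const card_ord.
- exact: measurable_cube.
Qed.

Lemma prod_bool (b : 'I_n -> bool) : (\prod_(a < n) (b a)%:R = [forall a, b a]%:R :> R)%R.
Proof.
have [/forallP ba|] := boolP [forall a, b a]; first by rewrite big1// => a _; rewrite ba.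
rewrite negb_forall => /existsP[a /negbTE ba].
by rewrite (bigD1 a)//= ba mul0r.
Qed.

Lemma matrix_cubeE c X :
  matrix_cube c X = (([forall a, forall b, (`|X b a| <= c)%R]%:R : R)%:E).
Proof.
rewrite /matrix_cube -prod_bool -prodEFin; apply: eq_bigr => a _.
by rewrite -prod_bool -prodEFin.
Qed.

(** An indicator function that depends on X only through X^T X and the sign of
    det X, hence is invariant under rotations on the left; the bound on the
    columns makes its integral finite. The bound n is large enough for the support
    to contain the matrices of positive determinant with entries in [-1, 1]. *)
Definition weight (X : 'M[R]_n) : R :=
  ((0 < \det X) && [forall a, (X^T *m X) a a <= n%:R])%R%:R.

Lemma measurable_weight : measurable_fun setT weight.
Proof.
rewrite /weight; under eq_fun do rewrite -mulnb natrM -prod_bool.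
apply: measurable_funM.
  by apply: measurable_bool_indicator; apply: measurable_fun_ltr => //; exact: measurable_det.
apply: measurable_prod => a _; apply: measurable_bool_indicator.
apply: measurable_fun_ler => //; apply: measurable_entry; apply: measurable_mulmx => //.
exact: measurable_trmx.
Qed.

Lemma weight_rotate O X : is_SO O -> weight (O *m X) = weight X.
Proof.
move=> [OO O1]; rewrite /weight det_mulmx O1 mul1r; congr ((_ && _)%:R).
by apply: eq_forallb => a; rewrite trmx_mul mulmxA -(mulmxA X^T) OO mulmx1.
Qed.

Lemma weight_det X : weight X != 0%R -> (0 < \det X)%R.
Proof. by rewrite /weight; case: ltP => //; rewrite eqxx. Qed.

Lemma gram_diag (X : 'M[R]_n) a : ((X^T *m X) a a = \sum_b X b a ^+ 2)%R.
Proof. by rewrite mxE; apply: eq_bigr => b _; rewrite mxE expr2. Qed.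

Lemma weight_le_cube X : (weight X)%:E <= matrix_cube n%:R X.
Proof.
rewrite matrix_cubeE lee_fin /weight ler_nat.
case: (boolP (_ && _)) => // /andP[_ /forallP Xn]; rewrite lt0b.
apply/forallP => a; apply/forallP => b.
have n1 : (1 <= n%:R :> R)%R by rewrite ler1n; case: (n) b => [[]|].
rewrite -ler_sqr ?nnegrE// real_normK ?num_real//.
apply: (@le_trans _ _ n%:R%R); last by rewrite expr2 ler_peMr.
apply: le_trans (Xn a); rewrite gram_diag (bigD1 b)//= lerDl sumr_ge0// => c _.
exact: sqr_ge0.
Qed.

Definition total_weight := \int[matrix_lebesgue n n]_X (weight X)%:E.

Lemma total_weight_lty : total_weight < +oo.
Proof.
have le : total_weight <= \int[matrix_lebesgue n n]_X matrix_cube n%:R X.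
  apply: ge0_le_integral => //.
  - by move=> X _; rewrite lee_fin.
  - by apply/measurable_EFinP; exact: measurable_weight.
  - exact: measurable_matrix_cube.
  - by move=> X _; exact: weight_le_cube.
by apply: le_lt_trans le _; rewrite integral_matrix_cube ?ltry.
Qed.

Lemma cube_le_weight X : ((0 < \det X)%R%:R : R)%:E * matrix_cube 1 X <= (weight X)%:E.
Proof.
rewrite matrix_cubeE -EFinM lee_fin /weight -natrM mulnb ler_nat.
case: (boolP (_ && _)) => // /andP[-> /forallP X1] /=; rewrite lt0b.
apply/forallP => a; rewrite gram_diag -[leRHS]mulr1.
have -> : (n%:R * 1 = \sum_(b < n) 1 :> R)%R.
  by rewrite sumr_const card_ord mulr1.
apply: ler_sum => b _; have /forallP/(_ b) := X1 a.
by rewrite -(real_normK (num_real (X b a))) expr_le1.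
Qed.

(** Changing the sign of the first column exchanges the matrices of positive and of
    negative determinant in the cube. If the total weight were zero, both would
    be negligible there, and so would the whole cube, as singular matrices are. *)
Lemma total_weight_gt0 : (0 < n)%N -> 0 < total_weight.
Proof.
move=> n0; have W_ge0 : 0 <= total_weight by apply: integral_ge0 => X _; rewrite lee_fin.
rewrite lt_neqAle W_ge0 andbT; apply/eqP => /esym W0.
pose lam := @matrix_lebesgue R n n.
pose f X : \bar R := ((0 < \det X)%R%:R : R)%:E * matrix_cube 1 X.
pose f' X : \bar R := ((\det X < 0)%R%:R : R)%:E * matrix_cube 1 X.
pose f0 X : \bar R := ((\det X == 0)%R%:R : R)%:E * matrix_cube 1 X.
have mdet : measurable_fun setT (fun X : 'M[R]_n => \det X) by exact: measurable_det.
have mc := measurable_matrix_cube 1.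
have mf : measurable_fun setT f.
  by apply: emeasurable_funM => //; apply: measurable_EFin_bool; exact: measurable_fun_ltr.
have mf' : measurable_fun setT f'.
  by apply: emeasurable_funM => //; apply: measurable_EFin_bool; exact: measurable_fun_ltr.
have mf0 : measurable_fun setT f0.
  by apply: emeasurable_funM => //; apply: measurable_EFin_bool; exact: measurable_fun_eqr.
have c0 X := matrix_cube_ge0 1 X.
have fge0 X : 0 <= f X by rewrite mule_ge0.
have f'ge0 X : 0 <= f' X by rewrite mule_ge0.
have f0ge0 X : 0 <= f0 X by rewrite mule_ge0.
have If : \int[lam]_X f X = 0.
  apply/eqP; rewrite eq_le integral_ge0// andbT -[leRHS]W0.
  apply: ge0_le_integral => //.
  - by apply/measurable_EFinP; exact: measurable_weight.
  - by move=> X _; exact: cube_le_weight.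
have If' : \int[lam]_X f' X = 0.
  pose d : 'rV[R]_n := \row_j (if (j == 0%N :> nat) then -1 else 1)%R.
  have dJ : \det (diag_mx d) = (-1)%R.
    rewrite det_diag (bigD1 (Ordinal n0))//= mxE eqxx big1 ?mulr1// => j j0.
    by rewrite mxE ifN.
  have J := @right_jacobian_unitmx R n n (diag_mx d) _ f mf fge0.
  rewrite dJ normrN1 expr1n mul1e -/lam If in J; rewrite -[RHS]J; last first.
    by rewrite unitmxE dJ unitrN1.
  apply: eq_integral => X _; rewrite /f' /f det_mulmx dJ mulrN1 oppr_gt0; congr (_ * _).
  apply: eq_bigr => a _; apply: eq_bigr => b _.
  rewrite /cube mul_mx_diag mxE normrM mxE.
  by case: ifP => _; rewrite ?normrN1 ?normr1 mulr1.
have If0 : \int[lam]_X f0 X = 0.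
  apply/eqP; rewrite eq_le integral_ge0// andbT.
  have sing : \int[lam]_X ((\det X == 0%R)%:R : R)%:E = 0.
    by apply: singular_null => a s g; exact: ge0_integral_cV_translate.
  rewrite -[leRHS]sing; apply: ge0_le_integral => //.
    by apply: measurable_EFin_bool; exact: measurable_fun_eqr.
  move=> X _; rewrite /f0 matrix_cubeE -EFinM lee_fin ler_piMr// lern1.
  exact: leq_b1.
have : \int[lam]_X matrix_cube 1 X = 0.
  transitivity (\int[lam]_X (f X + (f' X + f0 X))).
    apply: eq_integral => X _; rewrite /f /f' /f0.
    by case: (ltgtP (\det X) 0%R) => _; rewrite !(mul0e, mul1e, adde0, add0e).
  have mff : measurable_fun setT (fun X => f' X + f0 X) by exact: emeasurable_funD.
  have ff0 X : 0 <= f' X + f0 X by exact: adde_ge0.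
  rewrite ge0_integralD// ge0_integralD//.
  by rewrite If If' If0 !adde0.
by rewrite integral_matrix_cube// => -[] /eqP; rewrite !expf_eq0 n0 /= mulrn_eq0 oner_eq0.
Qed.

End rotation_weight.

(** * Uniqueness of the invariant probability on flags *)
Lemma mule_fin_inj (R : realType) (c x y : \bar R) :
  (0 < c)%E -> (c < +oo)%E -> (c * x = c * y)%E -> x = y.
Proof.
case: c => [c| |]//; rewrite lte_fin => c0 _ /(congr1 (fun z => c^-1%:E * z)%E).
by rewrite !muleA -EFinM mulVf ?gt_eqF// !mul1e.
Qed.

Section rotation_average.
Local Open Scope ereal_scope.
Context {R : realType} {n r : nat} {i : r.-tuple nat} {hi : flag_dims n i}.
Local Notation std := (@std_flag R n r i hi).
Local Notation lam := (@matrix_lebesgue R n n).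
Local Notation V := (@total_weight R n).

(** The average of [phi] over the orbit of the standard flag under the inverse of
    the random rotation [rotation_part X]. The inverse appears because the law of
    the rotation part is invariant on the left, whereas independence of the base
    point ([rotation_average_base]) is invariance on the right. *)
Definition rotation_average (phi : flag R hi -> \bar R) : \bar R :=
  \int[lam]_X ((weight X)%:E * phi (act (rotation_part X)^T std)).

Lemma measurable_weightE : measurable_fun setT (fun X : 'M[R]_n => (weight X)%:E).
Proof. by apply/measurable_EFinP; exact: measurable_weight. Qed.

(** If xi is the image of the standard flag by k, then
    (rotation_part X)^T k = (rotation_part (k^T X))^T, and k^T X has the same law
    as X. *)
Lemma rotation_average_base (phi : flag R hi -> \bar R) xi :
  measurable_fun setT phi -> (forall x, 0 <= phi x) ->
  \int[lam]_X ((weight X)%:E * phi (act (rotation_part X)^T xi)) = rotation_average phi.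
Proof.
move=> mphi phi0; have [k kSO ->] := flag_transitive xi.
pose G X := (weight X)%:E * phi (act (rotation_part X)^T std).
have mG : measurable_fun setT G.
  apply: emeasurable_funM; first exact: measurable_weightE.
  apply: (measurableT_comp mphi); apply: measurable_act => //.
    by move=> X; apply: is_SO_tr; exact: rotation_part_SO.
  by apply: measurable_trmx; exact: measurable_rotation_part.
have G0 X : 0 <= G X by rewrite mule_ge0// lee_fin.
have kt := is_SO_tr kSO.
rewrite /rotation_average -[RHS](ge0_integral_mulmxl kt.2 mG G0).
apply: eq_integral => X _; rewrite /G weight_rotate//.
have [->|/weight_det dX] := eqVneq (weight X) 0%R; first by rewrite !mul0e.
rewrite rotation_part_mul// trmx_mul trmxK actM//; last exact: is_SO_unitmx.
by apply: is_SO_unitmx; apply: is_SO_tr; exact: rotation_part_SO.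
Qed.

(** The invariance hypothesis allows inserting the inverse of [rotation_part X]
    into the integrand for every X; after Tonelli the integral over X no longer
    depends on [zeta z]. The family [zeta] with the weight [w] covers both the
    invariant probability and the flag of a random matrix. *)
Lemma rotation_averageP d (Z : measurableType d) (m : {sigma_finite_measure set Z -> \bar R})
    (w : Z -> \bar R) (zeta : Z -> flag R hi) (phi : flag R hi -> \bar R) :
  measurable_fun setT w -> (forall z, 0 <= w z) -> measurable_fun setT zeta ->
  measurable_fun setT phi -> (forall x, 0 <= phi x) ->
  (forall O : 'M[R]_n, is_SO O ->
    \int[m]_z (w z * phi (act O (zeta z))) = \int[m]_z (w z * phi (zeta z))) ->
  V * \int[m]_z (w z * phi (zeta z)) = \int[m]_z w z * rotation_average phi.
Proof.
move=> mw w0 mz mphi phi0 inv.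
have mjoint : measurable_fun setT (fun y : 'M[R]_n * Z => phi (act (rotation_part y.1)^T (zeta y.2))).
  apply: (measurableT_comp mphi); apply: measurable_act.
  - by move=> y; apply: is_SO_tr; exact: rotation_part_SO.
  - apply: measurable_trmx; apply: (measurableT_comp measurable_rotation_part).
    exact: measurable_fst.
  - by apply: (measurableT_comp mz); exact: measurable_snd.
have mX X : measurable_fun setT (fun z => phi (act (rotation_part X)^T (zeta z))).
  exact: (measurableT_comp mjoint (pair1_measurable X)).
have mz' z : measurable_fun setT (fun X => phi (act (rotation_part X)^T (zeta z))).
  exact: (measurableT_comp mjoint (pair2_measurable z)).
have W0 X : 0 <= (weight X)%:E :> \bar R by rewrite lee_fin.
have I0 : 0 <= \int[m]_z (w z * phi (zeta z)).
  by apply: integral_ge0 => z _; rewrite mule_ge0.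
transitivity (\int[lam]_X ((weight X)%:E * \int[m]_z (w z * phi (zeta z)))).
  by rewrite ge0_integralZr//; exact: measurable_weightE.
transitivity (\int[lam]_X \int[m]_z ((weight X)%:E * (w z * phi (act (rotation_part X)^T (zeta z))))).
  apply: eq_integral => X _; rewrite -(inv (rotation_part X)^T); last first.
    by apply: is_SO_tr; exact: rotation_part_SO.
  rewrite ge0_integralZl//; first exact: emeasurable_funM.
  by move=> z _; rewrite mule_ge0.
rewrite tonelli_swap; first last.
- by move=> X z; rewrite !mule_ge0.
- apply: emeasurable_funM; first exact: (measurableT_comp measurable_weightE measurable_fst).
  by apply: emeasurable_funM => //; exact: (measurableT_comp mw measurable_snd).
transitivity (\int[m]_z (w z * rotation_average phi)); last first.
  rewrite ge0_integralZr//; apply: integral_ge0 => X _; rewrite mule_ge0//.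
apply: eq_integral => z _; rewrite -(rotation_average_base (zeta z))//.
rewrite -ge0_integralZl//.
- by apply: eq_integral => X _; rewrite muleCA.
- apply: emeasurable_funM => //; exact: measurable_weightE.
- by move=> X _; rewrite mule_ge0.
Qed.

(** Both sides are equal to [rotation_average phi]: apply [rotation_averageP] to
    the probability [mu], and to the flags [act (rotation_part X) std], whose law
    is invariant because [rotation_part] is equivariant. *)
Lemma invariant_flag_integral (mu : probability (flag R hi) R) (phi : flag R hi -> \bar R) :
  (0 < n)%N -> SO_invariant mu -> measurable_fun setT phi -> (forall x, 0 <= phi x) ->
  V * \int[mu]_xi phi xi = \int[lam]_X ((weight X)%:E * phi (act (rotation_part X) std)).
Proof.
move=> n0 mu_inv mphi phi0.
have mzeta : measurable_fun setT (fun X : 'M[R]_n => act (rotation_part X) std).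
  by apply: measurable_act => //; [exact: rotation_part_SO|exact: measurable_rotation_part].
have W0 (X : 'M[R]_n) : 0 <= (weight X)%:E :> \bar R by rewrite lee_fin.
pose G X := (weight X)%:E * phi (act (rotation_part X) std).
have mG : measurable_fun setT G.
  by apply: emeasurable_funM; [exact: measurable_weightE|exact: (measurableT_comp mphi mzeta)].
have G0 X : 0 <= G X by rewrite mule_ge0.
have mu_avg : V * \int[mu]_xi phi xi = rotation_average phi.
  have inv1 O : is_SO O -> \int[mu]_xi (cst 1 xi * phi (act O (id xi))) =
      \int[mu]_xi (cst 1 xi * phi (id xi)).
    move=> OSO; transitivity (\int[mu]_xi phi (act O xi)).
      by apply: eq_integral => xi _; rewrite mul1e.
    have mO : measurable_fun setT (fun xi : flag R hi => act O xi) by exact: measurable_act.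
    rewrite -(ge0_integral_image_measure mu mO)//.
    transitivity (\int[mu]_xi phi xi); last by apply: eq_integral => xi _; rewrite mul1e.
    apply: eq_measure_integral => A mA _.
    rewrite -[RHS](mu_inv O (is_SO_unitmx OSO) OSO A mA).
    by rewrite -act_flag_act.
  have := rotation_averageP (measurable_cst _) (fun=> lee01) (@measurable_id _ _ _) mphi phi0 inv1.
  have -> : \int[mu]_xi cst 1 xi = 1.
    by rewrite integral_cst// mul1e [LHS]probability_setT.
  rewrite mul1e => <-; congr (_ * _).
  by apply: eq_integral => xi _; rewrite mul1e.
have lam_avg : V * \int[lam]_X G X = V * rotation_average phi.
  apply: (rotation_averageP measurable_weightE W0 mzeta mphi phi0) => O OSO.
  rewrite -[RHS](ge0_integral_mulmxl OSO.2 mG G0); apply: eq_integral => X _.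
  rewrite /G weight_rotate//.
  have [->|/weight_det dX] := eqVneq (weight X) 0%R; first by rewrite !mul0e.
  by rewrite rotation_part_mul// actM// is_SO_unitmx//; exact: rotation_part_SO.
apply: (mule_fin_inj (total_weight_gt0 n0) total_weight_lty).
by rewrite mu_avg.
Qed.

End rotation_average.

(** * The integral over block triangular matrices *)
Lemma measurable_flip d1 d2 d3 (T1 : measurableType d1) (T2 : measurableType d2)
    (T3 : measurableType d3) (f : T1 -> T2 -> T3) :
  measurable_fun setT (fun z : T1 * T2 => f z.1 z.2) ->
  measurable_fun setT (fun z : T2 * T1 => f z.2 z.1).
Proof.
move=> mf; apply: (measurableT_comp mf (g := fun z : T2 * T1 => (z.2, z.1))).
by apply/measurable_fun_pairP; split; [exact: measurable_snd|exact: measurable_fst].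
Qed.

Section block_support.
Local Open Scope ereal_scope.
Context {R : realType}.

Lemma integral_parabolic_support n (k : nat -> nat) (kn : forall a, (k a <= n)%N) m
    (f g : 'M[R]_(n, m) -> \bar R) :
  measurable_fun setT f -> measurable_fun setT g ->
  (forall T, 0 <= f T) -> (forall T, 0 <= g T) ->
  (forall T : 'M[R]_(n, m),
    (forall (b : 'I_n) (a : 'I_m), (k a <= b)%N -> T b a = 0%R) -> f T = g T) ->
  \int[parabolic_measure kn m]_T f T = \int[parabolic_measure kn m]_T g T.
Proof.
rewrite /parabolic_measure; elim: m k kn f g => [|m IHm] k kn f g mf mg f0 g0 fg.
  by apply: eq_integral => T _; apply: fg => b [].
rewrite (ge0_integral_column_productS _ mf f0) (ge0_integral_column_productS _ mg g0).
set rho := column_product _ m.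
have mI (h : 'M[R]_(n, m.+1) -> \bar R) : measurable_fun setT h -> (forall T, 0 <= h T) ->
    measurable_fun setT (fun x => \int[rho]_Y h (mx_cons (x, Y))).
  move=> mh h0.
  apply: (measurable_parametric_integral _ (f := fun x Y => h (mx_cons (x, Y)))) => //.
  exact: measurable_mx_cons_pair.
rewrite (ge0_integral_coord_measure _ (mI _ mf f0)); last by move=> x; exact: integral_ge0.
rewrite (ge0_integral_coord_measure _ (mI _ mg g0)); last by move=> x; exact: integral_ge0.
apply: eq_integral => t _; apply: (IHm (fun a => k a.+1) (fun a => kn a.+1)) => //.
- exact: measurable_mx_cons_pair.
- exact: measurable_mx_cons_pair.
move=> T HT; apply: fg => b a.
have [a' ->|->] := unliftP ord0 a => kb.
  by have /matrixP/(_ b ord0) := mx_cons_colS (pid_mx (k 0%N) *m t, T) a'; rewrite !mxE => ->; exact: HT.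
have /matrixP/(_ b ord0) := mx_cons_col0 (pid_mx (k 0%N) *m t, T); rewrite [LHS]mxE => ->.
by rewrite mxE big1// => c _; rewrite mxE ltnNge kb andbF mul0r.
Qed.

End block_support.

Section flag_identity.
Local Open Scope ereal_scope.
(* [k a] and [l a] stand for the end and the start of the block of the column a.
   The hypothesis [lk_galois] says that b lies in a block before that of a if and
   only if the block of b ends at or before a; the closure hypotheses say that
   the starts and the ends are unions of whole blocks. *)
Context {R : realType} {n : nat} (k l : nat -> nat).
Hypothesis kn : forall a, (k a <= n)%N.
Hypothesis ln : forall a, (l a <= n)%N.
Hypothesis k_mono : {homo k : a b / (a <= b)%N}.
Hypothesis k_gt : forall a, (a < n)%N -> (a < k a)%N.
Hypothesis lk_galois : forall a b, (a < n)%N -> (b < n)%N -> (b < l a)%N = (k b <= a)%N.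
Hypothesis k_closed : forall a b, (a < n)%N -> (b < k a)%N -> (k b <= k a)%N.
Hypothesis l_closed : forall a b, (a < n)%N -> (b < l a)%N -> (k b <= l a)%N.
Variable u : nat -> 'cV[R]_n -> \bar R.
Hypothesis mu : forall K, measurable_fun setT (u K).
Hypothesis u0 : forall K x, 0 <= u K x.

Local Notation lam := (@matrix_lebesgue R n n).
Local Notation rho := (@parabolic_measure R n k kn n).

Definition section_integral K (X : 'M[R]_n) : \bar R :=
  \int[lebesgue_cV K]_t u K (X *m ((pid_mx K : 'M[R]_(n, K)) *m t)).

(** For [u K = |f|] this is the L1-norm of f on the span of the first [K] columns of
    X, see [L1norm_rotation]. *)
Definition section_norm K (X : 'M[R]_n) : \bar R :=
  (leading_volume K X)%:E * section_integral K X.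

Lemma section_integral_ge0 K X : 0 <= section_integral K X.
Proof. exact: integral_ge0. Qed.

Lemma section_norm_ge0 K X : 0 <= section_norm K X.
Proof. by rewrite mule_ge0 ?section_integral_ge0// lee_fin frame_volume_ge0. Qed.

Lemma measurable_leading_volume K : measurable_fun setT (@leading_volume R n K).
Proof.
by apply: (measurableT_comp (@measurable_frame_volume R n K)); exact: measurable_mulmx.
Qed.

Lemma measurable_section_integral K : measurable_fun setT (section_integral K).
Proof.
apply: (measurable_parametric_integral _
  (f := fun X t => u K (X *m ((pid_mx K : 'M[R]_(n, K)) *m t)))) => //.
apply: (measurableT_comp (mu K)); apply: measurable_mulmx; first exact: measurable_fst.
by apply: measurable_mulmx => //; exact: measurable_snd.
Qed.

Lemma measurable_section_norm K : measurable_fun setT (section_norm K).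
Proof.
apply: emeasurable_funM; last exact: measurable_section_integral.
by apply/measurable_EFinP; exact: measurable_leading_volume.
Qed.

(** The leading block of T acts on the first [K] columns: it multiplies their volume
    by the absolute value of its determinant and, by substitution, divides the
    integral by it. *)
Lemma section_norm_stable K X T : (K <= n)%N -> T \in unitmx -> stabilizes K T ->
  section_norm K (X *m T) = section_norm K X.
Proof.
move=> Kn TU sT; rewrite /section_norm leading_volumeM// EFinM -muleA; congr (_ * _).
have m1 : measurable_fun setT (fun t : 'cV[R]_K => u K (X *m ((pid_mx K : 'M[R]_(n, K)) *m t))).
  by apply: (measurableT_comp (mu K)); do 2 apply: measurable_mulmx => //.
rewrite /section_integral -[RHS](ge0_integral_cV_mulmx (leading_block_unit Kn sT TU) m1)//.
by congr (_ * _); apply: eq_integral => t _; rewrite -(mulmxA X T) (mulmxA T) sT !mulmxA.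
Qed.

Definition column_values (X : 'M[R]_n) : \bar R := \prod_(a < n) u (k a) (col a X).

Lemma column_values_ge0 X : 0 <= column_values X. Proof. exact: prode_ge0. Qed.

Lemma measurable_column_values : measurable_fun setT column_values.
Proof.
apply: emeasurable_prod => a; apply: (measurableT_comp (mu _)); exact: measurable_col.
Qed.

(** The a-th column of X T is X applied to the a-th column of T, which ranges over
    the span of the first [k a] basis vectors. *)
Lemma prod_section_integral_fiber X :
  \prod_(a < n) section_integral (k a) X = \int[rho]_T column_values (X *m T).
Proof.
pose v (a : nat) x := u (k a) (X *m x).
have mv a : measurable_fun setT (v a).
  by apply: (measurableT_comp (mu _)); exact: measurable_mulmx.
have v0 a x : 0 <= v a x by exact: u0.
transitivity (\int[rho]_T \prod_(a < n) v a (col a T)); last first.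
  by apply: eq_integral => T _; apply: eq_bigr => a _; rewrite /v !colE mulmxA.
rewrite ge0_integral_column_prod//; apply: eq_bigr => a _.
by rewrite ge0_integral_coord_measure.
Qed.

(** The inverse written with the adjugate, so that it is visibly measurable. *)
Definition det_inverse (T : 'M[R]_n) : 'M[R]_n := ((\det T)^-1 *: \adj T)%R.

Lemma det_inverseE T : T \in unitmx -> det_inverse T = invmx T.
Proof. by move=> TU; rewrite /invmx TU. Qed.

(** The Jacobian of X |-> X T^-1 and the volumes that this substitution produces. *)
Definition fiber_density (T : 'M[R]_n) : R :=
  ((\det T != 0)%:R * (`|\det T| ^+ n)^-1 * \prod_(a < n) (leading_volume (k a) T)^-1)%R.

Lemma fiber_density_ge0 T : (0 <= fiber_density T)%R.
Proof.
rewrite !mulr_ge0// ?invr_ge0 ?exprn_ge0// prodr_ge0// => a _.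
by rewrite invr_ge0 frame_volume_ge0.
Qed.

Lemma measurable_fiber_density : measurable_fun setT fiber_density.
Proof.
apply: measurable_funM.
  apply: measurable_funM.
    apply: measurable_bool_indicator; apply: measurable_neg.
    by apply: measurable_fun_eqr => //; exact: measurable_det.
  apply: measurable_invr; apply: measurable_funX; apply: (measurableT_comp (@normr_measurable _ _)).
  exact: measurable_det.
by apply: measurable_prod => a _; apply: measurable_invr; exact: measurable_leading_volume.
Qed.

Lemma measurable_det_inverse : measurable_fun setT det_inverse.
Proof.
apply: measurable_scalemx; last exact: measurable_adj.
by apply: measurable_invr; exact: measurable_det.
Qed.


Definition fiber_weight (X : 'M[R]_n) : \bar R :=
  \int[rho]_T (fiber_density T * weight (X *m det_inverse T))%:E.

Lemma measurable_fiber_weight_joint d (Z : measurableType d) (f g : Z -> 'M[R]_n) :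
  measurable_fun setT f -> measurable_fun setT g ->
  measurable_fun setT (fun y => (fiber_density (g y) * weight (f y *m det_inverse (g y)))%:E).
Proof.
move=> mf mg; apply/measurable_EFinP; apply: measurable_funM.
  exact: (measurableT_comp measurable_fiber_density mg).
apply: (measurableT_comp measurable_weight); apply: measurable_mulmx => //.
exact: (measurableT_comp measurable_det_inverse mg).
Qed.

Lemma upper_unitmx (S : 'M[R]_n) : upper_triangular S -> (forall a, S a a != 0%R) ->
  S \in unitmx.
Proof.
by move=> Su S0; rewrite unitmxE unitfE det_upper_triangular// prodf_seq_neq0; apply/allP => a _; rewrite S0.
Qed.

Lemma fiber_density_mul T S : S \in unitmx -> (forall a, stabilizes (k a) S) ->
  (fiber_density (T *m S) = (`|\det S| ^+ n)^-1 * \prod_(a < n) (leading_volume (k a) S)^-1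
     * fiber_density T)%R.
Proof.
move=> SU Sk; rewrite /fiber_density det_mulmx mulf_eq0 negb_or.
have -> : (\det S != 0)%R by move: SU; rewrite unitmxE unitfE.
rewrite andbT normrM exprMn invfM.
have -> : (\prod_(a < n) (leading_volume (k a) (T *m S))^-1 =
  \prod_(a < n) (leading_volume (k a) T)^-1 * \prod_(a < n) (leading_volume (k a) S)^-1)%R.
  rewrite -big_split; apply: eq_bigr => a _.
  by rewrite leading_volumeM// -leading_volume_stable// invfM.
ring.
Qed.

(** Substituting T S for T turns the argument S T^-1 of the weight into T^-1; the
    factors come from the Jacobian and from the multiplicativity of
    [fiber_density]. *)
Lemma fiber_weight_upper Q S : is_SO Q -> upper_triangular S -> (forall a, S a a != 0%R) ->
  fiber_weight (Q *m S) =
  ((\prod_(a < n) `|S a a| ^+ k a) * ((`|\det S| ^+ n)^-1 *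
     \prod_(a < n) (leading_volume (k a) S)^-1))%:E * fiber_weight 1%:M.
Proof.
move=> QSO Su S0; have SU := upper_unitmx Su S0.
pose f T := (fiber_density T * weight (S *m det_inverse T))%:E.
have mf : measurable_fun setT f by exact: measurable_fiber_weight_joint.
have f0 T : 0 <= f T by rewrite lee_fin mulr_ge0 ?fiber_density_ge0.
transitivity (\int[rho]_T f T).
  by apply: eq_integral => T _; rewrite /f -mulmxA weight_rotate.
rewrite -(parabolic_measure_triangular kn k_mono Su S0 mf f0) EFinM -muleA; congr (_ * _).
rewrite /fiber_weight -ge0_integralZl//; last 3 first.
- exact: measurable_fiber_weight_joint.
- by move=> T _; rewrite lee_fin mulr_ge0 ?fiber_density_ge0.
- rewrite lee_fin mulr_ge0 ?invr_ge0 ?exprn_ge0// prodr_ge0// => a _.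
  by rewrite invr_ge0 frame_volume_ge0.
apply: eq_integral => T _; rewrite /f fiber_density_mul//; last first.
  by move=> a; exact: upper_triangular_stabilizes.
rewrite -EFinM; congr EFin; have [T0|T0] := eqVneq (\det T) 0%R.
  by rewrite /fiber_density T0 eqxx !mul0r !(mulr0, mul0r).
have TU : T \in unitmx by rewrite unitmxE unitfE.
rewrite [RHS]mulrA; congr (_ * weight _)%R; rewrite mul1mx !det_inverseE ?unitmx_mul ?TU//.
apply: (can_inj (mulKmx TU)); rewrite mulmxA.
by rewrite (mulmxV TU) mulmxV// unitmx_mul TU.
Qed.

(** S_bb occurs in the volume attached to the start of the block of a exactly when
    [k b <= a], that is for n - k b values of a. This is where the exponents of
    the theorem are used: it makes the powers add up to n. *)
Lemma prod_leading_volume_upper (S : 'M[R]_n) : upper_triangular S ->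
  (\prod_(a < n) leading_volume (l a) S * \prod_(a < n) `|S a a| ^+ k a = `|\det S| ^+ n)%R.
Proof.
move=> Su; rewrite det_upper_triangular// normr_prod -prodrXl.
rewrite (eq_bigr (fun a : 'I_n => \prod_(b < n | (b < l a)%N) `|S b b|)%R) => [|a _]; last first.
  exact: leading_volume_upper.
rewrite (exchange_big_dep xpredT)//= -big_split; apply: eq_bigr => b _ /=.
rewrite (eq_bigl (fun a : 'I_n => (k b <= a)%N)) => [|a]; last exact: lk_galois.
have -> : (\prod_(a < n | (k b <= a)%N) `|S b b| = `|S b b| ^+ (n - k b))%R.
  by rewrite -prodr_const_nat big_geq_mkord.
by rewrite -exprD subnK.
Qed.

(** The diagonal of T is unconstrained since [a < k a], so the translations by
    multiples of the identity preserve the measure and [singular_null] applies. *)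
Lemma parabolic_measure_regular F : measurable_fun setT F -> (forall T, 0 <= F T) ->
  \int[rho]_T F T = \int[rho]_T (((\det T != 0)%R%:R : R)%:E * F T).
Proof.
move=> mF F0; pose z (T : 'M[R]_n) : \bar R := ((\det T == 0%R)%:R : R)%:E.
pose z' (T : 'M[R]_n) : \bar R := ((\det T != 0%R)%:R : R)%:E.
have mdet : measurable_fun setT (fun T : 'M[R]_n => \det T == 0%R).
  by apply: measurable_fun_eqr => //; exact: measurable_det.
have mz : measurable_fun setT z by exact: measurable_EFin_bool.
have mz' : measurable_fun setT z' by apply: measurable_EFin_bool; exact: measurable_neg.
have z0 T : 0 <= z T by rewrite lee_fin.
have z'0 T : 0 <= z' T by rewrite lee_fin.
have zF0 : \int[rho]_T (z T * F T) = 0.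
  apply/eqP; rewrite eq_le integral_ge0 ?andbT => [|T _]; last exact: mule_ge0.
  apply: (@le_trans _ _ (\int[rho]_T (z T * +oo))).
    apply: ge0_le_integral => //.
    - by move=> T _; exact: mule_ge0.
    - exact: emeasurable_funM.
    - by apply: emeasurable_funM => //; exact: measurable_cst.
    - by move=> T _; rewrite lee_wpmul2l// leey.
  rewrite ge0_integralZr// singular_null ?mul0e// => a s.
  have ak : (a < k a)%N by exact: k_gt.
  have -> : (s *: delta_mx a ord0 = pid_mx (k a) *m (s *: delta_mx (Ordinal ak) ord0) :> 'cV[R]_n)%R.
    rewrite -scalemxAr; congr (_ *: _)%R; apply/matrixP => b c.
    rewrite (ord1 c) [RHS]mxE (bigD1 (Ordinal ak))//= big1 ?addr0 => [|d da]; last first.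
      by rewrite [X in (_ * X)%R]mxE (negbTE da) mulr0.
    rewrite !mxE !eqxx mulr1 andbT -val_eqE /=; congr (nat_of_bool _)%:R.
    by case: eqP => [->|//]; rewrite ak.
  exact: coord_measure_translation.
transitivity (\int[rho]_T (z T * F T + z' T * F T)).
  apply: eq_integral => T _; rewrite /z /z'.
  by case: eqP => _; rewrite mul1e mul0e ?adde0 ?add0e.
rewrite ge0_integralD//; [|by move=> T _; exact: mule_ge0|exact: emeasurable_funM|
  by move=> T _; exact: mule_ge0|exact: emeasurable_funM].
by rewrite zF0 add0e.
Qed.

Lemma block_stabilizes K (T : 'M[R]_n) : (K <= n)%N ->
  (forall b, (b < n)%N -> (b < K)%N -> (k b <= K)%N) ->
  (forall b a : 'I_n, (k a <= b)%N -> T b a = 0%R) -> stabilizes K T.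
Proof.
move=> Kn Kk HT; apply: stabilizesP => // b a aK Kb; apply: HT.
exact: leq_trans (Kk a _ aK) Kb.
Qed.

Lemma leading_volume_div K (X T : 'M[R]_n) : (K <= n)%N -> T \in unitmx -> stabilizes K T ->
  (leading_volume K (X *m invmx T) = leading_volume K X * (leading_volume K T)^-1)%R.
Proof.
move=> Kn TU sT; rewrite -[in RHS](mulmxKV TU X).
by rewrite (leading_volumeM _ sT) -leading_volume_stable// mulfK// gt_eqF// leading_volume_unit_gt0.
Qed.

(** Write the norms at the ends of the blocks as volumes times integrals over T,
    exchange the integrals and substitute X T^-1 for X. The norms at the starts
    of the blocks do not change, the values at the columns of X T become values
    at the columns of X, and the integral over T becomes [fiber_weight X]. With
    X = Q S this is an explicit product times a constant, and
    [prod_leading_volume_upper] shows that all volumes cancel. *)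
Lemma section_norm_weight_identity :
  \int[lam]_X ((weight X)%:E *
    (\prod_(a < n) section_norm (l a) X * \prod_(a < n) section_norm (k a) X)) =
  fiber_weight 1%:M *
  \int[lam]_X (((\det X != 0)%R%:R : R)%:E *
    (\prod_(a < n) section_integral (l a) X * column_values X)).
Proof.
pose DK (X : 'M[R]_n) : R := (\prod_(a < n) leading_volume (k a) X)%R.
pose LL X := \prod_(a < n) section_norm (l a) X.
pose M X := LL X * ((DK X)%:E * column_values X).
have DK0 X : (0 <= DK X)%R by apply: prodr_ge0 => a _; exact: frame_volume_ge0.
have LL0 X : 0 <= LL X by apply: prode_ge0 => a _; exact: section_norm_ge0.
have M0 X : 0 <= M X by rewrite !mule_ge0 ?lee_fin// column_values_ge0.
have mDK : measurable_fun setT DK.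
  by apply: measurable_prod => a _; exact: measurable_leading_volume.
have mLL : measurable_fun setT LL.
  by apply: emeasurable_prod => a; exact: measurable_section_norm.
have mM : measurable_fun setT M.
  apply: emeasurable_funM => //; apply: emeasurable_funM; last exact: measurable_column_values.
  exact/measurable_EFinP.
pose Phi X T := (weight X)%:E * (LL X * (DK X)%:E) * column_values (X *m T).
have Phi0 X T : 0 <= Phi X T.
  by rewrite !mule_ge0 ?lee_fin ?column_values_ge0.
have mPhi : measurable_fun setT (fun y : 'M[R]_n * 'M[R]_n => Phi y.1 y.2).
  apply: emeasurable_funM.
    apply: emeasurable_funM.
      exact: (measurableT_comp measurable_weightE measurable_fst).
    apply: emeasurable_funM; first exact: (measurableT_comp mLL measurable_fst).
    apply/measurable_EFinP; exact: (measurableT_comp mDK measurable_fst).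
  apply: (measurableT_comp measurable_column_values); apply: measurable_mulmx.
    exact: measurable_fst.
  exact: measurable_snd.
transitivity (\int[lam]_X \int[rho]_T Phi X T).
  apply: eq_integral => X _; rewrite ge0_integralZl//; last 3 first.
  - apply: (measurableT_comp measurable_column_values); exact: measurable_mulmx.
  - by move=> T _; exact: column_values_ge0.
  - by rewrite !mule_ge0 ?lee_fin.
  rewrite -prod_section_integral_fiber -!muleA; congr (_ * (_ * _)).
  by rewrite /DK -prodEFin -big_split.
rewrite tonelli_swap//.
have mPhi' : measurable_fun setT (fun y : 'M[R]_n * 'M[R]_n => Phi y.2 y.1).
  exact: measurable_flip.
have mIPhi : measurable_fun setT (fun T => \int[lam]_X Phi X T).
  exact: (measurable_parametric_integral lam (f := fun T X => Phi X T) mPhi' (fun _ _ => Phi0 _ _)).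
pose Psi X T := M X * (fiber_density T * weight (X *m det_inverse T))%:E.
have Psi0 X T : 0 <= Psi X T by rewrite mule_ge0// lee_fin mulr_ge0 ?fiber_density_ge0.
have mPsi : measurable_fun setT (fun y : 'M[R]_n * 'M[R]_n => Psi y.1 y.2).
  apply: emeasurable_funM; first exact: (measurableT_comp mM measurable_fst).
  by apply: measurable_fiber_weight_joint; [exact: measurable_fst|exact: measurable_snd].
have mPsi' : measurable_fun setT (fun y : 'M[R]_n * 'M[R]_n => Psi y.2 y.1).
  exact: measurable_flip.
rewrite parabolic_measure_regular//; last by move=> T; exact: integral_ge0.
(* The substitution needs T to be invertible and block triangular, which holds
   almost everywhere. *)
transitivity (\int[rho]_T \int[lam]_X Psi X T).
  apply: integral_parabolic_support.
  - apply: emeasurable_funM => //; apply: measurable_EFin_bool; apply: measurable_neg.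
    by apply: measurable_fun_eqr => //; exact: measurable_det.
  - exact: (measurable_parametric_integral lam (f := fun T X => Psi X T) mPsi' (fun _ _ => Psi0 _ _)).
  - by move=> T; rewrite mule_ge0 ?lee_fin//; exact: integral_ge0.
  - by move=> T; exact: integral_ge0.
  move=> T HT; have [T0|T0] := eqVneq (\det T) 0%R.
    rewrite mul0e integral0_eq// => X _.
    by rewrite /Psi /fiber_density T0 eqxx !mul0r mule0.
  have TU : T \in unitmx by rewrite unitmxE unitfE.
  have T'U : invmx T \in unitmx by rewrite unitmx_inv.
  have mPhiT : measurable_fun setT (Phi^~ T) by exact: (measurableT_comp mPhi (pair2_measurable T)).
  rewrite mul1e -(right_jacobian_unitmx T'U mPhiT)// -ge0_integralZl//; last first.
    exact: (measurable_comp_mulmxr (invmx T) mPhiT).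
  apply: eq_integral => X _; rewrite /Phi /Psi /M mulmxKV//.
  have -> : LL (X *m invmx T) = LL X.
    apply: eq_bigr => a _; rewrite -[in RHS](mulmxKV TU X) section_norm_stable//.
    by apply: block_stabilizes => // b bn; exact: l_closed.
  have -> : DK (X *m invmx T) = (DK X * \prod_(a < n) (leading_volume (k a) T)^-1)%R.
    rewrite -big_split; apply: eq_bigr => a _; rewrite leading_volume_div//.
    by apply: block_stabilizes => // b bn; exact: k_closed.
  rewrite det_inverseE// /fiber_density T0 mul1r det_inv normfV exprVn.
  move: (LL X) (column_values X) (weight _) (DK X) => p q w d.
  move: (\prod_(a < n) _)%R ((_ ^+ n)^-1)%R => e c.
  by rewrite !EFinM [LHS](AC (1*((1*(1*2))*1)) ((3*(4*6))*((1*5)*2))).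
rewrite -(tonelli_swap _ _ mPsi)//.
transitivity (\int[lam]_X (M X * fiber_weight X)).
  apply: eq_integral => X _; rewrite ge0_integralZl//.
  - exact: measurable_fiber_weight_joint.
  - by move=> T _; rewrite lee_fin mulr_ge0 ?fiber_density_ge0.
have fw0 X : 0 <= fiber_weight X.
  by apply: integral_ge0 => T _; rewrite lee_fin mulr_ge0 ?fiber_density_ge0.
have UL0 X : 0 <= \prod_(a < n) section_integral (l a) X.
  by apply: prode_ge0 => a _; exact: section_integral_ge0.
rewrite -ge0_integralZl//; last 2 first.
- apply: emeasurable_funM.
    apply: measurable_EFin_bool; apply: measurable_neg.
    by apply: measurable_fun_eqr => //; exact: measurable_det.
  apply: emeasurable_funM; last exact: measurable_column_values.
  by apply: emeasurable_prod => a; exact: measurable_section_integral.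
- by move=> X _; rewrite !mule_ge0 ?lee_fin ?column_values_ge0.
apply: eq_integral => X _; have [X0|X0] := eqVneq (\det X) 0%R.
  rewrite mul0e mule0 [fiber_weight X]integral0_eq ?mule0// => T _.
  by rewrite /weight det_mulmx X0 mul0r ltxx mulr0.
rewrite mul1e.
have XU : X \in unitmx by rewrite unitmxE unitfE.
have [Q [S [QSO Su S0 XE]]] := unitmx_rotation_upper XU.
have volE K : leading_volume K X = leading_volume K S.
  by rewrite XE /leading_volume -mulmxA frame_volume_isometry//; case: QSO.
have := fiber_weight_upper QSO Su S0; rewrite -XE => ->.
have -> : M X = (\prod_(a < n) leading_volume (l a) S * \prod_(a < n) leading_volume (k a) S)%:E
    * (\prod_(a < n) section_integral (l a) X * column_values X).
  rewrite /M /LL /section_norm big_split /= prodEFin.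
  have -> : DK X = (\prod_(a < n) leading_volume (k a) S)%R.
    by apply: eq_bigr => a _; exact: volE.
  under eq_bigr do rewrite volE.
  by rewrite EFinM muleACA.
rewrite [LHS](AC (2*2) ((1*3)*(4*2)))/= -EFinM.
have SU := upper_unitmx Su S0.
have dS : (`|\det S| ^+ n != 0)%R.
  by rewrite expf_neq0// normr_eq0; move: SU; rewrite unitmxE unitfE.
have dk : (\prod_(a < n) leading_volume (k a) S != 0)%R.
  by rewrite gt_eqF// prodr_gt0// => a _; exact: leading_volume_unit_gt0.
move: dS dk (prod_leading_volume_upper Su); rewrite prodfV.
move: (\prod_(a < n) leading_volume (l a) S)%R (\prod_(a < n) leading_volume (k a) S)%R.
move: (\prod_(a < n) `|S a a| ^+ k a)%R (`|\det S| ^+ n)%R => z t x y t0 y0 xz.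
have -> : (x * y * (z * (t^-1 * y^-1)) = (x * z) * t^-1 * (y * y^-1))%R by ring.
by rewrite xz !mulfV// mulr1 mul1e.
Qed.

End flag_identity.

(** * L1-norms as functions of the flag *)
Section ereal_powers.
Local Open Scope ereal_scope.
Context {R : realType}.

Lemma expe_prod (x : \bar R) m : x ^+ m = \prod_(0 <= j < m) x.
Proof. by rewrite big_const_nat subn0 -Monoid.iteropE. Qed.

Lemma expeD (x : \bar R) p q : x ^+ (p + q) = x ^+ p * x ^+ q.
Proof.
rewrite !expe_prod (@big_cat_nat _ _ _ p)//= ?leq_addr//; congr (_ * _).
by rewrite !big_const_nat addKn subn0.
Qed.

Lemma exp1e m : (1 : \bar R) ^+ m = 1.
Proof. by rewrite expe_prod big1. Qed.

Lemma measurable_expe d (T : measurableType d) (f : T -> \bar R) m :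
  measurable_fun setT f -> measurable_fun setT (fun x => f x ^+ m).
Proof.
by move=> mf; under eq_fun do rewrite expe_prod; apply: emeasurable_prod.
Qed.

End ereal_powers.

Section flag_norms.
Local Open Scope ereal_scope.
Context {R : realType} {n r : nat} {i : r.-tuple nat} {hi : flag_dims n i}.

Definition abs_family (f : 'cV[R]_n -> R) (K : nat) (x : 'cV[R]_n) : \bar R := `|f x|%:E.

Lemma measurable_abs_EFin (f : 'cV[R]_n -> R) : measurable_fun setT f ->
  measurable_fun setT (fun x => `|f x|%:E).
Proof. by move=> mf; apply/measurable_EFinP; exact: measurableT_comp. Qed.

Lemma measurable_onb (F : {vspace 'cV[R]_n}) :
  measurable_fun setT (mulmx (onb F) : 'cV[R]_(\dim F) -> _).
Proof. by rewrite (_ : mulmx _ = fun t => onb F *m t)//; exact: measurable_mulmx. Qed.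

Definition subspace_measure (F : {vspace 'cV[R]_n}) : {measure set 'cV[R]_n -> \bar R} :=
  image_measure (lebesgue_cV (\dim F)) (measurable_onb (F := F)).

Lemma L1norm_onE (F : {vspace 'cV[R]_n}) f :
  L1norm_on F f = \int[subspace_measure F]_(x in [set` F]) `|f x|%:E.
Proof. by []. Qed.

Lemma L1norm_on_ge0 (F : {vspace 'cV[R]_n}) f : 0 <= L1norm_on F f.
Proof. by rewrite L1norm_onE; apply: integral_ge0 => x _; rewrite lee_fin. Qed.

(** X and its rotation part span the same flag, since the triangular factor
    preserves the coordinate subspaces. *)
Lemma L1norm_rotation f (X : 'M[R]_n) (j : 'I_r) : measurable_fun setT f -> (0 < \det X)%R ->
  L1norm_on (act (rotation_part X) (@std_flag R n r i hi) j) f =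
  section_norm (abs_family f) (tnth i j) X.
Proof.
move=> mf dX; have jn := @flag_dim_le n r i hi j.
have QQ := (rotation_part_SO X).1.
have QU := is_SO_unitmx (rotation_part_SO X).
have [S [Su Sd XE]] := rotation_partP dX.
rewrite actE// std_flagE -mx_imageM.
have vQ : leading_volume (tnth i j) (rotation_part X) = 1%R.
  by rewrite /leading_volume frame_volume_isometry// frame_volume_orthonormal// tr_pid_mx pid_mxK.
rewrite L1norm_on_frame//; last by rewrite -/(leading_volume _ _) vQ oner_neq0.
transitivity (section_norm (abs_family f) (tnth i j) (rotation_part X)).
  by congr (_ * _); apply: eq_integral => t _; rewrite /abs_family mulmxA.
rewrite [in RHS]XE section_norm_stable//.
- by move=> K; exact: measurable_abs_EFin.
- by move=> K x; rewrite lee_fin.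
- by apply: upper_unitmx => // a; rewrite gt_eqF.
- exact: upper_triangular_stabilizes.
Qed.

(** For an orthogonal projection p of rank K, some K columns of p form a basis of
    its image. Selecting columns is measurable in p, unlike the choice of an
    orthonormal basis in [L1norm_on]. *)
Definition selected_columns K (p : 'M[R]_n) (s : {ffun 'I_K -> 'I_n}) : 'M[R]_(n, K) :=
  p *m colsub s 1%:M.

Definition selected_norm K (f : 'cV[R]_n -> R) (p : 'M[R]_n) (s : {ffun 'I_K -> 'I_n}) : \bar R :=
  (frame_volume (selected_columns p s))%:E *
  \int[lebesgue_cV K]_t `|f (selected_columns p s *m t)|%:E.

(** A selection of independent columns gives the norm, by [L1norm_on_frame]; any
    other selection has volume zero and gives zero. *)
Lemma L1norm_on_selected K f (F : {vspace 'cV[R]_n}) : \dim F = K -> measurable_fun setT f ->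
  L1norm_on F f = \big[maxe/0]_s @selected_norm K f (orthoproj F) s.
Proof.
move=> dF mf.
have selE (s : {ffun 'I_K -> 'I_n}) : frame_volume (selected_columns (orthoproj F) s) != 0%R ->
    selected_norm f (orthoproj F) s = L1norm_on F f.
  move=> vs; have [Z ZY] := frame_left_inverse vs.
  rewrite /selected_norm -L1norm_on_frame//; congr (L1norm_on _ f).
  apply/eqP; rewrite eqEdim (dim_mx_image ZY) dF leqnn andbT.
  apply/subvP => x /mem_mx_imageP[y ->].
  by rewrite /selected_columns /orthoproj -!mulmxA; exact: orthonormal_basis_mem (onbP F).
have [B [BB BF]] : exists B : 'M[R]_(n, K), orthonormal_basis F B.
  by case: K / dF {selE}; exists (onb F); exact: onbP.
have fullB : row_full B.
  by have := mxrankM_maxr B^T B; rewrite BB mxrank1 col_leq_rank.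
pose s0 : {ffun 'I_K -> 'I_n} := fullrankfun fullB.
have vs0 : frame_volume (selected_columns (orthoproj F) s0) != 0%R.
  rewrite (orthoproj_unique (conj BB BF)) /selected_columns -mulmxA frame_volumeM.
  rewrite frame_volume_orthonormal// mul1r normr_eq0 -unitfE -unitmxE -unitmx_tr.
  rewrite trmx_mul trmxK.
  have -> : (colsub s0 1%:M)^T *m B = rowsub s0 B.
    by rewrite trmx_mxsub trmx1 mul_rowsub_mx mul1mx.
  exact: fullrowsub_unit.
apply/eqP; rewrite eq_le; apply/andP; split.
  by rewrite -(selE s0 vs0); exact: le_bigmax.
apply: bigmax_le => [|s _]; first exact: L1norm_on_ge0.
have [v0|/selE ->//] := eqVneq (frame_volume (selected_columns (orthoproj F) s)) 0%R.
by rewrite /selected_norm v0 mul0e; exact: L1norm_on_ge0.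
Qed.

Lemma measurable_bigmaxe d (T : measurableType d) (I : Type) (s : seq I) (f : I -> T -> \bar R) :
  (forall a, measurable_fun setT (f a)) ->
  measurable_fun setT (fun x => \big[maxe/0]_(a <- s) f a x).
Proof.
move=> mf; elim: s => [|a s IHs].
  by under eq_fun do rewrite big_nil; exact: measurable_cst.
by under eq_fun do rewrite big_cons; exact: measurable_maxe.
Qed.

Lemma measurable_L1norm_flag f (j : 'I_r) : measurable_fun setT f ->
  measurable_fun setT (fun xi : flag R hi => L1norm_on (xi j) f).
Proof.
move=> mf; under eq_fun do rewrite (L1norm_on_selected (flag_dimE _ j) mf).
apply: measurable_bigmaxe => s.
have msel : measurable_fun setT (fun p : 'M[R]_n => selected_columns p s).
  exact: measurable_mulmx.
apply: (measurableT_comp (f := fun p => selected_norm f p s)); last exact: measurable_orthoproj.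
apply: emeasurable_funM.
  by apply/measurable_EFinP; apply: (measurableT_comp (@measurable_frame_volume R n _)).
apply: (measurable_parametric_integral _ (f := fun p t => `|f (selected_columns p s *m t)|%:E)).
  apply: (measurableT_comp (measurable_abs_EFin mf)); apply: measurable_mulmx.
    exact: (measurableT_comp msel measurable_fst).
  exact: measurable_snd.
by move=> p t; rewrite lee_fin.
Qed.

End flag_norms.

(** * Functions that differ on a null set *)
(** For a nonnegative function that is not measurable the integral is the supremum
    of the integrals of the simple functions below it, and a simple function can be
    set to zero on a null set. *)
Section null_modification.
Local Open Scope ereal_scope.
Context d (T : measurableType d) {R : realType} (m : {measure set T -> \bar R}).

Import HBNNSimple.

Lemma integral_le_off_null (N : set T) (f g : T -> \bar R) :
  measurable N -> m N = 0 -> (forall x, 0 <= f x) -> (forall x, 0 <= g x) ->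
  (forall x, ~ N x -> f x <= g x) -> \int[m]_x f x <= \int[m]_x g x.
Proof.
move=> mN N0 f0 g0 fg; rewrite ge0_integralTE// ge0_integralTE//.
apply: ge_ereal_sup => _ [h /= hf <-].
have mNC : measurable (~` N) by exact: measurableC.
pose h' := proj_nnsfun h mNC.
have h'E x : h' x = (h \_ (~` N)) x by rewrite mrestrict.
apply: (@le_trans _ _ (sintegral m h')); last first.
  apply: ereal_sup_ubound; exists h' => // x; rewrite h'E patchE.
  by case: ifPn => [/set_mem Nx|_]; [exact: le_trans (hf x) (fg x Nx)|exact: g0].
rewrite -!integralT_nnsfun le_eqVlt; apply/orP; left; apply/eqP; apply: ge0_ae_eq_integral => //.
- by apply/measurable_EFinP.
- by apply/measurable_EFinP.
- by move=> x _; rewrite lee_fin.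
- by move=> x _; rewrite lee_fin.
exists N; split => // x /= /not_implyP[_ hh']; apply: contrapT => Nx; apply: hh'.
by congr EFin; rewrite [RHS]h'E patchE mem_set.
Qed.

Lemma eq_integral_off_null (N D : set T) (f g : T -> \bar R) :
  measurable N -> m N = 0 -> (forall x, D x -> 0 <= f x) -> (forall x, D x -> 0 <= g x) ->
  (forall x, D x -> ~ N x -> f x = g x) -> \int[m]_(x in D) f x = \int[m]_(x in D) g x.
Proof.
move=> mN N0 f0 g0 fg; rewrite !(integral_mkcond D).
have ge0 (h : T -> \bar R) : (forall x, D x -> 0 <= h x) -> forall x, 0 <= (h \_ D) x.
  by move=> h0 x; rewrite patchE; case: ifPn => // /set_mem /h0.
have e x : ~ N x -> (f \_ D) x = (g \_ D) x.
  by move=> Nx; rewrite !patchE; case: ifPn => // /set_mem Dx; exact: fg.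
apply/eqP; rewrite eq_le; apply/andP; split;
  by apply: (integral_le_off_null mN N0) => [x|x|x /e ->//]; exact: ge0.
Qed.

End null_modification.

Section null_sets_and_flags.
Local Open Scope ereal_scope.
Context {R : realType} {n r : nat} {i : r.-tuple nat} {hi : flag_dims n i}.
Local Notation lam := (@matrix_lebesgue R n n).

Variables (N : set 'cV[R]_n).
Hypotheses (mN : measurable N) (N0 : lebesgue_cV n N = 0).

Lemma measurable_indicator : measurable_fun setT (\1_N : 'cV[R]_n -> R).
Proof. exact: measurable_indic. Qed.

Definition indicatorE (x : 'cV[R]_n) : \bar R := (\1_N x : R)%:E.

Lemma measurable_indicatorE : measurable_fun setT indicatorE.
Proof. by apply/measurable_EFinP; exact: measurable_indicator. Qed.

Lemma indicatorE_ge0 x : 0 <= indicatorE x.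
Proof. by rewrite lee_fin. Qed.

Lemma null_column (a : 'I_n) : \int[lam]_X indicatorE (col a X) = 0.
Proof.
pose v (b : nat) (x : 'cV[R]_n) := if b == a then indicatorE x else 1.
have mv b : measurable_fun setT (v b).
  by rewrite /v; case: eqP => _; [exact: measurable_indicatorE|exact: measurable_cst].
have v0 b x : 0 <= v b x by rewrite /v; case: eqP => _ //; exact: indicatorE_ge0.
transitivity (\int[lam]_X \prod_(b < n) v b (col b X)).
  apply: eq_integral => X _; rewrite (bigD1 a)//= /v eqxx big1 ?mule1// => b ba.
  by rewrite ifN.
rewrite ge0_integral_column_prod// (bigD1 a)//= /v eqxx integral_indic// setIT.
by rewrite [X in X * _]N0 mul0e.
Qed.

(** Complete x to an invertible T with x as one of its columns; then X x is a
    column of X T, which has up to a factor the same law as X. *)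
Lemma null_image (x : 'cV[R]_n) : x != 0%R -> \int[lam]_X indicatorE (X *m x) = 0.
Proof.
move=> x0; have [a xa] : exists a, x a ord0 != 0%R.
  apply/existsP; rewrite -negb_forall; apply: contra x0 => /forallP x0.
  by apply/eqP/matrixP => a b; rewrite (ord1 b) mxE; exact/eqP/x0.
pose T : 'M[R]_n := \matrix_(b, c) if c == a then x b ord0 else (b == c)%:R.
have TU : T \in unitmx.
  rewrite -row_free_unit; apply: inj_row_free => v vT.
  have vb b : b != a -> v ord0 b = 0%R.
    move=> ba; move/rowP/(_ b): vT; rewrite !mxE => <-.
    rewrite (bigD1 b)//= mxE (negbTE ba) eqxx mulr1 big1 ?addr0// => c cb.
    by rewrite mxE (negbTE ba) (negbTE cb) mulr0.
  have va : v ord0 a = 0%R.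
    move/rowP/(_ a): vT; rewrite !mxE (bigD1 a)//= mxE eqxx big1 ?addr0 => [|c ca].
      by move/eqP; rewrite mulf_eq0 (negbTE xa) orbF => /eqP.
    by rewrite vb// mul0r.
  by apply/rowP => b; rewrite mxE; have [->|/vb] := eqVneq b a.
have mcol : measurable_fun setT (fun X : 'M[R]_n => indicatorE (col a X)).
  by apply: (measurableT_comp measurable_indicatorE); exact: measurable_col.
have := @right_jacobian_unitmx R n n T TU _ mcol (fun=> indicatorE_ge0 _).
rewrite null_column => /eqP; rewrite mule_eq0 eqe expf_eq0 normr_eq0.
have /negbTE -> : (\det T != 0)%R by move: TU; rewrite unitmxE unitfE.
rewrite andbF /= => /eqP <-; apply: eq_integral => X _; congr indicatorE.
apply/matrixP => b c; rewrite (ord1 c) !mxE; apply: eq_bigr => e _.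
by rewrite !mxE eqxx.
Qed.

(** The indicator function of the origin as a product over the coordinates, to which
    [ge0_integral_cV_prod] applies. *)
Definition origin_indicator K (t : 'cV[R]_K) : \bar R :=
  \prod_(b < K) ((t b ord0 == 0%R)%:R : R)%:E.

Lemma measurable_eq0 : measurable_fun setT (fun x : R => ((x == 0%R)%:R : R)%:E).
Proof. by apply: measurable_EFin_bool; exact: measurable_fun_eqr. Qed.

Lemma measurable_origin_indicator K : measurable_fun setT (@origin_indicator K).
Proof.
apply: emeasurable_prod => b; apply: (measurableT_comp measurable_eq0).
exact: measurable_entry.
Qed.

Lemma origin_indicator_ge0 K (t : 'cV[R]_K) : 0 <= origin_indicator t.
Proof. by apply: prode_ge0 => b _; rewrite lee_fin. Qed.

Lemma integral_origin_indicator K : (0 < K)%N -> \int[lebesgue_cV K]_t origin_indicator t = 0.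
Proof.
move=> K0; rewrite /origin_indicator.
rewrite (ge0_integral_cV_prod K measurable_eq0) => [|x]; last by rewrite lee_fin.
rewrite (bigD1 (Ordinal K0))//= (_ : integral _ _ _ = 0) ?mul0e//.
transitivity (\int[lebesgue_measure]_x ((\1_[set 0%R : measurableTypeR R] x : R)%:E)).
  apply: eq_integral => x _; rewrite indicE; congr ((nat_of_bool _)%:R%:E).
  by apply/idP/idP => [/eqP ->|/set_mem/= ->]; [exact/mem_set|exact/eqP].
by rewrite integral_indic// setIT [LHS]lebesgue_measure_set1.
Qed.

(** By Tonelli it is enough to integrate over X for fixed t, where [null_image]
    applies unless t = 0, and the origin is negligible as K is positive. *)
Lemma null_section K : (0 < K <= n)%N ->
  \int[lam]_X section_integral (abs_family \1_N) K X = 0.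
Proof.
move=> /andP[K0 Kn].
pose f (X : 'M[R]_n) (t : 'cV[R]_K) := abs_family \1_N K (X *m ((pid_mx K : 'M[R]_(n, K)) *m t)).
have f0 X t : 0 <= f X t by rewrite lee_fin.
have fE X t : f X t = indicatorE (X *m ((pid_mx K : 'M[R]_(n, K)) *m t)).
  by rewrite /f /abs_family ger0_norm.
have mf : measurable_fun setT (fun y : 'M[R]_n * 'cV[R]_K => f y.1 y.2).
  apply: (measurableT_comp (measurable_abs_EFin measurable_indicator)).
  apply: measurable_mulmx; first exact: measurable_fst.
  by apply: measurable_mulmx => //; exact: measurable_snd.
rewrite (tonelli_swap _ _ mf)//.
have pid0 (t : 'cV[R]_K) : t != 0%R -> (pid_mx K : 'M[R]_(n, K)) *m t != 0%R.
  apply: contra => /eqP /(congr1 (mulmx (pid_mx K : 'M[R]_(K, n)))).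
  by rewrite mulmxA pid_mxK// mul1mx mulmx0 => ->.
apply/eqP; rewrite eq_le; apply/andP; split; last first.
  by apply: integral_ge0 => t _; exact: integral_ge0.
have mf' : measurable_fun setT (fun y : 'cV[R]_K * 'M[R]_n => f y.2 y.1) by exact: measurable_flip.
apply: (@le_trans _ _ (\int[lebesgue_cV K]_t (origin_indicator t * +oo))).
  apply: ge0_le_integral => //.
  - by move=> t _; exact: integral_ge0.
  - exact: (measurable_parametric_integral lam (f := fun t X => f X t) mf' (fun _ _ => f0 _ _)).
  - by apply: emeasurable_funM; [exact: measurable_origin_indicator|exact: measurable_cst].
  - move=> t _; have [->|t0] := eqVneq t 0%R.
      by rewrite /origin_indicator big1 ?mul1e ?leey// => b _; rewrite mxE eqxx.
    under eq_integral do rewrite fE.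
    by rewrite null_image ?pid0// mule_ge0// origin_indicator_ge0.
rewrite ge0_integralZr//; last 2 first.
- exact: measurable_origin_indicator.
- by move=> t _; exact: origin_indicator_ge0.
by rewrite integral_origin_indicator// mul0e.
Qed.

(** The integral of the norms of the indicator function is computed with
    [invariant_flag_integral] and [L1norm_rotation], and vanishes by
    [null_section]. *)
Lemma null_almost_every_flag (mu : probability (flag R hi) R) :
  (0 < n)%N -> SO_invariant mu ->
  exists A : set (flag R hi), [/\ measurable A, mu A = 0 &
    forall xi, ~ A xi -> forall j, L1norm_on (xi j) \1_N = 0].
Proof.
move=> n0 mu_inv.
have mL j : measurable_fun setT (fun xi : flag R hi => L1norm_on (xi j) \1_N).
  exact: (measurable_L1norm_flag j measurable_indicator).
have L0 j : \int[mu]_xi L1norm_on (xi j) \1_N = 0.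
  have V0 := @total_weight_gt0 R n n0.
  have := invariant_flag_integral n0 mu_inv (mL j) (fun xi => L1norm_on_ge0 (xi j) \1_N).
  rewrite [RHS](_ : _ = 0).
    by move=> /eqP; rewrite mule_eq0 (gt_eqF V0) => /eqP.
  have SI0 X : 0 <= section_integral (abs_family \1_N) (tnth i j) X.
    by apply: integral_ge0 => t _; rewrite lee_fin.
  have mSI : measurable_fun setT (section_integral (abs_family \1_N) (tnth i j)).
    apply: measurable_section_integral => K; first exact: (measurable_abs_EFin measurable_indicator).
    by move=> x; rewrite lee_fin.
  have mstd : measurable_fun setT (fun X : 'M[R]_n => act (rotation_part X) (@std_flag R n r i hi)).
    by apply: measurable_act => //; [exact: rotation_part_SO|exact: measurable_rotation_part].
  apply/eqP; rewrite eq_le; apply/andP; split; last first.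
    by apply: integral_ge0 => X _; rewrite mule_ge0 ?lee_fin// L1norm_on_ge0.
  apply: (@le_trans _ _ (\int[lam]_X (section_integral (abs_family \1_N) (tnth i j) X * +oo))).
    apply: ge0_le_integral => //.
    - by move=> X _; rewrite mule_ge0 ?lee_fin// L1norm_on_ge0.
    - apply: emeasurable_funM; first exact: measurable_weightE.
      exact: (measurableT_comp (mL j) mstd).
    - by apply: emeasurable_funM => //; exact: measurable_cst.
    - move=> X _; have [->|/weight_det dX] := eqVneq (weight X) 0%R.
        by rewrite mul0e mule_ge0.
      rewrite (L1norm_rotation j measurable_indicator dX) /section_norm.
      have [->|SIX] := eqVneq (section_integral (abs_family \1_N) (tnth i j) X) 0.
        by rewrite !mule0 mul0e.
      by rewrite gt0_muley ?leey// lt_neqAle eq_sym SIX SI0.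
  rewrite ge0_integralZr// null_section ?mul0e// (@flag_dim_le n r i hi j) andbT.
  by have /andP[_ /all_tnthP/(_ j)/andP[]] := hi.
pose S (xi : flag R hi) : \bar R := \sum_(j < r) L1norm_on (xi j) \1_N.
have mS : measurable_fun setT S by apply: emeasurable_sum => j; exact: mL.
have S0 xi : 0 <= S xi by apply: sume_ge0 => j _; exact: L1norm_on_ge0.
have IS : \int[mu]_xi `|S xi| = 0.
  under eq_integral do rewrite gee0_abs//.
  rewrite ge0_integral_sum//; last by move=> j xi _; exact: L1norm_on_ge0.
  by rewrite big1.
have [A [mA A0 SA]] := (ae_eq_integral_abs mu measurableT mS).1 IS.
exists A; split => // xi nA j.
have : S xi = 0.
  by apply: contrapT => Sxi; apply: nA; apply: SA => /= /(_ I).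
move=> /eqP; rewrite /S (bigD1 j)//= padde_eq0 ?L1norm_on_ge0//.
  by move=> /andP[/eqP].
by apply: sume_ge0 => k _; exact: L1norm_on_ge0.
Qed.

Lemma L1norm_on_off_null (F : {vspace 'cV[R]_n}) (f g : 'cV[R]_n -> R) :
  (forall x, ~ N x -> f x = g x) -> L1norm_on F \1_N = 0 -> L1norm_on F f = L1norm_on F g.
Proof.
move=> fg; rewrite !L1norm_onE => NF.
have mF : measurable [set` F] by exact: measurable_subspace.
have mNF : measurable ([set` F] `&` N) by exact: measurableI.
have NF0 : subspace_measure F ([set` F] `&` N) = 0.
  rewrite -NF setIC -integral_indic//; apply: eq_integral => x _.
  by rewrite ger0_norm.
apply: (eq_integral_off_null mNF NF0) => // x Fx Nx.
by rewrite fg// => Nx'; apply: Nx.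
Qed.

End null_sets_and_flags.

Section almost_everywhere.
Local Open Scope ereal_scope.
Context {R : realType} {n r : nat} {i : r.-tuple nat} {hi : flag_dims n i}.

Lemma flag_integral_ae (mu : probability (flag R hi) R) (f g : 'cV[R]_n -> R) :
  (0 < n)%N -> SO_invariant mu -> {ae lebesgue_cV n, forall x, f x = g x} ->
  flag_integral mu f = flag_integral mu g.
Proof.
move=> n0 mu_inv [N [mN N0 fgN]].
have [A [mA A0 AN]] := null_almost_every_flag mN N0 n0 mu_inv.
have ge0 h xi : 0 <= \prod_(j < r) L1norm_on (xi j) h ^+ (flag_index j.+2 - flag_index j).
  by apply: prode_ge0 => j _; rewrite expe_ge0// L1norm_on_ge0.
apply: (eq_integral_off_null mA A0) => // xi _ nA.
apply: eq_bigr => j _; congr (_ ^+ _); apply: (L1norm_on_off_null mN).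
  by move=> x Nx; apply: contrapT => fg; apply: Nx; exact: fgN.
exact: AN.
Qed.

End almost_everywhere.

(** * Blocks of columns and the exponents *)
Section blocks.
Context {n r : nat} {i : r.-tuple nat}.
Hypothesis hi : flag_dims n i.

Local Notation idx := (@flag_index n r i).

(** The blocks are numbered from 0; the block of the column a comes after the i_j
    with i_j <= a. *)
Definition block_number (a : nat) : nat := count (fun x => (x <= a)%N) i.

Definition block_start (a : nat) : nat := idx (block_number a).

Definition block_end (a : nat) : nat := idx (block_number a).+1.

Lemma block_number_le a : (block_number a <= r)%N.
Proof. by rewrite /block_number -{2}(size_tuple i) count_size. Qed.

Lemma block_number_mono : {homo block_number : a b / (a <= b)%N}.
Proof. by move=> a b ab; apply: sub_count => x /= xa; exact: leq_trans ab. Qed.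

Lemma flag_index0 : idx 0 = 0%N. Proof. by []. Qed.

Lemma flag_index_last : idx r.+1 = n.
Proof. by rewrite /flag_index nth_default//= size_tuple. Qed.

Lemma flag_index_tnth (j : 'I_r) : idx j.+1 = tnth i j.
Proof. by rewrite /flag_index /= (tnth_nth n). Qed.

Lemma flag_index_le_n j : (idx j <= n)%N.
Proof.
case: j => [|j]; first by [].
have [jr|rj] := ltnP j r; last by rewrite /flag_index nth_default//= size_tuple.
rewrite -[j]/(val (Ordinal jr)) flag_index_tnth.
have /andP[_ /all_tnthP/(_ (Ordinal jr))/andP[_ /leq_trans]] := hi.
by apply; exact: leq_pred.
Qed.

Lemma flag_index_mono : {homo idx : j k / (j <= k)%N}.
Proof.
apply: homo_leq => // [j k l|j]; first exact: leq_trans.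
case: j => [|j]; first by [].
have [jr|rj] := ltnP j.+1 r; last first.
  by rewrite [leqRHS]/flag_index [X in (_ <= X)%N]nth_default ?flag_index_le_n//= size_tuple.
have /andP[si _] := hi.
rewrite /flag_index /=; apply: ltnW.
by have /(sortedP n)/(_ j) := si; rewrite size_tuple => /(_ jr).
Qed.

(** [block_number] is right adjoint to [flag_index]; all the properties of blocks
    used above follow from this. *)
Lemma flag_index_leE a j : (a < n)%N -> (j <= r.+1)%N ->
  (idx j <= a)%N = (j <= block_number a)%N.
Proof.
move=> an; rewrite leq_eqVlt => /predU1P[->|].
  rewrite flag_index_last leqNgt an; apply/esym/negbTE.
  by rewrite -ltnNge ltnS block_number_le.
case: j => [|j] jr; first by [].
have /andP[si _] := hi.
have si' : sorted leq i by apply: sub_sorted si => x y; exact: ltnW.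
have ri : (j < size i)%N by rewrite size_tuple.
have nth_mono := sorted_leq_nth leq_trans leqnn n si'.
rewrite /flag_index /= /block_number; apply/idP/idP => [ija|].
  rewrite -[in leqRHS](cat_take_drop j.+1 i) count_cat.
  apply: (@leq_trans (count (fun x => (x <= a)%N) (take j.+1 i))); last exact: leq_addr.
  suff : all (fun x => (x <= a)%N) (take j.+1 i).
    by rewrite all_count => /eqP ->; rewrite size_takel.
  apply/(all_nthP n) => k; rewrite size_takel// => kj; rewrite nth_take//.
  apply: leq_trans ija; apply: nth_mono; rewrite ?inE//.
  exact: leq_ltn_trans ri.
apply: contraTT; rewrite -!ltnNge !ltnS => aij.
rewrite -[in leqLHS](cat_take_drop j i) count_cat.
have -> : count (fun x => (x <= a)%N) (drop j i) = 0%N.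
  apply/eqP; rewrite -leqn0 leqNgt -has_count; apply/hasPn => x /(nthP n)[k].
  rewrite size_drop ltn_subRL => kr <-; rewrite nth_drop -ltnNge.
  apply: leq_trans aij _; apply: nth_mono; rewrite ?inE ?leq_addr//.
by rewrite addn0 (leq_trans (count_size _ _))// size_takel// ltnW.
Qed.

Lemma block_end_le a : (block_end a <= n)%N. Proof. exact: flag_index_le_n. Qed.

Lemma block_start_le a : (block_start a <= n)%N. Proof. exact: flag_index_le_n. Qed.

Lemma block_end_mono : {homo block_end : a b / (a <= b)%N}.
Proof. by move=> a b ab; apply: flag_index_mono; rewrite ltnS; exact: block_number_mono. Qed.

Lemma block_end_gt a : (a < n)%N -> (a < block_end a)%N.
Proof. by move=> an; rewrite ltnNge flag_index_leE ?ltnS ?block_number_le// ltnn. Qed.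

Lemma block_galois a b : (a < n)%N -> (b < n)%N -> (b < block_start a)%N = (block_end b <= a)%N.
Proof.
move=> an bn; rewrite ltnNge !flag_index_leE ?ltnS ?block_number_le//.
  by rewrite -ltnNge.
by apply: leqW; exact: block_number_le.
Qed.

Lemma block_end_closed a b : (a < n)%N -> (b < block_end a)%N -> (block_end b <= block_end a)%N.
Proof.
move=> an ba; have bn := leq_trans ba (block_end_le a).
apply: flag_index_mono; move: ba; rewrite ltnNge flag_index_leE ?ltnS ?block_number_le//.
by rewrite -ltnNge ltnS.
Qed.

Lemma block_start_closed a b : (a < n)%N -> (b < block_start a)%N -> (block_end b <= block_start a)%N.
Proof.
move=> an ba; have bn := leq_trans ba (block_start_le a).
apply: flag_index_mono; move: ba; rewrite ltnNge flag_index_leE -?ltnNge//.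
by apply: leqW; exact: block_number_le.
Qed.

Local Open Scope ereal_scope.

Lemma prod_blocks (R : realType) (h : nat -> \bar R) :
  \prod_(a < n) h (block_number a) = \prod_(j < r.+1) h j ^+ (idx j.+1 - idx j).
Proof.
suff e s : (s <= r.+1)%N ->
    \prod_(0 <= a < idx s) h (block_number a) = \prod_(0 <= j < s) h j ^+ (idx j.+1 - idx j).
  by have := e r.+1 (leqnn _); rewrite flag_index_last !big_mkord.
elim: s => [|s IHs] sr; first by rewrite !big_geq.
rewrite big_nat_recr//= -IHs ?(ltnW sr)//.
rewrite (@big_cat_nat _ _ _ (idx s))//=; last exact: flag_index_mono.
congr (_ * _); rewrite -[RHS]/(h s ^+ _).
rewrite (eq_big_nat _ _ (F2 := fun=> h s)).
  by rewrite big_const_nat -Monoid.iteropE.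
move=> a /andP[sa as1]; congr h; have an := leq_trans as1 (flag_index_le_n _).
apply/eqP; rewrite eqn_leq -(flag_index_leE an) ?(ltnW sr)// sa andbT.
by move: as1; rewrite ltnNge flag_index_leE// -ltnNge ltnS.
Qed.

(** i_j is the start of one block and the end of another, of total length
    i_(j+1) - i_(j-1). *)
Lemma prod_flag_exponents (R : realType) (h : nat -> \bar R) :
  h 0%N = 1 -> h n = 1 ->
  \prod_(a < n) h (block_start a) * \prod_(a < n) h (block_end a) =
  \prod_(j < r) h (idx j.+1) ^+ (idx j.+2 - idx j).
Proof.
move=> h0 hn; rewrite (prod_blocks (h \o idx)) (prod_blocks (fun j => h (idx j.+1))).
rewrite big_ord_recl [X in _ * X]big_ord_recr /= flag_index_last hn flag_index0 h0 !exp1e.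
rewrite mul1e mule1 -big_split; apply: eq_bigr => j _ /=; rewrite -expeD; congr (_ ^+ _).
rewrite addnBA ?flag_index_mono// subnK// flag_index_mono//.
Qed.

End blocks.

(** * Linear form of the flag integral and invariance *)
Section invariance.
Local Open Scope ereal_scope.
Context {R : realType} {n r : nat} {i : r.-tuple nat} {hi : flag_dims n i}.
Hypothesis n0 : (0 < n)%N.
Variable mu : probability (flag R hi) R.
Hypothesis mu_inv : SO_invariant mu.
Local Notation lam := (@matrix_lebesgue R n n).
Local Notation V := (@total_weight R n).
Local Notation bstart := (@block_start n r i).
Local Notation bend := (@block_end n r i).

(** The values at 0 and n make the norms attached to the start of the first block
    and to the end of the last one equal to 1. *)
Definition block_family (f : 'cV[R]_n -> R) (h : 'cV[R]_n -> \bar R) (K : nat)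
    (x : 'cV[R]_n) : \bar R :=
  if K == 0%N then 1 else if K == n then h x else `|f x|%:E.

Definition linear_integral (f : 'cV[R]_n -> R) (h : 'cV[R]_n -> \bar R) : \bar R :=
  \int[lam]_X (((\det X != 0)%R%:R : R)%:E *
    (\prod_(a < n) section_integral (block_family f h) (bstart a) X *
     column_values bend (block_family f h) X)).

Definition linear_constant : \bar R :=
  fiber_weight (block_end_le hi) 1%:M.

Lemma measurable_block_family f h K : measurable_fun setT f -> measurable_fun setT h ->
  measurable_fun setT (block_family f h K).
Proof.
move=> mf mh; rewrite /block_family; case: (K == 0%N); first exact: measurable_cst.
by case: (K == n) => //; exact: measurable_abs_EFin.
Qed.

Lemma block_family_ge0 f h K x : (forall x, 0 <= h x) -> 0 <= block_family f h K x.
Proof. by move=> h0; rewrite /block_family; do 2 case: ifP => // _; rewrite lee_fin. Qed.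

Lemma section_norm0 f h X : section_norm (block_family f h) 0 X = 1.
Proof.
rewrite /section_norm (_ : leading_volume 0 X = 1%R) ?mul1e; last first.
  by rewrite -[LHS]/(Num.sqrt (\det (_ : 'M[R]_0))) det_mx00 sqrtr1.
transitivity (\int[lebesgue_cV 0]_t cst (1 : \bar R) (t : 'cV[R]_0)).
  by apply: eq_integral => t _.
by rewrite integral_cst// mul1e [LHS]diracT.
Qed.

Lemma section_norm_full f h X : measurable_fun setT h -> (forall x, 0 <= h x) ->
  X \in unitmx -> section_norm (block_family f h) n X = \int[lebesgue_cV n]_x h x.
Proof.
move=> mh h0 XU; rewrite /section_norm /leading_volume pid_mx_1 mulmx1.
have -> : frame_volume X = `|\det X|%R.
  rewrite -[X in frame_volume X]mul1mx frame_volumeM frame_volume_orthonormal ?mul1r//.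
  by rewrite trmx1 mulmx1.
rewrite -[RHS](ge0_integral_cV_mulmx XU mh h0); congr (_ * _).
apply: eq_integral => t _; rewrite pid_mx_1 mul1mx /block_family eqxx.
by rewrite (gtn_eqF n0).
Qed.

(** The density [h] is arbitrary and the constant does not depend on it: the
    substitution in [linear_integral_act] changes [h]. *)
Lemma flag_integral_linear f h : measurable_fun setT f -> measurable_fun setT h ->
  (forall x, 0 <= h x) -> \int[lebesgue_cV n]_x h x = 1 ->
  V * flag_integral mu f = linear_constant * linear_integral f h.
Proof.
move=> mf mh h0 h1.
pose phi (xi : flag R hi) := \prod_(j < r) L1norm_on (xi j) f ^+ (@flag_index n r i j.+2 - @flag_index n r i j).
have phi0 xi : 0 <= phi xi.
  by apply: prode_ge0 => j _; rewrite expe_ge0// L1norm_on_ge0.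
have mphi : measurable_fun setT phi.
  apply: emeasurable_prod => j; apply: measurable_expe; exact: measurable_L1norm_flag.
rewrite -[flag_integral mu f]/(\int[mu]_xi phi xi) (invariant_flag_integral n0 mu_inv mphi phi0).
have mB K : measurable_fun setT (block_family f h K) by exact: measurable_block_family.
have B0 K x : 0 <= block_family f h K x by exact: block_family_ge0.
rewrite /linear_integral /linear_constant.
rewrite -(section_norm_weight_identity (block_end_le hi) (block_start_le hi) (block_end_mono hi)
  (block_end_gt hi) (block_galois hi) (block_end_closed hi) (block_start_closed hi) mB B0).
apply: eq_integral => X _.
have [->|/weight_det dX] := eqVneq (weight X) 0%R; first by rewrite !mul0e.
have XU : X \in unitmx by rewrite unitmxE unitfE gt_eqF.
rewrite (prod_flag_exponents hi (h := fun K => section_norm (block_family f h) K X)).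
- congr (_ * _); apply: eq_bigr => j _; congr (_ ^+ _).
  rewrite (L1norm_rotation j mf dX) flag_index_tnth /section_norm; congr (_ * _).
  have /andP[_ /all_tnthP/(_ j)/andP[ij1 ijn]] := hi.
  apply: eq_integral => t _; rewrite /abs_family /block_family (gtn_eqF ij1) ltn_eqF//.
  by apply: leq_ltn_trans ijn _; rewrite ltn_predL.
- exact: section_norm0.
- by rewrite section_norm_full.
Qed.

Lemma linear_integral_act f h g : measurable_fun setT f -> measurable_fun setT h ->
  (forall x, 0 <= h x) -> \det g = 1%R ->
  linear_integral (mx_act g f) h = linear_integral f (fun x => h (g *m x)).
Proof.
move=> mf mh h0 g1; have gU : g \in unitmx by rewrite unitmxE g1 unitr1.
have famE K x : block_family (mx_act g f) h K x =
    block_family f (fun x => h (g *m x)) K (invmx g *m x).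
  by rewrite /block_family /mx_act mulKVmx.
set u := block_family f (fun x => h (g *m x)) in famE *.
have mh' : measurable_fun setT (fun x => h (g *m x)).
  by apply: (measurableT_comp mh); exact: measurable_mulmx.
have mu' K : measurable_fun setT (u K) by exact: measurable_block_family.
have u0 K x : 0 <= u K x by apply: block_family_ge0 => y; exact: h0.
pose G (X : 'M[R]_n) := (((\det X != 0)%R%:R : R)%:E *
    (\prod_(a < n) section_integral u (bstart a) X * column_values bend u X)).
have mG : measurable_fun setT G.
  apply: emeasurable_funM.
    apply: measurable_EFin_bool; apply: measurable_neg.
    by apply: measurable_fun_eqr => //; exact: measurable_det.
  apply: emeasurable_funM; last exact: measurable_column_values.
  by apply: emeasurable_prod => a; exact: measurable_section_integral.
have G0 X : 0 <= G X.
  rewrite !mule_ge0 ?lee_fin ?column_values_ge0//.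
  by apply: prode_ge0 => a _; exact: section_integral_ge0.
have g'1 : \det (invmx g) = 1%R by rewrite det_inv g1 invr1.
rewrite -[RHS](ge0_integral_mulmxl g'1 mG G0); apply: eq_integral => X _.
rewrite /G det_mulmx g'1 mul1r.
have sectionE K : section_integral (block_family (mx_act g f) h) K X =
    section_integral u K (invmx g *m X).
  by apply: eq_integral => t _; rewrite famE -[in RHS]mulmxA.
have columnE : column_values bend (block_family (mx_act g f) h) X =
    column_values bend u (invmx g *m X).
  by apply: eq_bigr => a _; rewrite famE !colE mulmxA.
by rewrite columnE; under eq_bigr do rewrite sectionE.
Qed.

Definition unit_cube_indicator (x : 'cV[R]_n) : \bar R := \prod_(b < n) cube (2^-1) (x b ord0).

Lemma measurable_unit_cube_indicator : measurable_fun setT unit_cube_indicator.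
Proof.
apply: emeasurable_prod => b; apply: (measurableT_comp (measurable_cube _)).
exact: measurable_entry.
Qed.

Lemma unit_cube_indicator_ge0 x : 0 <= unit_cube_indicator x.
Proof. by apply: prode_ge0 => b _; exact: cube_ge0. Qed.

Lemma integral_unit_cube_indicator : \int[lebesgue_cV n]_x unit_cube_indicator x = 1.
Proof.
rewrite ge0_integral_cV_prod; [|exact: measurable_cube|exact: cube_ge0].
apply: big1 => b _; rewrite integral_cube ?invr_ge0//.
by congr EFin; lra.
Qed.

(** Use the density h for the function transformed by g, and h o g for f. *)
Lemma flag_integral_borel_act f g : measurable_fun setT f -> \det g = 1%R ->
  flag_integral mu (mx_act g f) = flag_integral mu f.
Proof.
move=> mf g1; have gU : g \in unitmx by rewrite unitmxE g1 unitr1.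
pose h := unit_cube_indicator.
have mh := measurable_unit_cube_indicator.
have mgf : measurable_fun setT (mx_act g f).
  by apply: (measurableT_comp mf); exact: measurable_mulmx.
have mhg : measurable_fun setT (fun x => h (g *m x)).
  by apply: (measurableT_comp mh); exact: measurable_mulmx.
have hg1 : \int[lebesgue_cV n]_x h (g *m x) = 1.
  rewrite -integral_unit_cube_indicator -(ge0_integral_cV_mulmx gU mh unit_cube_indicator_ge0).
  by rewrite g1 normr1 mul1e.
have h0 := unit_cube_indicator_ge0.
have gf_lin := flag_integral_linear mgf mh h0 integral_unit_cube_indicator.
have f_lin := flag_integral_linear mf mhg (fun x => h0 (g *m x)) hg1.
apply: (mule_fin_inj (total_weight_gt0 n0) total_weight_lty).
apply: (etrans gf_lin); apply: (etrans _ (esym f_lin)).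
exact/congr1/linear_integral_act.
Qed.

Lemma mx_act_ae (f f0 : 'cV[R]_n -> R) (g : 'M[R]_n) : \det g = 1%R -> {ae lebesgue_cV n, forall x, f x = f0 x} ->
  {ae lebesgue_cV n, forall x, mx_act g f x = mx_act g f0 x}.
Proof.
move=> g1 [N [mN N0 fN]].
have g'U : invmx g \in unitmx by rewrite unitmx_inv unitmxE g1 unitr1.
have mg : measurable_fun setT (fun x : 'cV[R]_n => invmx g *m x) by exact: measurable_mulmx.
have mN' : measurable ((fun x : 'cV[R]_n => invmx g *m x) @^-1` N).
  by rewrite -[X in measurable X]setTI; exact: mg.
exists ((fun x => invmx g *m x) @^-1` N); split => //.
  have := ge0_integral_cV_mulmx g'U (measurable_indicatorE mN) (@indicatorE_ge0 _ _ N).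
  rewrite det_inv g1 invr1 normr1 mul1e [RHS]integral_indic// setIT [RHS]N0 => <-.
  have := integral_indic (lebesgue_cV n) measurableT mN'; rewrite setIT => <-.
  by apply: eq_integral => x _; rewrite /indicatorE !indicE.
by move=> x fx; exact: (fN (invmx g *m x) fx).
Qed.

End invariance.

Theorem theorem5p1 (R : realType) (n r : nat) (i : r.-tuple nat)
  (hn : (2 <= n)%N) (hr : (1 <= r <= n.-1)%N) (hi : flag_dims n i)
  (mu : probability (flag R hi) R) (hmu : SO_invariant mu)
  (f : 'cV[R]_n -> R)
  (fbounded : exists M : R, forall x, `|f x| <= M)
  (fint : lebesgue_integrable f)
  (g : 'M[R]_n) (hg : \det g = 1) :
  flag_integral mu (mx_act g f) = flag_integral mu f.
Proof.
have n0 : (0 < n)%N by exact: ltnW.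
have [f0 /measurable_int/measurable_EFinP mf0 ff0] := fint.
rewrite (flag_integral_ae n0 hmu ff0) (flag_integral_ae n0 hmu (mx_act_ae hg ff0)).
exact: flag_integral_borel_act.
Qed.
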